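(* Let $K\subset\mathbb{R}^n$ be a closed convex set and $\mu_0\in K$. Then under $H_0$, i.e. when $Y=\mu_0+\xi$, $$d_{\mathrm{TV}}\left(\frac{T(Y)-m_{\mu_0}}{\sigma_{\mu_0}},\mathcal{N}(0,1)\right)\le \frac{8\sqrt{\mathbb{E}_{\mu_0}\|\hat\mu_K-\mu_0\|^2}}{2\|\mathbb{E}_{\mu_0}\hat\mu_K-\mu_0\|^2+\|\mathbb{E}_{\mu_0}J_{\hat\mu_K}\|_F^2}.$$
   Context: Model: $Y=\mu+\xi$ with $\mu\in\mathbb{R}^n$ and $\xi$ a standard Gaussian vector in $\mathbb{R}^n$; $\mathbb{E}_\mu,\mathrm{Var}_\mu$ refer to this model with mean $\mu$. $\|\cdot\|$ is the Euclidean norm on vectors and $\|\cdot\|_F$ the Frobenius norm on matrices. For a closed convex $K\subset\mathbb{R}^n$, $\Pi_K(x)=\arg\min_{y\in K}\|x-y\|^2$ is the metric projection (a $1$-Lipschitz map, hence a.e. differentiable), and $\hat\mu_K=\Pi_K(Y)$. The log-likelihood ratio statistic for $H_0:\mu=\mu_0$ versus $H_1:\mu\in K$ is $T(Y)=\|Y-\mu_0\|^2-\|Y-\hat\mu_K\|^2$, with $m_\mu=\mathbb{E}_\mu T(Y)$ and $\sigma_\mu^2=\mathrm{Var}_\mu(T(Y))$. Under $H_0$, $J_{\hat\mu_K}=J_{\Pi_K}(\mu_0+\xi)$ is the (a.e. defined) Jacobian matrix of $\Pi_K$ at $\mu_0+\xi$, and its expectation is taken entrywise. $d_{\mathrm{TV}}(X,Z)=\sup_{B\text{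 Borel}}|\mathbb{P}(X\in B)-\mathbb{P}(Z\in B)|$. Convention: $0/0=0$.
   Formalization: The case K = {μ0} (which includes n = 0) is excluded: there T(Y) = 0 and σ = 0, so with 0/0 = 0 the left-hand side is d_TV(δ_0, N(0,1)) = 1 while the right-hand side is 0/0 = 0, and the claim fails. *)

(* Defs.v *)
From HB Require Import structures.
From mathcomp Require Import all_boot all_order all_algebra.
From mathcomp Require Import all_classical all_reals all_analysis.

Set Implicit Arguments.
Unset Strict Implicit.
Unset Printing Implicit Defensive.

Import Order.TTheory GRing.Theory Num.Theory.
Import numFieldNormedType.Exports.

Local Open Scope classical_set_scope.
Local Open Scope ring_scope.

(* The norm [`|x|] of the normed module ['M_(m, n)] is the max norm, so the
   Euclidean and Frobenius norms are introduced separately.  The topology, hence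
   closedness and differentiability, is the same. *)
Definition enorm (R : realType) (n : nat) (x : 'rV[R]_n) : R :=
  Num.sqrt (\sum_(i < n) x ord0 i ^+ 2).

Definition fnorm (R : realType) (m n : nat) (A : 'M[R]_(m, n)) : R :=
  Num.sqrt (\sum_(i < m) \sum_(j < n) A i j ^+ 2).

Definition metric_proj (R : realType) (n : nat) (K : set 'rV[R]_n)
    (x : 'rV[R]_n) : 'rV[R]_n :=
  get [set y | K y /\ forall z, K z -> enorm (x - y) ^+ 2 <= enorm (x - z) ^+ 2].

Definition lrt_stat (R : realType) (n : nat) (K : set 'rV[R]_n)
    (mu0 y : 'rV[R]_n) : R :=
  enorm (y - mu0) ^+ 2 - enorm (y - metric_proj K y) ^+ 2.

(* Allowing [B i = setT] makes this the product rule for all finite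
   subfamilies. *)
Definition mutually_independent (R : realType) (d : measure_display)
    (T : measurableType d) (P : probability T R) (n : nat)
    (X : 'I_n -> T -> R) : Prop :=
  forall B : 'I_n -> set R, (forall i, measurable (B i)) ->
    P (\bigcap_i (X i @^-1` B i)) = (\prod_(i < n) P (X i @^-1` B i))%E.

(* Laws are compared on Borel sets only: a measure is a function on all sets
   whose values outside the sigma-algebra are irrelevant. *)
Definition standard_gaussian_vector (R : realType) (d : measure_display)
    (T : measurableType d) (P : probability T R) (n : nat)
    (xi : T -> 'rV[R]_n) : Prop :=
  [/\ forall i, measurable_fun [set: T] (fun w => xi w ord0 i),
      mutually_independent P (fun i w => xi w ord0 i) &
      forall i (B : set R), measurable B ->
        P ((fun w => xi w ord0 i) @^-1` B) = normal_prob 0 1 B].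

Definition expectation_mx (R : realType) (d : measure_display)
    (T : measurableType d) (P : probability T R) (m n : nat)
    (X : T -> 'M[R]_(m, n)) : 'M[R]_(m, n) :=
  \matrix_(i < m, j < n) fine 'E_P[fun w => X w i j].

Definition tv_dist (R : realType) (d : measure_display) (T : measurableType d)
    (mu nu : set T -> \bar R) : \bar R :=
  ereal_sup [set `|mu B - nu B|%E | B in [set B | measurable B]].

(* Main.v *)
Require Import Defs.
From HB Require Import structures.
From mathcomp Require Import all_boot all_order all_algebra.
From mathcomp Require Import all_classical all_reals all_analysis.
From mathcomp Require Import measurable_realfun.
From mathcomp Require Import ring lra.

Set Implicit Arguments.
Unset Strict Implicit.
Unset Printing Implicit Defensive.

Import Order.TTheory GRing.Theory Num.Theory.
Import numFieldNormedType.Exports.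

Local Open Scope classical_set_scope.
Local Open Scope ring_scope.

(** Let [F x] be the statistic at [mu0 + x] and [G x] the projection of
    [mu0 + x] recentred at [mu0]. As [K] is convex, [F] is differentiable with
    gradient [2 *: G], while [G] vanishes at [0] and is nonexpansive for the
    Euclidean norm; these are the properties on which the proof rests
    ([envelope]). Let [D] be the denominator of the bound, [v] the variance of
    [F x] for a standard Gaussian vector [x], and [W] the normalized statistic.

    The variance is at least [2 * D]: this is Bessel's inequality for the first
    two Gaussian chaoses, on which the coefficients of [F] are its mean gradient
    and its mean Hessian ([variance_lower_bound]).

    The distance is bounded by Stein's method. Averaging the gradient of [F]
    along the rotation from [x] to an independent copy gives a field [M] such
    that the covariance of [F] with any [H] is the mean of the scalar product of
    the gradient of [H] with [M] ([mehler]). Put [T = dotp (2 *: G) M]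
    ([covT]); its mean is [v]. If [h] takes values in the unit interval and [f]
    solves [f' x = x * f x + (h x - E h)], where [E h] is the Gaussian mean, then
    [|f'| <= 2] ([stein_solution]), and the covariance formula for [H = f W]
    bounds the difference between the mean of [h W] and [E h] by
    [2 * sqrt (Var T) / v] ([discrepancy_cts]). Now [M] is nonexpansive too, so
    the gradient of [T] is controlled by [G] and [M], and Poincare's inequality
    gives [Var T <= 64 * E |G|^2] ([variance_covT]). So the difference is at most
    [16 * sqrt (E |G|^2) / v <= 8 * sqrt (E |G|^2) / D]. It extends from
    continuous [h] to indicators of Borel sets because these are Baire functions
    ([Ex_indic_le]). If [D = 0], the right-hand side is infinite, as [G] is not
    identically zero.

    The calculus behind this rests on one fact: if [x] and [v] are independent
    standard Gaussian vectors, then rotating the pair by an angle [t], which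
    replaces [x] by [cos t *: x + sin t *: v], preserves its law
    ([rot_preserves]). Setting the derivative in [t] of an integral to zero is
    integration by parts ([rot_ibp], [gauss_ibp]); a rotation by a quarter turn
    gives the covariance formula and, cut into small steps, Poincare's inequality
    ([poincare]). As [G] is only Lipschitz, its Jacobian matrix has to be shown to
    exist almost everywhere. Rotating by a random angle reduces the existence of
    directional derivatives to functions of one real variable ([ae_qcauchy]),
    integration by parts shows that they depend linearly on the direction
    ([dird_linear]), and compactness makes them total derivatives
    ([rademacher]). *)

(** * Borel sets of the space of row vectors *)

Section borel_rv.
Context {R : realType}.

(** Open orthants generate the Borel sets, are stable under intersection and
    exhaust the space, so that two finite measures that agree on them are equal.
    Smooth approximations of their indicators are products of functions of one
    variable. *)
Definition orthant n (a : 'rV[R]_n) : set 'rV[R]_n :=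
  [set x | forall i, a ord0 i < x ord0 i].

Definition orthants n : set (set 'rV[R]_n) := range (@orthant n).

Definition rvm n := g_sigma_algebraType (@orthants n).

Lemma orthantI n (a b : 'rV[R]_n) :
  orthant a `&` orthant b = orthant (\row_i Num.max (a ord0 i) (b ord0 i)).
Proof.
apply/seteqP; split=> [x [ax bx] i|x abx].
  by rewrite mxE gt_max ax bx.
by split=> i; move: (abx i); rewrite mxE gt_max => /andP[].
Qed.

Lemma orthants_setI n : setI_closed (@orthants n).
Proof. by move=> _ _ [a _ <-] [b _ <-]; rewrite orthantI; exists (\row_i Num.max (a ord0 i) (b ord0 i)). Qed.

Lemma measurable_orthant n (a : 'rV[R]_n) : measurable (orthant a : set (rvm n)).
Proof. by apply: sub_sigma_algebra; exists a. Qed.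

Lemma bigcup_orthant n :
  \bigcup_k orthant (const_mx (- k%:R) : 'rV[R]_n) = setT.
Proof.
apply/seteqP; split=> // x _.
exists (Num.trunc (\sum_i `|x ord0 i|)).+1 => // i.
rewrite mxE ltrNl.
apply: (@le_lt_trans _ _ (\sum_i `|x ord0 i|)); last first.
  by apply: (proj2 (andP (truncn_itv _))); exact: sumr_ge0.
rewrite (bigD1 i) //= ler_wpDr ?sumr_ge0 // -normrN.
exact: ler_norm.
Qed.

Lemma rvm_measure_unique n (m1 m2 : {measure set (rvm n) -> \bar R}) :
  (forall a, m1 (orthant a) = m2 (orthant a)) -> (m1 setT < +oo)%E ->
  forall A : set (rvm n), measurable A -> m1 A = m2 A.
Proof.
move=> m12 m1fin A mA.
apply: (@measure_unique _ R (rvm n) (@orthants n)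
  (fun k => orthant (const_mx (- k%:R) : 'rV[R]_n))) => //.
- exact: orthants_setI.
- by move=> k; exists (const_mx (- k%:R)).
- exact: bigcup_orthant.
- by move=> _ [a _ <-]; exact: m12.
- move=> k; apply: le_lt_trans m1fin; apply: le_measure => //; rewrite inE.
  exact: measurable_orthant.
  exact: measurableT.
Qed.

Lemma measurable_rvm d (T : measurableType d) n (X : T -> 'rV[R]_n) :
  (forall i, measurable_fun setT (fun w => X w ord0 i)) ->
  measurable_fun setT (X : T -> rvm n).
Proof.
move=> mX; apply: (@measurability _ _ T (rvm n) setT X (@orthants n)) => //.
move=> _ [_ [a _ <-] <-]; rewrite setTI.
rewrite (_ : _ @^-1` _ =
    \bigcap_(i in [set: 'I_n]) ((fun w => X w ord0 i) @^-1` `]a ord0 i, +oo[)).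
  apply: fin_bigcap_measurable => // i _; rewrite -[X in measurable X]setTI.
  exact: mX.
apply/seteqP; split=> [w aw i _ /=|w aw i]; first by rewrite in_itv/= andbT aw.
by have := aw i Logic.I; rewrite /= in_itv/= andbT.
Qed.

(** A half-space is an increasing union of orthants. *)
Lemma measurable_coord n (i : 'I_n) :
  measurable_fun setT (fun x : rvm n => (x : 'rV[R]_n) ord0 i).
Proof.
apply: (measurability _ (RGenOInfty.measurableE R)) => //.
move=> _ [_ [a ->] <-]; rewrite setTI.
rewrite (_ : _ @^-1` _ = \bigcup_k orthant
    (\row_j (if j == i then a else - k%:R) : 'rV[R]_n)).
  by apply: bigcup_measurable => k _; exact: measurable_orthant.
apply/seteqP; split=> x /=.
  rewrite in_itv/= andbT => ax.
  have : setT (x : 'rV[R]_n) by [].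
  rewrite -bigcup_orthant => -[k _ xk]; exists k => // j; rewrite mxE.
  by case: eqVneq => [->//|_]; have := xk j; rewrite mxE.
by move=> [k _ /(_ i)]; rewrite mxE eqxx in_itv/= andbT.
Qed.

(** Every open set is a countable union of cubes with rational centre and
    radius, and cubes are intersections of preimages under coordinates. *)
Lemma measurable_cts n (H : 'rV[R]_n -> R) : continuous H ->
  measurable_fun setT (H : rvm n -> R).
Proof.
move=> cH; apply: (measurability _ (RGenOInfty.measurableE R)) => //.
move=> _ [_ [a ->] <-]; rewrite setTI.
have oU : open (H @^-1` `]a, +oo[).
  by move/continuousP : cH; apply; exact: interval_open.
pose cube (q : 'rV[rat]_n * rat) : set 'rV[R]_n :=
  [set x | forall i, `|x ord0 i - ratr (q.1 ord0 i)| < ratr q.2].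
pose F q := if `[< cube q `<=` H @^-1` `]a, +oo[ >] then cube q else set0.
rewrite (_ : _ @^-1` _ = \bigcup_q F q).
  apply: countable_bigcupT_measurable; first exact: countableP.
  move=> q; rewrite /F; case: ifP => // _.
  rewrite (_ : cube q = \bigcap_(i in [set: 'I_n])
     ((fun x : rvm n => (x : 'rV[R]_n) ord0 i) @^-1` `]ratr (q.1 ord0 i) - ratr q.2, ratr (q.1 ord0 i) + ratr q.2[)).
    apply: fin_bigcap_measurable => // i _; rewrite -[X in measurable X]setTI.
    exact: measurable_coord.
  apply/seteqP; split=> [x qx i _ /=|x qx i].
    by rewrite in_itv/= -ltr_distl qx.
  by have := qx i Logic.I; rewrite /= in_itv/= -ltr_distl.
apply/seteqP; split=> [x Ux|x [q _]]; last first.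
  rewrite /F; case: ifP; last by [].
  by move=> /asboolP + qx; apply.
have : nbhs x (H @^-1` `]a, +oo[) by apply: open_nbhs_nbhs; split.
move=> /nbhs_ballP[e /= e0 xeU].
have [r r0 re] : exists2 r : rat, 0 < ratr r :> R & ratr r < e / 2.
  have [|r] := @rat_in_itvoo R 0 (e / 2); first by rewrite divr_gt0.
  by rewrite in_itv/= => /andP[? ?]; exists r.
have qE i : {q : rat | `|x ord0 i - ratr q| < ratr r}.
  apply: cid; have [|q] := @rat_in_itvoo R (x ord0 i - ratr r) (x ord0 i + ratr r).
    by rewrite ltrBlDr -addrA ltrDl addr_gt0.
  by rewrite in_itv/= -ltr_distl distrC => ?; exists q.
exists (\row_i sval (qE i), r) => //; rewrite /F.
have xc : cube (\row_i sval (qE i), r) x by move=> i /=; rewrite mxE; case: (qE i).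
rewrite asboolT // => y yc; apply: xeU.
split=> // i j; rewrite (ord1 i) /ball /=.
have := yc j; have := xc j => /= h1 h2.
rewrite [e](splitr e).
have -> : x ord0 j - y ord0 j = (x ord0 j - ratr ((\row_i sval (qE i)) ord0 j)) - (y ord0 j - ratr ((\row_i sval (qE i)) ord0 j)) by ring.
apply: le_lt_trans (ler_normB _ _) _.
by rewrite ltrD // (lt_trans h1, lt_trans h2).
Qed.

End borel_rv.

(** * Rotation invariance of the standard Gaussian measure of the plane *)

(** Change of variables and uniqueness of measures apply to bundled measures. *)
Definition image_measure d d' (T1 : measurableType d) (T2 : measurableType d')
    (R : realType) (m : {measure set T1 -> \bar R}) (f : T1 -> T2)
    (mf : measurable_fun setT f) : {measure set T2 -> \bar R} :=
  measure_function_pushforward__canonical__measure_function_Measure m mf.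

Lemma image_measureE d d' (T1 : measurableType d) (T2 : measurableType d')
    (R : realType) (m : {measure set T1 -> \bar R}) (f : T1 -> T2)
    (mf : measurable_fun setT f) (A : set T2) :
  image_measure m mf A = m (f @^-1` A).
Proof. by []. Qed.

Section normal_integral.
Context {R : realType}.
Notation mu := (@lebesgue_measure R).

Lemma ge0_integral_normal_prob (f : measurableTypeR R -> \bar R) :
  measurable_fun setT f -> (forall x, 0 <= f x)%E ->
  (\int[normal_prob 0 1]_x f x =
   \int[mu]_x (f x * (normal_pdf 0 1 x)%:E))%E.
Proof.
move=> mf f0.
have dom : normal_prob 0 1 `<< mu := normal_prob_dominates 0 1.
rewrite -(Radon_Nikodym_SigmaFinite.change_of_variables dom)//.
apply: ae_eq_integral => //.
- apply: emeasurable_funM => //.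
  exact: measurable_int (Radon_Nikodym_SigmaFinite.f_integrable dom).
- apply: emeasurable_funM => //; apply/measurable_EFinP.
  exact: measurable_normal_pdf.
- apply: ae_eqe_mul2l; apply: integral_ae_eq => //.
  + exact: Radon_Nikodym_SigmaFinite.f_integrable.
  + by apply/measurable_EFinP; exact: measurable_normal_pdf.
  + by move=> A _ mA; rewrite -Radon_Nikodym_SigmaFinite.f_integral.
Qed.

(** Both sides are translation-scale images of a measure determined by its
    values on half-open intervals. *)
Lemma ge0_integral_affine (a b : R) (f : R -> \bar R) : 0 < a ->
  measurable_fun setT f -> (forall x, 0 <= f x)%E ->
  (\int[mu]_x f (a * x + b)%R = (a^-1)%:E * \int[mu]_x f x)%E.
Proof.
move=> a0 mf f0.
have mphi : measurable_fun setT (fun x : measurableTypeR R => (a * x + b) : measurableTypeR R).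
  by apply: measurable_funD => //; exact: measurable_funM.
have a0' : 0 <= a by exact: ltW.
pose m : {measure set (measurableTypeR R) -> \bar R} := mscale (NngNum a0') (image_measure mu mphi).
have muE A : measurable A -> mu A = m A.
  apply: lebesgue_measure_unique => _ [[x y] _ <-] /=.
  rewrite /m /mscale /= /pushforward.
  rewrite (_ : _ @^-1` _ = `](x - b) / a, (y - b) / a]%classic); last first.
    apply/seteqP; split=> z /=; rewrite !in_itv/= ltr_pdivrMr// ler_pdivlMr// [z * a]mulrC;
      by rewrite ltrBlDr lerBrDr.
  rewrite !lebesgue_measure_itv/= !lte_fin ltr_pM2r ?invr_gt0// ltrD2r.
  case: ifP => _; last by rewrite mule0.
  rewrite -!EFinD -EFinM; congr EFin; field.
  by rewrite gt_eqF.
rewrite [in RHS](eq_measure_integral m); last by move=> A mA _; exact: muE.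
rewrite ge0_integral_mscale//= (ge0_integral_pushforward mphi)//= preimage_setT.
by rewrite muleA -EFinM mulVf ?gt_eqF// mul1e.
Qed.

End normal_integral.

Section rotation_plane.
Context {R : realType}.
Notation mu := (@lebesgue_measure R).
Notation g1 := (@normal_prob R 0 1).
Notation MR := (measurableTypeR R).

(** The variables are substituted one at a time, first [x] by [c * x + s * y] at
    fixed [y], which needs [c] to be positive, then [y]; each substitution is
    affine. *)
Lemma lebesgue_rotation (c s : R) (K : MR * MR -> \bar R) : 0 < c ->
  c ^+ 2 + s ^+ 2 = 1 -> measurable_fun setT K -> (forall z, 0 <= K z)%E ->
  (\int[mu]_x \int[mu]_y K (c * x + s * y, - s * x + c * y)%R =
   \int[mu]_x \int[mu]_y K (x, y))%E.
Proof.
move=> c0 cs mK K0.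
have mlin (a b a' b' : R) : measurable_fun setT (fun z : MR * MR =>
    (a * z.1 + b * z.2, a' * z.1 + b' * z.2)).
  by apply: measurable_fun_pair; apply: measurable_funD; apply: measurable_funM.
rewrite (@fubini_tonelli _ _ _ _ _ mu mu (fun z : MR * MR => K (c * z.1 + s * z.2, - s * z.1 + c * z.2))) /=; last 2 first.
- exact: (measurableT_comp mK (mlin _ _ _ _)).
- by [].
transitivity (\int[mu]_y \int[mu]_x ((c^-1)%:E * K (x, c^-1 * (y - s * x))%R))%E.
  apply: eq_integral => y _.
  rewrite ge0_integralZl//; last 2 first.
  - apply: (measurableT_comp mK); apply: measurable_fun_pair => //.
    by apply: measurable_funM => //; apply: measurable_funB => //; exact: measurable_funM.
  - by rewrite lee_fin invr_ge0 ltW.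
  rewrite -(@ge0_integral_affine _ c (s * y) (fun x => K (x, c^-1 * (y - s * x))))//; last first.
    apply: (measurableT_comp mK); apply: measurable_fun_pair => //.
    by apply: measurable_funM => //; apply: measurable_funB => //; exact: measurable_funM.
  apply: eq_integral => x _; congr (K (_, _)).
  have -> : y - s * (c * x + s * y) = c * (- s * x + c * y).
    by rewrite -{1}[y]mul1r -cs; ring.
  by rewrite mulKf// lt0r_neq0.
rewrite (@fubini_tonelli _ _ _ _ _ mu mu (fun z : MR * MR => ((c^-1)%:E * K (z.2, c^-1 * (z.1 - s * z.2))%R)%E)) /=; last 2 first.
- apply: emeasurable_funM => //; apply: (measurableT_comp mK).
  apply: measurable_fun_pair => //.
  by apply: measurable_funM => //; apply: measurable_funB => //; exact: measurable_funM.
- by move=> z; rewrite mule_ge0// lee_fin invr_ge0 ltW.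
apply: eq_integral => x _.
have mKx : measurable_fun setT (fun y => K (x, y)).
  by apply: (measurableT_comp mK); exact: measurable_fun_pair.
rewrite ge0_integralZl//; last 2 first.
- apply: (measurableT_comp mKx).
  by apply: measurable_funM => //; apply: measurable_funB.
- by rewrite lee_fin invr_ge0 ltW.
transitivity ((c^-1)%:E * ((c^-1^-1)%:E * \int[mu]_y K (x, y)))%E.
  congr (_ * _)%E; rewrite -(@ge0_integral_affine _ c^-1 (- (c^-1 * s * x)))//; last by rewrite invr_gt0.
  by apply: eq_integral => y _; congr (K (_, _)); rewrite mulrBr mulrA.
by rewrite muleA -EFinM mulfV ?mul1e// invr_eq0 lt0r_neq0.
Qed.

Lemma normal_pdf_rotation (c s x y : R) : c ^+ 2 + s ^+ 2 = 1 ->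
  normal_pdf 0 1 x * normal_pdf 0 1 y =
  normal_pdf 0 1 (c * x + s * y) * normal_pdf 0 1 (- s * x + c * y).
Proof.
move=> cs; rewrite !normal_pdfE ?oner_neq0// /normal_fun !subr0 mulrACA [RHS]mulrACA.
congr (_ * _); rewrite -!expRD; congr expR.
set h := (1 ^+ 2 *+ 2)^-1.
transitivity (- ((c ^+ 2 + s ^+ 2) * (x ^+ 2 + y ^+ 2)) * h); last by ring.
by rewrite cs; ring.
Qed.

Lemma normal_rotation (c s : R) (A : set (MR * MR)) : 0 < c ->
  c ^+ 2 + s ^+ 2 = 1 -> measurable A ->
  ((g1 \x g1) ((fun z : MR * MR => (c * z.1 + s * z.2, - s * z.1 + c * z.2)%R : MR * MR) @^-1` A)
    = (g1 \x g1) A)%E.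
Proof.
move=> c0 cs mA.
have mlin (a b a' b' : R) : measurable_fun setT (fun z : MR * MR =>
    (a * z.1 + b * z.2, a' * z.1 + b' * z.2)).
  by apply: measurable_fun_pair; apply: measurable_funD; apply: measurable_funM.
have key (B : set (MR * MR)) : measurable B -> ((g1 \x g1) B =
    \int[mu]_x \int[mu]_y ((\1_B (x, y))%:E * (normal_pdf 0 1 x * normal_pdf 0 1 y)%:E))%E.
  move=> mB.
  rewrite -[X in (_ \x _)%E X](setTI B) setIC -integral_indic//= fubini_tonelli1//=; last by exact/measurable_EFinP.
  rewrite ge0_integral_normal_prob/=; last 2 first.
  - by apply: measurable_fun_fubini_tonelli_F => //; exact/measurable_EFinP.
  - by move=> x; apply: integral_ge0.
  apply: eq_integral => x _; rewrite /fubini_F/=.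
  have mBx : measurable_fun setT (fun y : MR => (\1_B (x, y) : R)).
    by apply: (@measurableT_comp _ _ _ _ _ _ (\1_B : MR * MR -> R)) => //; exact: measurable_fun_pair.
  rewrite ge0_integral_normal_prob//=; last by exact/measurable_EFinP.
  rewrite -ge0_integralZr//=.
  - by apply: eq_integral => y _; rewrite -muleA -EFinM [in X in (_ * X)%E]mulrC.
  - by apply: emeasurable_funM; apply/measurable_EFinP => //; exact: measurable_normal_pdf.
  - by move=> y _; rewrite mule_ge0// lee_fin normal_pdf_ge0.
  - by rewrite lee_fin normal_pdf_ge0.
have mA' := mlin c s (- s) c measurableT A mA; rewrite setTI in mA'.
rewrite (key _ mA) (key _ mA') {key}.
pose K (z : MR * MR) := ((\1_A z)%:E * (normal_pdf 0 1 z.1 * normal_pdf 0 1 z.2)%:E)%E.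
have mK : measurable_fun setT K.
  apply: emeasurable_funM; apply/measurable_EFinP => //.
  by apply: measurable_funM; apply: measurableT_comp => //; exact: measurable_normal_pdf.
have K0 z : (0 <= K z)%E.
  by rewrite mule_ge0// lee_fin mulr_ge0 ?normal_pdf_ge0.
apply: etrans (lebesgue_rotation c0 cs mK K0).
apply: eq_integral => x _; apply: eq_integral => y _; rewrite /K /=.
by congr (_ * _%:E)%E; exact: normal_pdf_rotation.
Qed.

End rotation_plane.

(** * The standard Gaussian measure and rotations *)

Section gaussian_measure.
Context {R : realType}.
Local Notation V := (@rvm R).

(** Uniqueness is applied to one factor at a time, the other one being
    confined to a measurable set. *)
Lemma prod_rvm_measure_unique n p
    (m1 m2 : {measure set (V n * V p) -> \bar R}) :
  (forall a b, m1 (orthant a `*` orthant b) = m2 (orthant a `*` orthant b)) ->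
  (m1 setT < +oo)%E ->
  forall A, measurable A -> m1 A = m2 A.
Proof.
move=> m12 m1fin A mA.
have m1lt B : measurable B -> (m1 B < +oo)%E.
  by move=> mB; apply: le_lt_trans m1fin; apply: le_measure => //; rewrite inE//; exact: measurableT.
have st1 b (B : set (V n)) : measurable B ->
    m1 (B `*` orthant b) = m2 (B `*` orthant b).
  move=> mB.
  have mD : measurable (setT `*` orthant b : set (V n * V p)).
    by apply: measurableX => //; exact: measurable_orthant.
  have E (X : set (V n)) :
      fst @^-1` X `&` (setT `*` orthant b : set (V n * V p)) = X `*` orthant b.
    by apply/seteqP; split=> z /=; [case=> ? [] | case].
  have mf : measurable_fun setT (@fst (V n) (V p)) by exact: measurable_fst.
  have : image_measure (mrestr m1 mD) mf B = image_measure (mrestr m2 mD) mf B.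
    apply: rvm_measure_unique => //.
      by move=> a; exact: etrans (congr1 m1 (E _)) (etrans (m12 _ _) (esym (congr1 m2 (E _)))).
    by apply: m1lt; apply: measurableI => //; exact: measurableT.
  by move=> h; exact: etrans (esym (congr1 m1 (E _))) (etrans h (congr1 m2 (E _))).
apply: (@measure_unique _ R _ [set A1 `*` A2 | A1 in measurable & A2 in measurable]
  (fun=> setT)) => //.
- exact: measurable_prod_measurableType.
- by move=> _ _ [A1 mA1 [A2 mA2 <-]] [B1 mB1 [B2 mB2 <-]]; rewrite -setXI;
    exists (A1 `&` B1); [exact: measurableI|exists (A2 `&` B2) => //; exact: measurableI].
- by move=> _; exists setT => //; exists setT => //; rewrite setXTT.
- by rewrite bigcup_const//; exists 0%N.
- move=> _ [B mB [C mC <-]].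
  have mD : measurable (B `*` setT : set (V n * V p)) by exact: measurableX.
  have E (X : set (V p)) :
      snd @^-1` X `&` (B `*` setT : set (V n * V p)) = B `*` X.
    by apply/seteqP; split=> z /=; [case=> ? [] | case].
  have mf : measurable_fun setT (@snd (V n) (V p)) by exact: measurable_snd.
  have : image_measure (mrestr m1 mD) mf C = image_measure (mrestr m2 mD) mf C.
    apply: rvm_measure_unique => //.
      by move=> a; exact: etrans (congr1 m1 (E _)) (etrans (st1 _ _ mB) (esym (congr1 m2 (E _)))).
    by apply: m1lt; apply: measurableI => //; exact: measurableT.
  by move=> h; exact: etrans (esym (congr1 m1 (E _))) (etrans h (congr1 m2 (E _))).
Qed.

(** The law of a pair of independent vectors with law [g]. *)
Definition psq n (g : probability (V n) R) : probability (V n * V n)%type R :=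
  (g \x g)%E.

Definition box n (B : 'I_n -> set R) : set 'rV[R]_n :=
  [set x | forall i, B i (x ord0 i)].

Lemma measurable_box n (B : 'I_n -> set R) : (forall i, measurable (B i)) ->
  measurable (box B : set (V n)).
Proof.
move=> mB; rewrite (_ : box B = \bigcap_(i in [set: 'I_n])
    ((fun x : rvm n => (x : 'rV[R]_n) ord0 i) @^-1` B i)).
  apply: fin_bigcap_measurable => // i _; rewrite -[X in measurable X]setTI.
  exact: measurable_coord.
by apply/seteqP; split=> x; [move=> h i _; exact: h|move=> h i; exact: h].
Qed.

Definition std_gaussian n (g : set (V n) -> \bar R) : Prop :=
  forall B : 'I_n -> set R, (forall i, measurable (B i)) ->
    g (box B) = (\prod_(i < n) normal_prob 0 1 (B i))%E.

(** The rotation by an angle of cosine [c] and sine [s] in the plane of the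
    [j]-th coordinates of the two vectors, for all [j] in [J]. *)
Definition rotc n (c s : R) (J : pred 'I_n) (z : V n * V n) : V n * V n :=
  (\row_i (if J i then c * (z.1 : 'rV[R]_n) ord0 i + s * (z.2 : 'rV[R]_n) ord0 i else (z.1 : 'rV[R]_n) ord0 i),
   \row_i (if J i then - s * (z.1 : 'rV[R]_n) ord0 i + c * (z.2 : 'rV[R]_n) ord0 i else (z.2 : 'rV[R]_n) ord0 i)).

Lemma measurable_coord1 n i :
  measurable_fun setT (fun z : V n * V n => (z.1 : 'rV[R]_n) ord0 i).
Proof. exact: (measurableT_comp (measurable_coord i) measurable_fst). Qed.

Lemma measurable_coord2 n i :
  measurable_fun setT (fun z : V n * V n => (z.2 : 'rV[R]_n) ord0 i).
Proof. exact: (measurableT_comp (measurable_coord i) measurable_snd). Qed.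

Lemma measurable_rotc c s n J : measurable_fun setT (@rotc n c s J).
Proof.
apply: measurable_fun_pair; apply: measurable_rvm => i.
  under eq_fun do rewrite mxE; case: (J i); last exact: measurable_coord1.
  apply: measurable_funD; apply: measurable_funM => //.
    exact: measurable_coord1.
  exact: measurable_coord2.
under eq_fun do rewrite mxE; case: (J i); last exact: measurable_coord2.
apply: measurable_funD; apply: measurable_funM => //.
  exact: measurable_coord1.
exact: measurable_coord2.
Qed.

(** With the other coordinates confined to rays, the joint law of the two
    [j]-th coordinates is a multiple of the plane Gaussian measure. *)
Lemma rotc1_preserves c s n (g : probability (V n) R) (j : 'I_n) :
  std_gaussian g -> 0 < c -> c ^+ 2 + s ^+ 2 = 1 ->
  forall A, measurable A ->
    psq g (rotc c s (pred1 j) @^-1` A) = psq g A.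
Proof.
move=> gg c0 cs A mA.
have mr : measurable_fun setT (@rotc n c s (pred1 j)) by exact: measurable_rotc.
apply/esym; apply: (prod_rvm_measure_unique (m1 := psq g) (m2 := image_measure (psq g) mr)) => //; last first.
  by exact: (eq_ind_r (fun x => (x < +oo)%E) (ltry 1) (probability_setT (psq g))).
move=> a b; rewrite image_measureE.
pose Ba (C : set R) i := if i == j then C else `]a ord0 i, +oo[%classic.
pose Bb (C : set R) i := if i == j then C else `]b ord0 i, +oo[%classic.
have mBa C : measurable C -> forall i, measurable (Ba C i).
  by move=> mC i; rewrite /Ba; case: ifP.
have mBb C : measurable C -> forall i, measurable (Bb C i).
  by move=> mC i; rewrite /Bb; case: ifP.
pose p : V n * V n -> measurableTypeR R * measurableTypeR R :=
  fun z => ((z.1 : 'rV[R]_n) ord0 j, (z.2 : 'rV[R]_n) ord0 j).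
have mp : measurable_fun setT p.
  by apply: measurable_fun_pair; [exact: measurable_coord1|exact: measurable_coord2].
pose D : set (V n * V n) := box (Ba setT) `*` box (Bb setT).
have mD : measurable D.
  by apply: measurableX; apply: measurable_box; [exact: mBa|exact: mBb].
pose m' := image_measure (mrestr (psq g) mD) mp.
have m'def S : m' S = psq g (p @^-1` S `&` D) by [].
pose ka := (\prod_(i < n | i != j) normal_prob 0 1 `]a ord0 i, +oo[%classic)%E.
pose kb := (\prod_(i < n | i != j) normal_prob 0 1 `]b ord0 i, +oo[%classic)%E.
have prodE (B : set R) (x : 'rV[R]_n) :
    (\prod_(i < n) normal_prob 0 1 (if i == j then B else `]x ord0 i, +oo[%classic) =
     normal_prob 0 1 B * \prod_(i < n | i != j) normal_prob 0 1 `]x ord0 i, +oo[%classic)%E.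
  rewrite (bigD1 j)//= eqxx; congr (_ * _)%E.
  by apply: eq_bigr => i /negbTE ->.
have m'E (B C : set R) : measurable B -> measurable C ->
    m' (B `*` C) = (normal_prob 0 1 B * normal_prob 0 1 C * (ka * kb))%E.
  move=> mB mC; rewrite m'def.
  transitivity (psq g (box (Ba B) `*` box (Bb C))).
    congr (psq g _); apply/seteqP; split=> [[x y] /= [[xB yC] [xD yD]]|[x y] /= [xD yD]].
      split=> i; [have := xD i; rewrite /Ba|have := yD i; rewrite /Bb];
        by case: eqP => // ->.
    split; first by split; [have := xD j; rewrite /Ba eqxx|have := yD j; rewrite /Bb eqxx].
    by split=> i; [have := xD i; rewrite /Ba|have := yD i; rewrite /Bb]; case: eqP.
  rewrite [LHS]product_measure1E; last 2 first.
  - by apply: measurable_box; exact: mBa.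
  - by apply: measurable_box; exact: mBb.
  apply: (etrans (congr2 mule (gg _ (mBa _ mB)) (gg _ (mBb _ mC)))).
  by rewrite !prodE muleACA.
have kfin : (ka * kb)%E \is a fin_num.
  by rewrite fin_numM//; apply: prode_fin_num => i _; rewrite fin_num_measure.
have k0 : (0 <= ka * kb)%E.
  by apply: mule_ge0; apply: prode_ge0 => i _; exact: measure_ge0.
have k0' : 0 <= fine (ka * kb)%E by exact: fine_ge0.
have m'P (C : set (measurableTypeR R * measurableTypeR R)) : measurable C ->
    m' C = ((normal_prob 0 1 \x normal_prob 0 1) C * (ka * kb))%E.
  move=> mC.
  pose m2 : {measure set (measurableTypeR R * measurableTypeR R) -> \bar R} :=
    mscale (NngNum k0') (normal_prob 0 1 \x normal_prob 0 1)%E.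
  transitivity (m2 C); last by rewrite /m2 /= /mscale /= fineK// muleC.
  apply: (@measure_unique _ R _ [set A1 `*` A2 | A1 in measurable & A2 in measurable]
    (fun=> setT)) => //.
  - exact: measurable_prod_measurableType.
  - by move=> _ _ [A1 mA1 [A2 mA2 <-]] [B1 mB1 [B2 mB2 <-]]; rewrite -setXI;
      exists (A1 `&` B1); [exact: measurableI|exists (A2 `&` B2) => //; exact: measurableI].
  - by move=> _; exists setT => //; exists setT => //; rewrite setXTT.
  - by rewrite bigcup_const//; exists 0%N.
  - move=> _ [B mB [C' mC' <-]]; rewrite m'E// /m2 /= /mscale /= fineK// muleC.
    by rewrite product_measure1E.
  - by move=> _; rewrite -setXTT m'E// !probability_setT !mul1e -ge0_fin_numE.
have rpD (C : set (measurableTypeR R * measurableTypeR R)) : measurable C ->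
  m' ((fun z => (c * z.1 + s * z.2, - s * z.1 + c * z.2)%R) @^-1` C) = m' C.
  move=> mC; rewrite !m'P ?normal_rotation//.
  rewrite -[X in measurable X]setTI.
  by apply: measurable_fun_pair => //; apply: measurable_funD; apply: measurable_funM.
have h := rpD (`]a ord0 j, +oo[ `*` `]b ord0 j, +oo[).
have {}h := h (measurableX (measurable_itv _) (measurable_itv _)).
rewrite !m'def in h.
rewrite (_ : orthant a `*` orthant b =
    p @^-1` (`]a ord0 j, +oo[%classic `*` `]b ord0 j, +oo[%classic) `&` D).
  apply: (etrans (esym h)); congr (psq g _); apply/seteqP; split=> -[x y] /=.
    rewrite !mxE eqxx => -[xy [xD yD]]; split=> //.
    by split=> i; [have := xD i; rewrite /Ba|have := yD i; rewrite /Bb];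
      rewrite mxE /=; case: eqP.
  rewrite !mxE eqxx => -[xy [xD yD]]; split=> //.
  by split=> i; [have := xD i; rewrite /Ba|have := yD i; rewrite /Bb];
    rewrite mxE /=; case: eqP.
apply/seteqP; split=> -[x y] /=.
  move=> [xa yb]; split.
    by split; [have := xa j|have := yb j]; rewrite in_itv/= andbT.
  by split=> i; [have := xa i; rewrite /Ba|have := yb i; rewrite /Bb];
    case: eqP => //= _; rewrite in_itv/= andbT.
move=> [[xj yj] [xD yD]]; split=> i.
  have := xD i; rewrite /Ba; case: eqP => [-> _|_ /=]; last by rewrite in_itv/= andbT.
  by move: xj; rewrite in_itv/= andbT.
have := yD i; rewrite /Bb; case: eqP => [-> _|_ /=]; last by rewrite in_itv/= andbT.
by move: yj; rewrite in_itv/= andbT.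
Qed.

Definition rot n (c s : R) (z : V n * V n) : V n * V n :=
  (c *: (z.1 : 'rV[R]_n) + s *: (z.2 : 'rV[R]_n),
   - s *: (z.1 : 'rV[R]_n) + c *: (z.2 : 'rV[R]_n)).

Lemma rotcT c s n (z : V n * V n) : rotc c s predT z = rot c s z.
Proof. by congr pair; apply/rowP => i; rewrite !mxE. Qed.

Lemma measurable_rot c s n : measurable_fun setT (@rot n c s).
Proof.
rewrite (_ : @rot n c s = rotc c s predT); first exact: measurable_rotc.
by apply/funext => z; rewrite rotcT.
Qed.

(** Rotating both vectors rotates the pairs of their [i]-th coordinates, one
    plane after the other. *)
Lemma rot_preserves c s n (g : probability (V n) R) :
  std_gaussian g -> 0 < c -> c ^+ 2 + s ^+ 2 = 1 ->
  forall A, measurable A -> psq g (rot c s @^-1` A) = psq g A.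
Proof.
move=> gg c0 cs A mA.
have H k : psq g (rotc c s (fun i : 'I_n => (i < k)%N) @^-1` A) = psq g A.
  elim: k => [|k IH].
    congr (psq g _); rewrite (_ : rotc _ _ _ = id)//.
    by apply/funext => -[x y]; congr pair; apply/rowP => i; rewrite mxE.
  have [kn|nk] := ltnP k n; last first.
    rewrite (_ : (fun i : 'I_n => _) = (fun i : 'I_n => (i < k)%N))//.
    apply/funext => i; rewrite !(leq_trans (ltn_ord i))//.
    exact: (leq_trans nk).
  have mS : measurable (rotc c s (fun i : 'I_n => (i < k)%N) @^-1` A).
    by rewrite -[X in measurable X]setTI; exact: measurable_rotc.
  apply: etrans IH; rewrite -(rotc1_preserves (Ordinal kn) gg c0 cs mS).
  suff -> : rotc c s (fun i : 'I_n => (i < k.+1)%N) =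
      rotc c s (fun i : 'I_n => (i < k)%N) \o rotc c s (pred1 (Ordinal kn)) by [].
  apply/funext => -[x y] /=; congr pair; apply/rowP => i; rewrite !mxE/=.
    rewrite ltnS leq_eqVlt -[(i == k :> nat)]/(i == Ordinal kn).
    by case: (eqVneq i (Ordinal kn)) => [->|_] /=; rewrite ?ltnn//; case: ifP.
  rewrite ltnS leq_eqVlt -[(i == k :> nat)]/(i == Ordinal kn).
  by case: (eqVneq i (Ordinal kn)) => [->|_] /=; rewrite ?ltnn//; case: ifP.
rewrite -(H n) (_ : rot c s = rotc c s (fun i : 'I_n => (i < n)%N))//.
apply/funext => z.
by rewrite -rotcT; congr rotc; apply/funext => i; rewrite ltn_ord.
Qed.

End gaussian_measure.

(** * Real-valued expectations *)

Lemma aeS (R : realType) d (T : measurableType d) (P : probability T R) (p q : T -> Prop) :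
  (forall x, p x -> q x) -> {ae P, forall x, p x} -> {ae P, forall x, q x}.
Proof. by move=> pq; exact: (@filterS _ _ (ae_filter_ringOfSetsType P)). Qed.

Lemma aeS2 (R : realType) d (T : measurableType d) (P : probability T R) (p1 p2 q : T -> Prop) :
  (forall x, p1 x -> p2 x -> q x) -> {ae P, forall x, p1 x} -> {ae P, forall x, p2 x} ->
  {ae P, forall x, q x}.
Proof. by move=> pq; exact: (@filterS2 _ _ (ae_filter_ringOfSetsType P)). Qed.

Section expectation.
Context {R : realType} {d : measure_display} {T : measurableType d}.
Variable P : probability T R.
Implicit Types f g h : T -> R.

Definition intg f : Prop := P.-integrable setT (EFin \o f).

Definition Ex f : R := (\int[P]_x f x)%R.

Lemma intg_meas f : intg f -> measurable_fun setT f.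
Proof. by move=> /integrableP[/measurable_EFinP]. Qed.

Lemma intg_le f h : measurable_fun setT f -> (forall x, `|f x| <= h x) ->
  intg h -> intg f.
Proof.
move=> mf fh ih; apply: (le_integrable measurableT _ _ ih).
  exact/measurable_EFinP.
move=> x _ /=; rewrite lee_fin (le_trans (fh x))//; exact: ler_norm.
Qed.

Lemma intg_cst c : intg (cst c).
Proof. exact: finite_measure_integrable_cst. Qed.

Lemma intgD f g : intg f -> intg g -> intg (fun x => f x + g x).
Proof. by move=> i j; have := integrableD measurableT i j. Qed.

Lemma intgZ c f : intg f -> intg (fun x => c * f x).
Proof. by move=> i; have := integrableZl measurableT c i. Qed.

Lemma intgN f : intg f -> intg (fun x => - f x).
Proof. by move=> i; have := integrableN i. Qed.

Lemma intgB f g : intg f -> intg g -> intg (fun x => f x - g x).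
Proof. by move=> i j; have := integrableB measurableT i j. Qed.

Lemma intg_abs f : intg f -> intg (fun x => `|f x|).
Proof.
move=> i; apply: (le_integrable measurableT _ _ i).
  by apply/measurable_EFinP; apply: measurableT_comp => //; exact: intg_meas.
by move=> x _ /=; rewrite normr_id.
Qed.

Lemma intg_sum (I : finType) (F : I -> T -> R) : (forall i, intg (F i)) ->
  intg (fun x => \sum_i F i x).
Proof.
move=> iF; rewrite /intg (_ : _ \o _ = fun x => \sum_i (F i x)%:E)%E.
  by apply: integrable_sum => // i _; exact: iF.
by apply/funext => x; rewrite /= sumEFin.
Qed.

Lemma eq_Ex f g : f =1 g -> Ex f = Ex g.
Proof. by move=> fg; apply: eq_Rintegral => x _; rewrite fg. Qed.

Lemma Ex_cst c : Ex (cst c) = c.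
Proof. by rewrite /Ex Rintegral_cst//= probability_setT mulr1. Qed.

Lemma ExD f g : intg f -> intg g -> Ex (fun x => f x + g x) = Ex f + Ex g.
Proof. by move=> *; exact: RintegralD. Qed.

Lemma ExB f g : intg f -> intg g -> Ex (fun x => f x - g x) = Ex f - Ex g.
Proof. by move=> *; exact: RintegralB. Qed.

Lemma ExZ c f : intg f -> Ex (fun x => c * f x) = c * Ex f.
Proof. by move=> *; exact: RintegralZl. Qed.

Lemma ExN f : intg f -> Ex (fun x => - f x) = - Ex f.
Proof.
move=> i; rewrite -mulN1r -ExZ//; apply: eq_Ex => x; by rewrite mulN1r.
Qed.

Lemma ExE f : intg f -> (\int[P]_x (f x)%:E)%E = (Ex f)%:E.
Proof. by move=> i; rewrite /Ex /Rintegral fineK//; exact: integrable_fin_num. Qed.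

Lemma Ex_sum (I : finType) (F : I -> T -> R) : (forall i, intg (F i)) ->
  Ex (fun x => \sum_i F i x) = \sum_i Ex (F i).
Proof.
move=> iF; rewrite /Ex /Rintegral.
under eq_integral do rewrite -sumEFin.
rewrite (integral_sum measurableT)//.
by under eq_bigr do rewrite (ExE (iF _)); rewrite sumEFin.
Qed.

Lemma Ex_le f g : intg f -> intg g -> (forall x, f x <= g x) -> Ex f <= Ex g.
Proof. by move=> *; apply: le_Rintegral. Qed.

Lemma Ex_ge0 f : (forall x, 0 <= f x) -> 0 <= Ex f.
Proof. by move=> f0; apply: Rintegral_ge0. Qed.

Lemma Ex_norm f : intg f -> `|Ex f| <= Ex (fun x => `|f x|).
Proof. by move=> i; exact: le_normr_Rintegral. Qed.

Lemma Ex_ae f g : measurable_fun setT f -> measurable_fun setT g ->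
  {ae P, forall x, f x = g x} -> Ex f = Ex g.
Proof.
move=> mf mg fg; congr fine; apply: ae_eq_integral => //; try exact/measurable_EFinP.
by apply: filterS fg => x /= -> _.
Qed.

(** Dominated convergence, in real-valued form. *)
Lemma Ex_cvg (F : nat -> T -> R) f h : (forall k, measurable_fun setT (F k)) ->
  measurable_fun setT f ->
  {ae P, forall x, F ^~ x @ \oo --> f x} ->
  {ae P, forall x k, `|F k x| <= h x} -> intg h ->
  intg f /\ Ex (F k) @[k --> \oo] --> Ex f.
Proof.
move=> mF mf Ff Fh ih.
have [] := @dominated_convergence _ T R P setT measurableT
  (fun k => EFin \o F k) (EFin \o f) (EFin \o h).
- by move=> k; apply/measurable_EFinP.
- by apply/measurable_EFinP.
- apply: filterS Ff => x Ffx _ /=; by apply: cvg_EFin => //; exact: nearW.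
- exact: ih.
- by apply: filterS Fh => x Fhx k _; rewrite /= lee_fin.
move=> if_ _ c; split => //.
have := fine_cvg; rewrite /Ex /Rintegral => fc; apply: fc.
by rewrite fineK; [exact: c|exact: integrable_fin_num].
Qed.

Lemma intg_ae_le f h : measurable_fun setT f -> {ae P, forall x, `|f x| <= h x} ->
  intg h -> intg f.
Proof.
move=> mf fh ih; have := @Ex_cvg (fun=> f) f h (fun=> mf) mf.
case=> //; first by apply: aeW => x; exact: cvg_cst.
by apply: aeS fh.
Qed.

Lemma intg_mul f g : measurable_fun setT f -> measurable_fun setT g ->
  intg (fun x => f x ^+ 2) -> intg (fun x => g x ^+ 2) -> intg (fun x => f x * g x).
Proof.
move=> mf mg if2 ig2.
apply: (@intg_le _ (fun x => f x ^+ 2 + g x ^+ 2)); last exact: intgD.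
  exact: measurable_funM.
move=> x; rewrite normrM.
have := sqr_ge0 (`|f x| - `|g x|); have := real_normK (num_real (f x)).
have := real_normK (num_real (g x)) => <- <-.
have := mulr_ge0 (normr_ge0 (f x)) (normr_ge0 (g x)).
set a := `|f x|; set b := `|g x|; rewrite sqrrB => ab h.
by move: ab h; rewrite mulr2n; clearbody a b; lra.
Qed.

Lemma Ex_CS f g : measurable_fun setT f -> measurable_fun setT g ->
  intg (fun x => f x ^+ 2) -> intg (fun x => g x ^+ 2) ->
  Ex (fun x => f x * g x) ^+ 2 <= Ex (fun x => f x ^+ 2) * Ex (fun x => g x ^+ 2).
Proof.
move=> mf mg if2 ig2; have ifg := intg_mul mf mg if2 ig2.
set a := Ex (fun x => f x ^+ 2); set b := Ex (fun x => f x * g x); set c := Ex (fun x => g x ^+ 2).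
have Q t : 0 <= a - 2 * t * b + t ^+ 2 * c.
  have -> : a - 2 * t * b + t ^+ 2 * c = Ex (fun x => (f x - t * g x) ^+ 2).
    rewrite -!ExZ// -ExB//; last exact: intgZ.
    rewrite -ExD//; [|by apply: intgB => //; exact: intgZ|exact: intgZ].
    by apply: eq_Ex => x; ring.
  by apply: Ex_ge0 => x; exact: sqr_ge0.
have a0 : 0 <= a by apply: Ex_ge0 => x; exact: sqr_ge0.
have c0 : 0 <= c by apply: Ex_ge0 => x; exact: sqr_ge0.
have [c00|cn0] := eqVneq c 0.
  have [->|b0] := eqVneq b 0; first by rewrite expr0n/= mulr_ge0.
  have := Q ((a + 1) / (2 * b)); rewrite c00 mulr0 addr0.
  have -> : a - 2 * ((a + 1) / (2 * b)) * b = - 1 by field.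
  by rewrite oppr_ge0 ler10.
have cp : 0 < c by rewrite lt_def cn0.
have := Q (b / c).
have -> : a - 2 * (b / c) * b + (b / c) ^+ 2 * c = (a * c - b ^+ 2) / c by field.
by rewrite pmulr_lge0 ?invr_gt0// subr_ge0.
Qed.

Lemma Ex_sqr_le f : measurable_fun setT f -> intg (fun x => f x ^+ 2) ->
  Ex f ^+ 2 <= Ex (fun x => f x ^+ 2).
Proof.
move=> mf if2; have := @Ex_CS f (cst 1) mf _ if2.
have -> : (fun x : T => (cst 1 x : R) ^+ 2) = cst 1 by apply/funext => x; rewrite /= expr1n.
rewrite Ex_cst mulr1 => /(_ _ (intg_cst _)); rewrite (_ : (fun x => f x * _) = f).
  by apply; exact: measurable_cst.
by apply/funext => x; rewrite /= mulr1.
Qed.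

End expectation.

Lemma Ex_image (R : realType) d1 d2 (T1 : measurableType d1) (T2 : measurableType d2)
    (P : probability T1 R) (Q : probability T2 R) (X : T1 -> T2) (f : T2 -> R) :
  measurable_fun setT X -> (forall A, measurable A -> P (X @^-1` A) = Q A) ->
  intg Q f -> intg P (f \o X) /\ Ex P (f \o X) = Ex Q f.
Proof.
move=> mX PX if_; have mf := intg_meas if_.
have E (h : T2 -> \bar R) : measurable_fun setT h -> (forall x, 0 <= h x)%E ->
    (\int[P]_x h (X x) = \int[Q]_x h x)%E.
  move=> mh h0; rewrite [in RHS](eq_measure_integral (image_measure P mX)).
    by rewrite [in RHS]ge0_integral_pushforward// preimage_setT.
  by move=> A mA _; rewrite image_measureE; apply/esym; exact: PX.
have ifp : intg P (f \o X).
  apply/integrableP; split.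
    apply/measurable_EFinP; exact: (measurableT_comp mf mX).
  rewrite (E (fun x => `|(f x)%:E|)%E)//.
    by case/integrableP : if_.
  by apply: measurableT_comp => //; exact/measurable_EFinP.
split=> //; congr fine.
rewrite [in RHS](eq_measure_integral (image_measure P mX)).
  by rewrite [in RHS](integral_pushforward mX)//; exact/measurable_EFinP.
by move=> A mA _; rewrite image_measureE; apply/esym; exact: PX.
Qed.

Section fubini.
Context {R : realType} d1 d2 (T1 : measurableType d1) (T2 : measurableType d2).
Variables (P : probability T1 R) (Q : probability T2 R).
Implicit Types f : T1 * T2 -> R.
Notation PQ := (P \x Q : probability (T1 * T2)%type R)%E.

Lemma ae_fst (p : T1 -> Prop) : {ae P, forall x, p x} -> {ae PQ, forall z, p z.1}.
Proof.
move=> [N [mN N0 HN]]; exists (N `*` setT); split.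
- exact: measurableX.
- by rewrite /= product_measure1E// [X in (X * _)%E]N0 mul0e.
- by move=> z /= pz; split=> //; apply: HN.
Qed.

Lemma ae_snd (p : T2 -> Prop) : {ae Q, forall x, p x} -> {ae PQ, forall z, p z.2}.
Proof.
move=> [N [mN N0 HN]]; exists (setT `*` N); split.
- exact: measurableX.
- by rewrite /= product_measure1E// [X in (_ * X)%E]N0 mule0.
- by move=> z /= pz; split=> //; apply: HN.
Qed.

Lemma intg_fubini f : intg PQ f ->
  {ae P, forall x, intg Q (fun y => f (x, y))}.
Proof. by move=> i; exact: (ae_integrable1 i). Qed.

(** The inner integral may diverge on a null set, where [Ex] takes a default
    value. *)
Lemma Ex_fubini f : intg PQ f ->
  intg P (fun x => Ex Q (fun y => f (x, y))) /\
  Ex PQ f = Ex P (fun x => Ex Q (fun y => f (x, y))).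
Proof.
move=> i.
have iF := integrable_fubini_F i.
have aeE : {ae P, forall x, (fubini_F Q (EFin \o f) x) = (Ex Q (fun y => f (x, y)))%:E}.
  by apply: filterS (intg_fubini i) => x ix; rewrite -(ExE ix).
have mE : measurable_fun setT (fun x => Ex Q (fun y => f (x, y))).
  apply: (measurableT_comp (fine_measurable measurableT)) => //.
  exact: (measurable_fubini_F i).
split.
  apply/integrableP; split; first exact/measurable_EFinP.
  case/integrableP : iF => mF; apply: le_lt_trans.
  rewrite le_eqVlt; apply/orP; left; apply/eqP; apply: ae_eq_integral => //.
  - by apply: measurableT_comp => //; exact/measurable_EFinP.
  - exact: measurableT_comp.
  - by apply: filterS aeE => x /= -> _.
congr fine; rewrite -[LHS](integral12_prod_meas1 i).
apply: ae_eq_integral => //.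
- exact: (measurable_fubini_F i).
- exact/measurable_EFinP.
- by apply: filterS aeE => x /= -> _.
Qed.

Lemma Ex_fubiniC f : intg PQ f ->
  intg Q (fun y => Ex P (fun x => f (x, y))) /\
  Ex PQ f = Ex Q (fun y => Ex P (fun x => f (x, y))).
Proof.
move=> i.
have mf : measurable_fun setT (EFin \o f) by exact: measurable_int i.
have iG : Q.-integrable setT (fubini_G P (EFin \o f)).
  apply/integrableP; split; first exact: (measurable_fubini_G i).
  apply: le_lt_trans ((integrable21ltyP _ _ mf).1 i).
  apply: ge0_le_integral => //=.
  - by apply: measurableT_comp => //; exact: (measurable_fubini_G i).
  - apply: (measurable_fun_fubini_tonelli_G (m1 := P) (fun z => `|(f z)%:E|%E)) => //.
    exact: measurableT_comp.
  - move=> y _; apply: le_abse_integral => //.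
    exact: measurableT_comp.
have aeE : {ae Q, forall y, (fubini_G P (EFin \o f) y) = (Ex P (fun x => f (x, y)))%:E}.
  apply: filterS (ae_integrable2 i) => x ix.
  by rewrite -(@ExE _ _ _ P (fun y => f (y, x)) ix).
have mE : measurable_fun setT (fun y => Ex P (fun x => f (x, y))).
  apply: (measurableT_comp (fine_measurable measurableT)) => //.
  exact: (measurable_fubini_G i).
split.
  apply/integrableP; split; first exact/measurable_EFinP.
  case/integrableP : iG => mG; apply: le_lt_trans.
  rewrite le_eqVlt; apply/orP; left; apply/eqP; apply: ae_eq_integral => //.
  - by apply: measurableT_comp => //; exact/measurable_EFinP.
  - exact: measurableT_comp.
  - by apply: filterS aeE => x /= -> _.
congr fine; rewrite -[LHS](integral21_prod_meas1 i).
apply: ae_eq_integral => //.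
- exact: (measurable_fubini_G i).
- exact/measurable_EFinP.
- by apply: filterS aeE => x /= -> _.
Qed.

Lemma intg_prod (f : T1 -> R) (g : T2 -> R) : intg P f -> intg Q g ->
  intg PQ (fun z => f z.1 * g z.2).
Proof.
move=> if_ ig.
have mfg : measurable_fun setT (fun z : T1 * T2 => f z.1 * g z.2).
  apply: measurable_funM.
    exact: (measurableT_comp (intg_meas if_) measurable_fst).
  exact: (measurableT_comp (intg_meas ig) measurable_snd).
apply/integrable12ltyP; first exact/measurable_EFinP.
rewrite (_ : (fun x => _) = fun x => (`|f x|%:E * (Ex Q (fun y => `|g y|))%:E)%E); last first.
  apply/funext => x /=.
  under eq_integral do rewrite normrM EFinM.
  rewrite ge0_integralZl//; last first.
    by apply/measurable_EFinP; exact: (intg_meas (intg_abs ig)).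
  by rewrite ExE//; exact: intg_abs.
rewrite ge0_integralZr//; last 2 first.
- by apply/measurable_EFinP; exact: (intg_meas (intg_abs if_)).
- by rewrite lee_fin; apply: Ex_ge0.
by rewrite (ExE (intg_abs if_)) -EFinM ltry.
Qed.

Lemma Ex_prod (f : T1 -> R) (g : T2 -> R) : intg P f -> intg Q g ->
  Ex PQ (fun z => f z.1 * g z.2) = Ex P f * Ex Q g.
Proof.
move=> if_ ig; have [_ ->] := Ex_fubini (intg_prod if_ ig).
rewrite /= mulrC -ExZ//; apply: eq_Ex => x; by rewrite /= ExZ// mulrC.
Qed.

Lemma intg_fst (f : T1 -> R) : intg P f -> intg PQ (fun z => f z.1).
Proof.
move=> i; have := intg_prod i (intg_cst Q 1); rewrite (_ : (fun z => _) = fun z => f z.1)//.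
by apply/funext => z; rewrite /= mulr1.
Qed.

Lemma Ex_fst (f : T1 -> R) : intg P f -> Ex PQ (fun z => f z.1) = Ex P f.
Proof.
move=> i; rewrite -[RHS]mulr1 -(Ex_cst Q 1) -Ex_prod//; last exact: intg_cst.
by apply: eq_Ex => z; rewrite mulr1.
Qed.

Lemma intg_snd (g : T2 -> R) : intg Q g -> intg PQ (fun z => g z.2).
Proof.
move=> i; have := intg_prod (intg_cst P 1) i; rewrite (_ : (fun z => _) = fun z => g z.2)//.
by apply/funext => z; rewrite /= mul1r.
Qed.

Lemma Ex_snd (g : T2 -> R) : intg Q g -> Ex PQ (fun z => g z.2) = Ex Q g.
Proof.
move=> i; rewrite -[RHS]mul1r -(Ex_cst P 1) -Ex_prod//; last exact: intg_cst.
by apply: eq_Ex => z; rewrite mul1r.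
Qed.

End fubini.

(** * Moments of the standard Gaussian measure *)

Section normal_moments.
Context {R : realType}.
Notation Nm := (normal_prob 0 1 : probability (measurableTypeR R) R).

(** [expR x] times the standard density is a multiple of the density of mean
    [1]. *)
Lemma intg_normal_expR : intg Nm expR.
Proof.
apply/integrableP; split; first by apply/measurable_EFinP.
rewrite (_ : (fun x => _) = fun x => (expR x)%:E); last first.
  by apply/funext => x /=; rewrite ger0_norm ?expR_ge0.
rewrite ge0_integral_normal_prob//; last by apply/measurable_EFinP.
rewrite (_ : (fun x => _) = fun x => ((expR (2^-1))%:E * (normal_pdf 1 1 x)%:E)%E); last first.
  apply/funext => x; rewrite -!EFinM; congr EFin.
  rewrite !normal_pdfE ?oner_neq0// /normal_fun subr0.
  rewrite mulrCA [RHS]mulrCA -!expRD; congr (_ * expR _).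
  by rewrite expr1n; field.
rewrite integralZl//; last exact: integrable_normal_pdf.
by rewrite integral_normal_pdf mule1 ltry.
Qed.

Lemma intg_normal_expRN : intg Nm (fun x => expR (- x)).
Proof.
apply/integrableP; split.
  by apply/measurable_EFinP; exact: measurableT_comp.
rewrite (_ : (fun x => _) = fun x => (expR (- x))%:E); last first.
  by apply/funext => x /=; rewrite ger0_norm ?expR_ge0.
rewrite ge0_integral_normal_prob//; last first.
  by apply/measurable_EFinP; exact: measurableT_comp.
rewrite (_ : (fun x => _) = fun x => ((expR (2^-1))%:E * (normal_pdf (-1) 1 x)%:E)%E); last first.
  apply/funext => x; rewrite -!EFinM; congr EFin.
  rewrite !normal_pdfE ?oner_neq0// /normal_fun subr0.
  rewrite mulrCA [RHS]mulrCA -!expRD; congr (_ * expR _).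
  by rewrite expr1n; field.
rewrite integralZl//; last exact: integrable_normal_pdf.
by rewrite integral_normal_pdf mule1 ltry.
Qed.

Lemma exp_ge_pow k (x : R) : 0 <= x -> x ^+ k <= k`!%:R * expR x.
Proof.
move=> x0; case: k => [|k]; first by rewrite expr0 fact0 mul1r (le_trans _ (expR_ge1Dx _))// lerDl.
have := expR_ge1Dxn k x0.
have f0 : 0 < (k.+1)`!%:R :> R by rewrite ltr0n fact_gt0.
move=> h; rewrite mulrC -ler_pdivrMr//; apply: le_trans h.
by rewrite lerDr.
Qed.

(** Powers are dominated by [expR x + expR (- x)]. *)
Lemma intg_normal_pow k : intg Nm (fun t => (1 + `|t|) ^+ k).
Proof.
apply: (@intg_le _ _ _ _ _ (fun t : measurableTypeR R => (k`!%:R * expR 1) * (expR t + expR (- t)))).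
- apply: measurable_funX; apply: measurable_funD => //.
- move=> t; rewrite ger0_norm; last by rewrite exprn_ge0// addr_ge0.
  apply: le_trans (exp_ge_pow _ _) _; first by rewrite addr_ge0.
  rewrite -mulrA ler_wpM2l// expRD ler_wpM2l ?expR_ge0//.
  have : expR `|t : R| = expR t \/ expR `|t : R| = expR (- t).
    by case/orP: (le_total 0 (t : R)) => t0; [left; rewrite ger0_norm|right; rewrite ler0_norm].
  by have := expR_ge0 (t : R); have := expR_ge0 (- t : R); lra.
- apply: intgZ; apply: intgD; [exact: intg_normal_expR|exact: intg_normal_expRN].
Qed.

Lemma intg_normal_sqr : intg Nm (fun t => t ^+ 2).
Proof.
apply: (intg_le _ _ (intg_normal_pow 2)); first exact: measurable_funX.
move=> t; rewrite normrX ler_pXn2r ?nnegrE ?addr_ge0//.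
by rewrite lerDr.
Qed.

Lemma Ex_normal_expR_sqr (h : R) : 0 <= h ->
  Ex Nm (fun t => expR (- (h * t ^+ 2 / 2))) = (Num.sqrt (1 + h))^-1.
Proof.
move=> h0; have h1 : 0 < 1 + h by rewrite ltr_pwDl.
have s0 : 0 < Num.sqrt (1 + h) by rewrite sqrtr_gt0.
rewrite /Ex /Rintegral ge0_integral_normal_prob//; last first.
  apply/measurable_EFinP; apply: measurableT_comp => //; apply: measurableT_comp => //.
  by apply: measurable_funM => //; apply: measurable_funM => //; exact: measurable_funX.
set s := (Num.sqrt (1 + h))^-1.
have sn0 : s != 0 by rewrite invr_eq0 gt_eqF.
rewrite (_ : (fun x => _) = fun x => (s%:E * (normal_pdf 0 s x)%:E)%E); last first.
  apply/funext => x; rewrite -!EFinM; congr EFin.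
  rewrite !normal_pdfE ?oner_neq0// /normal_fun !subr0.
  have s2 : s ^+ 2 = (1 + h)^-1 by rewrite /s exprVn sqr_sqrtr// ltW.
  have -> : normal_peak 1 = s * normal_peak s.
    rewrite /normal_peak expr1n mul1r -mulrnAr sqrtrM ?sqr_ge0// sqrtr_sqr.
    by rewrite ger0_norm ?invr_ge0 ?ltW// invfM mulrA divff// mul1r.
  rewrite mulrCA -expRD [RHS]mulrA; congr (_ * expR _).
  by rewrite s2 expr1n; field; rewrite gt_eqF.
rewrite integralZl//; last exact: integrable_normal_pdf.
by rewrite integral_normal_pdf mule1.
Qed.

(** The second moment is minus twice the derivative at [0] of the integral of
    [exp (- h t^2 / 2)], which is known from the normalisation of the centred
    normal densities. *)
Lemma Ex_normal_sqr : Ex Nm (fun t => t ^+ 2) = 1.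
Proof.
have i4 : intg Nm (fun t => t ^+ 4).
  apply: (intg_le _ _ (intg_normal_pow 4)); first exact: measurable_funX.
  move=> t; rewrite normrX ler_pXn2r ?nnegrE ?addr_ge0//.
  by rewrite lerDr.
set m := Ex Nm (fun t => t ^+ 2); set c := Ex Nm (fun t => t ^+ 4).
have c0 : 0 <= c by apply: Ex_ge0 => t; rewrite exprn_even_ge0.
have ie (h : R) : 0 <= h -> intg Nm (fun t => expR (- (h * t ^+ 2 / 2))).
  move=> h0; apply: (intg_le _ _ (intg_cst Nm 1)).
    apply: measurableT_comp => //; apply: measurableT_comp => //.
    by apply: measurable_funM => //; apply: measurable_funM => //; exact: measurable_funX.
  move=> t; rewrite ger0_norm ?expR_ge0//= -[leRHS]expR0 ler_expR oppr_le0.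
  by rewrite divr_ge0// mulr_ge0 ?sqr_ge0.
have key (h : R) : 0 < h -> h <= 1 -> `|m - 1| <= h * (1 + c).
  move=> h0 h1.
  have lo : 1 - h * m / 2 <= (Num.sqrt (1 + h))^-1.
    rewrite -(Ex_normal_expR_sqr (ltW h0)).
    have -> : 1 - h * m / 2 = Ex Nm (fun t => 1 - h / 2 * t ^+ 2).
      rewrite ExB ?ExZ; [|exact: intg_normal_sqr|exact: intg_cst|].
        by rewrite Ex_cst -/m; field.
      by apply: intgZ; exact: intg_normal_sqr.
    apply: Ex_le => [||t]; last 1 first.
    - by apply: le_trans (expR_ge1Dx _); rewrite le_eqVlt; apply/orP; left; apply/eqP; field.
    - by apply: intgB; [exact: intg_cst|apply: intgZ; exact: intg_normal_sqr].
    - by apply: ie; rewrite ltW.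
  have hi : (Num.sqrt (1 + h))^-1 <= 1 - h * m / 2 + h ^+ 2 * c / 4.
    rewrite -(Ex_normal_expR_sqr (ltW h0)).
    have -> : 1 - h * m / 2 + h ^+ 2 * c / 4 =
        Ex Nm (fun t => 1 - h / 2 * t ^+ 2 + h ^+ 2 / 4 * t ^+ 4).
      rewrite ExD ?ExB ?ExZ; [|exact: i4|exact: intg_normal_sqr|exact: intg_cst| | |].
      - by rewrite Ex_cst -/m -/c; field.
      - by apply: intgZ; exact: intg_normal_sqr.
      - by apply: intgB; [exact: intg_cst|apply: intgZ; exact: intg_normal_sqr].
      - by apply: intgZ.
    apply: Ex_le => [||t]; last 1 first.
    - have u0 : 0 <= h * (t : R) ^+ 2 / 2 by rewrite divr_ge0// mulr_ge0 ?sqr_ge0// ltW.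
      rewrite expRN.
      apply: (@le_trans _ _ (1 + h * t ^+ 2 / 2)^-1).
        by rewrite lef_pV2 ?posrE ?expR_gt0 ?expR_ge1Dx// ltr_pwDl.
      have -> : 1 - h / 2 * t ^+ 2 + h ^+ 2 / 4 * t ^+ 4 =
        1 - (h * t ^+ 2 / 2) + (h * t ^+ 2 / 2) ^+ 2 by field.
      move: u0; set u := h * (t : R) ^+ 2 / 2 => u0.
      rewrite -[leLHS]mul1r ler_pdivrMr; last by rewrite ltr_pwDl.
      have -> : (1 - u + u ^+ 2) * (1 + u) = 1 + u ^+ 3 by ring.
      by rewrite lerDl exprn_ge0.
    - by apply: ie; rewrite ltW.
    - apply: intgD; last exact: intgZ.
      by apply: intgB; [exact: intg_cst|apply: intgZ; exact: intg_normal_sqr].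
  have s0 : 0 < Num.sqrt (1 + h) by rewrite sqrtr_gt0 ltr_pwDl// ltW.
  have s2 : Num.sqrt (1 + h) ^+ 2 = 1 + h by rewrite sqr_sqrtr// addr_ge0// ltW.
  set v := (Num.sqrt (1 + h))^-1 in lo hi *.
  have v0 : 0 < v by rewrite invr_gt0.
  have v2 : v ^+ 2 * (1 + h) = 1 by rewrite -s2 -exprMn mulVf ?expr1n// gt_eqF.
  have vlo : 1 - h / 2 <= v.
    rewrite leNgt; apply/negP => vl.
    have : v ^+ 2 * (1 + h) < (1 - h / 2) ^+ 2 * (1 + h).
      by rewrite ltr_pM2r ?ltr_pwDl ?ltW// ltr_pXn2r ?nnegrE ?ltW// ; lra.
    by rewrite v2; nra.
  have vhi : v <= 1 - h / 2 + h ^+ 2 / 2.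
    rewrite leNgt; apply/negP => vl.
    have : (1 - h / 2 + h ^+ 2 / 2) ^+ 2 * (1 + h) < v ^+ 2 * (1 + h).
      by rewrite ltr_pM2r ?ltr_pwDl ?ltW// ltr_pXn2r ?nnegrE ?ltW//; nra.
    rewrite v2.
    have -> : (1 - h / 2 + h ^+ 2 / 2) ^+ 2 * (1 + h) =
      1 + h ^+ 2 * (1 / 4 + 3 / 4 * h + h ^+ 2 * (h - 1) / 4) by field.
    have : 0 <= h ^+ 2 * (1 / 4 + 3 / 4 * h + h ^+ 2 * (h - 1) / 4).
      by rewrite mulr_ge0 ?sqr_ge0//; nra.
    by lra.
  have hh : h * m <= h + 2 * (h ^+ 2) * (c / 4) by nra.
  have hh' : h - h ^+ 2 <= h * m by nra.
  have m1 : m <= 1 + 2 * h * (c / 4) by rewrite -(ler_pM2l h0); nra.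
  have m2 : 1 - h <= m by rewrite -(ler_pM2l h0); nra.
  by rewrite ler_norml; apply/andP; split; nra.
apply/eqP; rewrite -subr_eq0 -normr_le0 leNgt; apply/negP => m0.
set e := `|m - 1| in key m0.
pose h := Num.min 1 (e / (2 * (1 + c))).
have c1 : 0 < 2 * (1 + c) by rewrite mulr_gt0// ltr_pwDl.
have h0 : 0 < h by rewrite lt_min ltr01 divr_gt0.
have := key h h0; rewrite ge_min lexx => /(_ isT).
have he : h <= e / (2 * (1 + c)) by rewrite ge_min lexx orbT.
have : h * (1 + c) <= e / 2.
  apply: le_trans (_ : e / (2 * (1 + c)) * (1 + c) <= _).
    by rewrite ler_pM2r// ltr_pwDl.
  by rewrite le_eqVlt; apply/orP; left; apply/eqP; field; rewrite gt_eqF// ltr_pwDl.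
by lra.
Qed.

End normal_moments.

Section gaussian_moments.
Context {R : realType}.
Local Notation V := (@rvm R).
Notation Nm := (normal_prob 0 1 : probability (measurableTypeR R) R).
Variables (n : nat) (g : probability (V n) R).
Hypothesis gg : std_gaussian g.

Lemma std_gaussian_coord (i : 'I_n) (A : set (measurableTypeR R)) : measurable A ->
  g ((fun x : V n => (x : 'rV[R]_n) ord0 i) @^-1` A) = normal_prob 0 1 A.
Proof.
move=> mA; pose B j : set R := if j == i then A else setT.
have mB j : measurable (B j) by rewrite /B; case: ifP.
have -> : (fun x : V n => (x : 'rV[R]_n) ord0 i) @^-1` A = box B.
  apply/seteqP; split=> x /=.
    by move=> Ax j; rewrite /B; case: eqP => // ->.
  by move=> /(_ i); rewrite /B eqxx.
rewrite (gg mB) (bigD1 i)//= big1 ?mule1.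
  by rewrite /B eqxx.
by move=> j ji; rewrite /B (negbTE ji); exact: (probability_setT Nm).
Qed.

Lemma Ex_coord (i : 'I_n) (f : measurableTypeR R -> R) : intg Nm f ->
  intg g (fun x : V n => f ((x : 'rV[R]_n) ord0 i)) /\
  Ex g (fun x : V n => f ((x : 'rV[R]_n) ord0 i)) = Ex Nm f.
Proof.
by apply: Ex_image => [|A mA]; [exact: measurable_coord|exact: std_gaussian_coord].
Qed.

Lemma measurable_norm_rvm : measurable_fun setT (fun x : V n => `|x : 'rV[R]_n|).
Proof. by apply: measurable_cts; exact: norm_continuous. Qed.

Lemma rV_norm_attained (x : 'rV[R]_n) : `|x| = 0 \/ exists i, `|x| = `|x ord0 i|.
Proof.
have [->|x0] := eqVneq x 0; first by left; rewrite normr0.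
right; have : mx_norm x != 0 by apply: contra x0 => /eqP/mx_norm_eq0 ->.
by move=> /mx_norm_neq0[[i j] /=]; rewrite (ord1 i) => xE; exists j; rewrite -xE.
Qed.

Lemma rV_coord_le (x : 'rV[R]_n) i : `|x ord0 i| <= `|x|.
Proof.
rewrite [leRHS]mx_normrE.
by apply: (@le_trans _ _ `|x (ord0, i).1 (ord0, i).2|) => //; exact: le_bigmax.
Qed.

Lemma intg_gaussian_pow k : intg g (fun x : V n => (1 + `|x : 'rV[R]_n|) ^+ k).
Proof.
apply: (@intg_le _ _ _ _ _ (fun x : V n => 1 + \sum_i (1 + `|(x : 'rV[R]_n) ord0 i|) ^+ k)).
- by apply: measurable_funX; apply: measurable_funD => //; exact: measurable_norm_rvm.
- move=> x; rewrite ger0_norm; last by rewrite exprn_ge0// addr_ge0.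
  have p0 (i : 'I_n) : 0 <= (1 + `|(x : 'rV[R]_n) ord0 i|) ^+ k by rewrite exprn_ge0// addr_ge0.
  case: (rV_norm_attained x) => [->|[i ->]].
    by rewrite addr0 expr1n lerDl sumr_ge0.
  rewrite (bigD1 i)//= addrCA lerDl addr_ge0// sumr_ge0//.
- apply: intgD; first exact: intg_cst.
  apply: intg_sum => i.
  by have [] := Ex_coord i (intg_normal_pow k).
Qed.

Lemma intg_poly (H : V n -> R) (C : R) k : measurable_fun setT H ->
  (forall x, `|H x| <= C * (1 + `|x : 'rV[R]_n|) ^+ k) -> intg g H.
Proof.
move=> mH HC; apply: (intg_le mH HC); apply: intgZ; exact: intg_gaussian_pow.
Qed.

Lemma intg_psq_pow k :
  intg (psq g) (fun z => (1 + `|z.1 : 'rV[R]_n| + `|z.2 : 'rV[R]_n|) ^+ k).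
Proof.
apply: (@intg_le _ _ _ _ _ (fun z : V n * V n =>
    (1 + `|z.1 : 'rV[R]_n|) ^+ k * (1 + `|z.2 : 'rV[R]_n|) ^+ k)).
- apply: measurable_funX; apply: measurable_funD.
    apply: measurable_funD => //.
    exact: (measurableT_comp measurable_norm_rvm measurable_fst).
  exact: (measurableT_comp measurable_norm_rvm measurable_snd).
- move=> z; rewrite ger0_norm; last by rewrite exprn_ge0// !addr_ge0.
  rewrite -exprMn lerXn2r ?nnegrE ?mulr_ge0 ?addr_ge0//.
  have : 0 <= `|z.1 : 'rV[R]_n| * `|z.2 : 'rV[R]_n| by rewrite mulr_ge0.
  by rewrite mulrDl mul1r mulrDr mulr1; lra.
- exact: (intg_prod (intg_gaussian_pow k) (intg_gaussian_pow k)).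
Qed.

Lemma intg_psq_poly (H : V n * V n -> R) (C : R) k : measurable_fun setT H ->
  (forall z, `|H z| <= C * (1 + `|z.1 : 'rV[R]_n| + `|z.2 : 'rV[R]_n|) ^+ k) ->
  intg (psq g) H.
Proof.
move=> mH HC; apply: (intg_le mH HC); apply: intgZ; exact: intg_psq_pow.
Qed.

Lemma intg_coord i : intg g (fun x : V n => (x : 'rV[R]_n) ord0 i).
Proof.
apply: (@intg_poly _ 1 1); first exact: measurable_coord.
by move=> x; rewrite mul1r expr1 (le_trans (rV_coord_le _ _))// lerDr.
Qed.

Lemma intg_coordM i j : intg g (fun x : V n => (x : 'rV[R]_n) ord0 i * (x : 'rV[R]_n) ord0 j).
Proof.
apply: (@intg_poly _ 1 2).
  by apply: measurable_funM; exact: measurable_coord.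
move=> x; rewrite mul1r normrM expr2 ler_pM// ?(le_trans (rV_coord_le _ _))// lerDr//.
Qed.

Lemma psqE_fst (f : V n -> R) : intg g f -> Ex (psq g) (fun z => f z.1) = Ex g f.
Proof. exact: Ex_fst. Qed.

Lemma psqE_snd (f : V n -> R) : intg g f -> Ex (psq g) (fun z => f z.2) = Ex g f.
Proof. exact: Ex_snd. Qed.

Lemma Ex_rot c s (f : V n * V n -> R) : 0 < c -> c ^+ 2 + s ^+ 2 = 1 -> intg (psq g) f ->
  intg (psq g) (f \o rot c s) /\ Ex (psq g) (f \o rot c s) = Ex (psq g) f.
Proof.
by move=> c0 cs; apply: Ex_image; [exact: measurable_rot|exact: (rot_preserves gg c0 cs)].
Qed.

(** The mean is invariant under [m |-> (3/5 + 4/5) m], hence vanishes. *)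
Lemma Ex_coord0 i : Ex g (fun x : V n => (x : 'rV[R]_n) ord0 i) = 0.
Proof.
have cs : (3 / 5) ^+ 2 + (4 / 5) ^+ 2 = 1 :> R by field.
have c0 : 0 < 3 / 5 :> R by rewrite divr_gt0.
pose f (z : V n * V n) := (z.1 : 'rV[R]_n) ord0 i.
have if_ : intg (psq g) f by exact: (intg_fst _ (intg_coord i)).
have is_ : intg (psq g) (fun z => (z.2 : 'rV[R]_n) ord0 i) by exact: (intg_snd _ (intg_coord i)).
have [_] := Ex_rot c0 cs if_.
rewrite (_ : f \o _ = fun z => 3 / 5 * (z.1 : 'rV[R]_n) ord0 i + 4 / 5 * (z.2 : 'rV[R]_n) ord0 i); last first.
  by apply/funext => z; rewrite /f /= !mxE.
rewrite ExD; [|exact: intgZ|exact: intgZ].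
rewrite !ExZ// (psqE_fst (intg_coord i)) (psqE_snd (intg_coord i)).
by move=> h; lra.
Qed.

(** Rotating only the [i]-th coordinates multiplies the covariance of two
    distinct coordinates by [3/5]. *)
Lemma Ex_coordM i j : Ex g (fun x : V n => (x : 'rV[R]_n) ord0 i * (x : 'rV[R]_n) ord0 j) = (i == j)%:R.
Proof.
have [<-|ij] := eqVneq i j.
  rewrite -(Ex_normal_sqr (R := R)); have [_ <-] := Ex_coord i intg_normal_sqr.
  by apply: eq_Ex => x; rewrite expr2.
have cs : (3 / 5) ^+ 2 + (4 / 5) ^+ 2 = 1 :> R by field.
have c0 : 0 < 3 / 5 :> R by rewrite divr_gt0.
pose f (z : V n * V n) := (z.1 : 'rV[R]_n) ord0 i * (z.1 : 'rV[R]_n) ord0 j.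
have if_ : intg (psq g) f by exact: (intg_fst _ (intg_coordM i j)).
have ic : intg (psq g) (fun z : V n * V n => (z.1 : 'rV[R]_n) ord0 j * (z.2 : 'rV[R]_n) ord0 i).
  exact: (intg_prod (intg_coord j) (intg_coord i)).
have [_] := Ex_image (@measurable_rotc R _ _ n _) (rotc1_preserves i gg c0 cs) if_.
rewrite (_ : f \o _ = fun z => 3 / 5 * f z +
   4 / 5 * ((z.1 : 'rV[R]_n) ord0 j * (z.2 : 'rV[R]_n) ord0 i)); last first.
  by apply/funext => z; rewrite /f /= !mxE eqxx eq_sym (negbTE ij); ring.
rewrite ExD; [|exact: intgZ|exact: intgZ].
rewrite !ExZ//; have -> : Ex (psq g) (fun z : V n * V n =>
    (z.1 : 'rV[R]_n) ord0 j * (z.2 : 'rV[R]_n) ord0 i) = 0.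
  by apply: etrans (Ex_prod (intg_coord j) (intg_coord i)) _; rewrite !Ex_coord0 mulr0.
rewrite /f (psqE_fst (intg_coordM i j)) => h; rewrite /=; lra.
Qed.

End gaussian_moments.

(** * Almost everywhere differentiability on the line *)

Section lipschitz_line.
Context {R : realType}.
Notation mu := (@lebesgue_measure R).
Variables (h : R -> R) (L : R).
Hypothesis L0 : 0 < L.
Hypothesis hL : forall x y, `|h x - h y| <= L * `|x - y|.

Let g1 x := L * x + h x.
Let g2 x := L * x - h x.

Let h_cont : continuous h.
Proof.
move=> x; apply/cvgrPdist_lt => e e0; near=> y.
apply: le_lt_trans (hL _ _) _; rewrite mulrC -ltr_pdivlMr//.
near: y; exists (e / L) => /=; first by rewrite divr_gt0.
by move=> y.
Unshelve. all: by end_near. Qed.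

Let g1_nd : {homo g1 : x y / x <= y}.
Proof.
move=> x y xy; rewrite -subr_ge0 /g1.
have := hL y x; rewrite (ger0_norm (x := y - x)) ?subr_ge0// ler_norml => /andP[h1 _].
by lra.
Qed.

Let g2_nd : {homo g2 : x y / x <= y}.
Proof.
move=> x y xy; rewrite -subr_ge0 /g2.
have := hL y x; rewrite (ger0_norm (x := y - x)) ?subr_ge0// ler_norml => /andP[_ h1].
by lra.
Qed.

Let g1_rc : right_continuous g1.
Proof.
apply: right_continuousW => x; apply: cvgD; last exact: h_cont.
by apply: cvgM; [exact: cvg_cst|exact: cvg_id].
Qed.

Let g2_rc : right_continuous g2.
Proof.
apply: right_continuousW => x; apply: cvgB; last exact: h_cont.
by apply: cvgM; [exact: cvg_cst|exact: cvg_id].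
Qed.

#[local] HB.instance Definition _ := isCumulative.Build R _ R g1 g1_nd g1_rc.
#[local] HB.instance Definition _ := isCumulative.Build R _ R g2 g2_nd g2_rc.

Let nu1 := lebesgue_stieltjes_measure g1.
Let nu2 := lebesgue_stieltjes_measure g2.

Let nu1E a b : a <= b -> nu1 `]a, b] = (g1 b - g1 a)%:E.
Proof.
move=> ab; rewrite /nu1 /lebesgue_stieltjes_measure /measure_extension/=.
rewrite measurable_mu_extE/=; last by exists (a, b).
by rewrite wlength_itv_bnd.
Qed.

Let nu2E a b : a <= b -> nu2 `]a, b] = (g2 b - g2 a)%:E.
Proof.
move=> ab; rewrite /nu2 /lebesgue_stieltjes_measure /measure_extension/=.
rewrite measurable_mu_extE/=; last by exists (a, b).
by rewrite wlength_itv_bnd.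
Qed.

Let nu1_dom : nu1 `<< mu.
Proof.
have k0 : 0 <= (2 * L)^-1 by rewrite invr_ge0 mulr_ge0// ltW.
pose m : {measure set (measurableTypeR R) -> \bar R} :=
  mscale (NngNum k0) (measure_add nu1 nu2).
have mE A : m A = (((2 * L)^-1)%:E * (nu1 A + nu2 A))%E.
  exact: (congr1 (mule ((2 * L)^-1)%:E) (measure_addE nu1 nu2 A)).
have muE A : measurable A -> mu A = m A.
  apply: lebesgue_measure_unique => X /ocitvP[->|[[a b] /= ab ->]].
    by rewrite !measure0.
  rewrite mE nu1E ?ltW// nu2E ?ltW//.
  rewrite lebesgue_measure_itv/= lte_fin ab -EFinD -EFinM; congr EFin.
  by rewrite /g1 /g2; field; rewrite gt_eqF.
apply/null_content_dominatesP => A mA A0.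
have : m A = 0%E := etrans (esym (muE A mA)) A0.
rewrite mE => /eqP; rewrite mule_eq0 => /orP[|].
  by rewrite eqe invr_eq0 mulf_eq0 pnatr_eq0/= gt_eqF.
by rewrite padde_eq0// => /andP[/eqP].
Qed.

(** With [g1 x = L * x + h x] and [g2 x = L * x - h x], both nondecreasing,
    the Stieltjes measures of [g1] and [g2] add up to [2 * L] times the
    Lebesgue measure. So that of [g1] has a density, and [g1] is almost
    everywhere differentiable by the Lebesgue differentiation theorem; so is
    [h]. *)
Lemma lipschitz_ae_derivable01 : {ae mu, forall x, 0 < x < 1 -> derivable h x 1}.
Proof.
pose D : set (measurableTypeR R) := `]0, 1]%classic.
have mD : measurable D by exact: measurable_itv.
have Dfin : (nu1 D < +oo)%E by rewrite nu1E// ltry.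
pose nu := mfrestr mD Dfin.
have dom : nu `<< mu.
  apply/null_content_dominatesP => A mA A0; rewrite /nu /mfrestr /mrestr.
  have /null_content_dominatesP/(_ A mA A0) nA := nu1_dom.
  apply/eqP; rewrite eq_le measure_ge0 andbT -nA.
  apply: le_measure; rewrite ?inE//; exact: measurableI.
pose phi := Radon_Nikodym_SigmaFinite.f nu mu.
have iphi : mu.-integrable setT phi := Radon_Nikodym_SigmaFinite.f_integrable dom.
pose r := fine \o phi.
have rE : EFin \o r = phi.
  apply/funext => x; rewrite /r /= fineK//.
  exact: Radon_Nikodym_SigmaFinite.f_fin_num.
have ir : mu.-integrable setT (EFin \o r) by rewrite rE.
have := @FTC1Ny R r.
move=> /(_ _ _)/= H.
pose FF (x : R) := \int[mu]_(t in [set` `]-oo, x]]) r t.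
have {H} : \forall x \ae mu, derivable FF x 1.
  have : \forall x \ae mu, derivable FF x 1 /\
      FF^`()%classic x = r x.
    apply: H.
      by move=> y; apply: (integrableS measurableT).
    exact: open_integrable_locally openT ir.
  by apply: (@filterS _ _ (ae_filter_ringOfSetsType mu)) => x [].
apply: (@filterS _ _ (ae_filter_ringOfSetsType mu)) => x dx /andP[x0 x1].
have : derivable (fun y => g1 y - g1 0) x 1.
  apply: near_eq_derivable dx; near=> y.
  have y0 : 0 < y by near: y; exact: lt_nbhsr.
  have y1 : y < 1 by near: y; exact: lt_nbhsl.
  rewrite /FF /Rintegral (_ : (fun x => (r x)%:E) = phi); last exact: rE.
  rewrite -(Radon_Nikodym_SigmaFinite.f_integral dom)//.
  transitivity (fine (nu1 (`]-oo, y]%classic `&` D))); first by [].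
  rewrite (_ : _ `&` D = `]0, y]%classic).
    by rewrite nu1E// ltW.
  apply/seteqP; split=> z; rewrite /D /= !in_itv/=.
    by move=> [-> /andP[-> _]].
  by move=> /andP[-> zy]; split=> //; rewrite (le_trans zy)// ltW.
move=> dg.
have -> : h = (fun y => (g1 y - g1 0) + (g1 0 - L * y)).
  by apply/funext => y; rewrite /g1; ring.
have lin : derivable (cst (g1 0) - L \*: (id : R -> R)) (x : R) 1.
  by apply: derivableB; [exact: derivable_cst|apply: derivableZ; exact: derivable_id].
exact: (derivableD dg lin).
Unshelve. all: by end_near. Qed.

End lipschitz_line.

(** * Differentiation along rotations and integration by parts *)

Section mean_value.
Context {R : realType}.
Variables q dq : R -> R.
Hypothesis qE : forall x : R, is_derive x 1 q (dq x).

Lemma derive_continuous : continuous q.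
Proof.
move=> x; apply/differentiable_continuous/derivable1_diffP.
exact: (@ex_derive _ _ _ _ _ _ _ (qE x)).
Qed.

Lemma derive_mvt x y : x <= y ->
  exists2 c, x <= c <= y & q y - q x = dq c * (y - x).
Proof.
move=> xy; have [|c] := @MVT_segment R q dq x y xy (fun z _ => qE z).
  by apply: continuous_subspaceT; exact: derive_continuous.
by rewrite in_itv/= => xcy ->; exists c.
Qed.

Lemma derive_lipschitz C : (forall x, `|dq x| <= C) ->
  forall x y, `|q x - q y| <= C * `|x - y|.
Proof.
move=> qC x y; wlog yx : x y / y <= x.
  by move=> H; have [/H//|/ltW/H] := leP y x; rewrite distrC (distrC y).
by have [c _ ->] := derive_mvt yx; rewrite normrM ler_wpM2r.
Qed.

End mean_value.

Section trig_bounds.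
Context {R : realType}.

Lemma sin_bound (t : R) : 0 <= t -> `|sin t| <= t.
Proof.
move=> t0; have [c _] := derive_mvt (fun x => is_derive_sin x) t0.
rewrite sin0 !subr0 => ->; rewrite normrM (ger0_norm t0) ler_piMl// ler_norml.
by rewrite cos_geN1 cos_le1.
Qed.

Lemma cos_bound (t : R) : 0 <= t -> `|cos t - 1| <= t ^+ 2.
Proof.
move=> t0; have [c /andP[c0 ct]] := derive_mvt (fun x => is_derive_cos x) t0.
rewrite cos0 subr0 => ->; rewrite normrM normrN (ger0_norm t0) expr2 ler_wpM2r//.
exact: le_trans (sin_bound c0) ct.
Qed.

Lemma sin_bound2 (t : R) : 0 <= t -> `|sin t - t| <= t ^+ 3.
Proof.
move=> t0.
have D x : is_derive x (1 : R) (fun y : R => sin y - y) (cos x - 1).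
  by apply: is_deriveB.
have [c /andP[c0 ct]] := derive_mvt D t0.
rewrite sin0 subrr !subr0 => ->; rewrite normrM (ger0_norm t0) exprSr ler_wpM2r//.
by apply: le_trans (cos_bound c0) _; rewrite ler_pXn2r.
Qed.

Lemma cos_gt01 (t : R) : 0 <= t <= 1 -> 0 < cos t.
Proof.
move=> /andP[t0 t1]; apply: cos_gt0_pihalf.
have p0 : 0 < pi / 2 :> R by have /andP[] := pihalf_02 R.
rewrite (lt_le_trans _ t0) ?oppr_lt0//=.
have := @pihalf_ge1 R; rewrite le_eqVlt => /orP[/eqP p1|p1]; last exact: le_lt_trans p1.
by have := cos1_gt0 R; rewrite p1 cos_pihalf ltxx.
Qed.

Lemma is_derive_rot (a b t : R) :
  is_derive t (1 : R) (fun t : R => cos t * a + sin t * b) (- sin t * a + cos t * b).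
Proof.
have Hc := is_deriveM (is_derive_cos t) (is_derive_cst a t 1).
have Hs := is_deriveM (is_derive_sin t) (is_derive_cst b t 1).
have H := is_deriveD Hc Hs.
rewrite (_ : - sin t * a + cos t * b = cos t *: (0 : R^o) + cst a t *: - sin t +
    (sin t *: (0 : R^o) + cst b t *: cos t)); first exact: H.
by rewrite /GRing.scale /=; ring.
Qed.

End trig_bounds.

Section rotation_paths.
Context {R : realType} {n : nat}.
Implicit Types x y v : 'rV[R]_n.

(** The first component of the pair [(x, v)] rotated by the angle [t]. The law
    of a pair of independent Gaussian vectors is invariant under rotations, so
    that these circles are used where one would use lines for the Lebesgue
    measure. *)
Definition rx (t : R) x v := cos t *: x + sin t *: v.

(** Limits are taken along this sequence of times whenever dominated
    convergence is applied. *)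
Definition tk (k : nat) : R := k.+1%:R^-1.

Lemma tk_gt0 k : 0 < tk k. Proof. by rewrite invr_gt0. Qed.

Lemma tk_le1 k : tk k <= 1. Proof. by rewrite invf_le1// ler1n. Qed.

Lemma tk_cvg : tk k @[k --> \oo] --> (0 : R).
Proof. exact: cvg_harmonic. Qed.

Lemma tk_itv k : 0 <= tk k <= 1.
Proof. by rewrite tk_le1 ltW// tk_gt0. Qed.

Lemma rotE t (z : @rvm R n * @rvm R n) :
  rot (cos t) (sin t) z = (rx t z.1 z.2, rx t z.2 (- (z.1 : 'rV[R]_n))).
Proof. by rewrite /rot /rx scalerN scaleNr addrC (addrC (- _)). Qed.

Lemma rx_norm t x v : `|rx t x v| <= `|x| + `|v|.
Proof.
apply: le_trans (ler_normD _ _) _; rewrite !normrZ lerD// ler_piMl//.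
  by rewrite ler_norml cos_geN1 cos_le1.
by rewrite ler_norml sin_geN1 sin_le1.
Qed.

Lemma rx_dist t x v : 0 <= t <= 1 -> `|rx t x v - x| <= t * (`|x| + `|v|).
Proof.
move=> /andP[t0 t1].
have -> : rx t x v - x = (cos t - 1) *: x + sin t *: v.
  by rewrite scalerBl scale1r addrAC.
apply: le_trans (ler_normD _ _) _; rewrite !normrZ mulrDr lerD// ler_wpM2r//.
  by apply: le_trans (cos_bound t0) _; rewrite expr2 ler_piMl.
exact: sin_bound.
Qed.

(** Up to second order, a small rotation moves [x] along a straight line. *)
Lemma rx_line t x v : 0 <= t <= 1 -> `|rx t x v - (x + t *: v)| <= t ^+ 2 * (`|x| + `|v|).
Proof.
move=> /andP[t0 t1].
have -> : rx t x v - (x + t *: v) = (cos t - 1) *: x + (sin t - t) *: v.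
  by rewrite !scalerBl scale1r opprD addrACA.
apply: le_trans (ler_normD _ _) _; rewrite !normrZ mulrDr lerD// ler_wpM2r//.
  exact: cos_bound.
apply: le_trans (sin_bound2 t0) _; rewrite exprSr ler_piMr// sqr_ge0//.
Qed.

Definition dotp x y : R := \sum_i x ord0 i * y ord0 i.

Lemma dotpC x y : dotp x y = dotp y x.
Proof. by apply: eq_bigr => i _; rewrite mulrC. Qed.

Lemma dotpDl x y v : dotp (x + y) v = dotp x v + dotp y v.
Proof. by rewrite -big_split; apply: eq_bigr => i _; rewrite mxE mulrDl. Qed.

Lemma dotpZl c x v : dotp (c *: x) v = c * dotp x v.
Proof. by rewrite mulr_sumr; apply: eq_bigr => i _; rewrite mxE mulrA. Qed.

Lemma dotpNl x v : dotp (- x) v = - dotp x v.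
Proof. by rewrite -scaleN1r dotpZl mulN1r. Qed.

Lemma dotpBl x y v : dotp (x - y) v = dotp x v - dotp y v.
Proof. by rewrite dotpDl dotpNl. Qed.

Lemma dotpDr x y v : dotp v (x + y) = dotp v x + dotp v y.
Proof. by rewrite dotpC dotpDl !(dotpC v). Qed.

Lemma dotpZr c x v : dotp v (c *: x) = c * dotp v x.
Proof. by rewrite dotpC dotpZl (dotpC v). Qed.

Lemma dotpNr x v : dotp v (- x) = - dotp v x.
Proof. by rewrite dotpC dotpNl (dotpC v). Qed.

Lemma dotpBr x y v : dotp v (x - y) = dotp v x - dotp v y.
Proof. by rewrite dotpDr dotpNr. Qed.

Lemma dotp0l v : dotp 0 v = 0.
Proof. by rewrite /dotp big1// => i _; rewrite mxE mul0r. Qed.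

Lemma dotp_delta x i : dotp x (delta_mx ord0 i) = x ord0 i.
Proof.
rewrite /dotp (bigD1 i)//= mxE !eqxx mulr1 big1 ?addr0// => j ji.
by rewrite mxE eqxx (negbTE ji) mulr0.
Qed.

Lemma dotp_norm x y : `|dotp x y| <= n%:R * (`|x| * `|y|).
Proof.
apply: le_trans (ler_norm_sum _ _ _) _.
apply: le_trans (_ : \sum_(i < n) (`|x| * `|y|) <= _).
  by apply: ler_sum => i _; rewrite normrM ler_pM// rV_coord_le.
by rewrite sumr_const card_ord mulr_natl.
Qed.

Definition null_seq (t : nat -> R) :=
  (forall k, 0 < t k <= 1) /\ t k @[k --> \oo] --> (0 : R).

Lemma null_tk : null_seq tk.
Proof. by split; [move=> k; rewrite tk_gt0 tk_le1|exact: tk_cvg]. Qed.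

Lemma null_neq0 t k : null_seq t -> t k != 0.
Proof. by move=> [/(_ k)/andP[t0 _] _]; rewrite gt_eqF. Qed.

(** [a] represents the directional derivatives of [f] at [x], taken along the
    rotation paths that leave [x] in every direction. *)
Definition rder (f : 'rV[R]_n -> R) x a := forall t v, null_seq t ->
  (f (rx (t k) x v) - f x) / t k @[k --> \oo] --> dotp a v.

Lemma rder_cvg f x a t v : null_seq t -> rder f x a ->
  f (rx (t k) x v) @[k --> \oo] --> f x.
Proof.
move=> t0 /(_ t v t0) h.
have -> : f x = dotp a v * 0 + f x by rewrite mulr0 add0r.
rewrite (_ : (fun k => _) = fun k => (f (rx (t k) x v) - f x) / t k * t k + f x); last first.
  by apply/funext => k; rewrite mulfVK ?null_neq0// subrK.
apply: cvgD; last exact: cvg_cst.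
by apply: cvgM => //; case: t0.
Qed.

Lemma rderD f h x a b : rder f x a -> rder h x b ->
  rder (fun x => f x + h x) x (a + b).
Proof.
move=> fa hb t v t0; rewrite dotpDl.
rewrite (_ : (fun k => _) = fun k => (f (rx (t k) x v) - f x) / t k + (h (rx (t k) x v) - h x) / t k).
  by apply: cvgD; [exact: fa|exact: hb].
by apply/funext => k; rewrite -mulrDl; congr (_ / _); ring.
Qed.

Lemma rderM f h x a b : rder f x a -> rder h x b ->
  rder (fun x => f x * h x) x (h x *: a + f x *: b).
Proof.
move=> fa hb t v t0; rewrite dotpDl !dotpZl.
rewrite (_ : (fun k => _) = fun k => h (rx (t k) x v) * ((f (rx (t k) x v) - f x) / t k) +
    f x * ((h (rx (t k) x v) - h x) / t k)).
  apply: cvgD; apply: cvgM.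
  - exact: rder_cvg hb.
  - exact: fa.
  - exact: cvg_cst.
  - exact: hb.
by apply/funext => k; field; rewrite null_neq0.
Qed.

Lemma rder_cst c x : rder (fun=> c) x 0.
Proof.
move=> t v _; rewrite dotp0l (_ : (fun k => _) = fun=> 0); first exact: cvg_cst.
by apply/funext => k; rewrite subrr mul0r.
Qed.

Lemma rder_path (f : 'rV[R]_n -> R) x a :
  (forall v, is_derive (0 : R) 1 (fun t : R => f (rx t x v)) (dotp a v)) -> rder f x a.
Proof.
move=> H t v t0; have [D E] := H v.
have [/= l Dl] := (cvg_ex _).1 D.
have h : h^-1 *: (f (rx (h *: 1 + 0) x v) - f (rx 0 x v)) @[h --> 0^'] --> dotp a v.
  by rewrite -E; apply: (cvg_trans D).
have /cvgr_dnbhsP/(_ t) := h.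
rewrite /rx cos0 sin0 scale1r scale0r addr0.
have c1 : (forall k, t k != 0) /\ t k @[k --> \oo] --> (0 : R).
  by split; [move=> k; exact: null_neq0|case: t0].
move=> /(_ c1); apply: cvg_trans; apply: near_eq_cvg; apply: nearW => k /=.
by rewrite addr0 -[t k *: 1]/(t k * 1) mulr1 -[_ *: _]/(_ * _) mulrC.
Qed.

Lemma rder_coord i x : rder (fun x => x ord0 i) x (delta_mx ord0 i).
Proof.
apply: rder_path => v; rewrite dotpC dotp_delta.
rewrite (_ : (fun t => _) = fun t => cos t * x ord0 i + sin t * v ord0 i); last first.
  by apply/funext => t; rewrite !mxE.
have := is_derive_rot (x ord0 i) (v ord0 i) 0.
by rewrite sin0 cos0 oppr0 mul0r add0r mul1r.
Qed.

(** Completing the difference quotient of [s] by its derivative at [0] covers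
    the times at which [f] does not move. *)
Lemma rder_comp (s s' : R -> R) (f : 'rV[R]_n -> R) x a :
  (forall y : R, is_derive y (1 : R) s (s' y)) -> rder f x a ->
  rder (fun x => s (f x)) x (s' (f x) *: a).
Proof.
move=> Hs fa t v t0; rewrite dotpZl.
have [D E] := Hs (f x).
pose q h := if h == 0 then s' (f x) else (s (h + f x) - s (f x)) / h.
have qc : {for 0, continuous q}.
  apply/continuous_withinNx; rewrite [q 0]/q eqxx.
  have h : h^-1 *: (s (h *: 1 + f x) - s (f x)) @[h --> 0^'] --> s' (f x).
    by rewrite -E; apply: (cvg_trans D).
  apply: cvg_trans h; apply: near_eq_cvg; near=> h.
  have h0 : h != 0 by near: h; exact: nbhs_dnbhs_neq.
  by rewrite /q (negbTE h0) -[h *: 1]/(h * 1) mulr1 -[_ *: _]/(_ * _) mulrC.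
rewrite (_ : (fun k => _) = fun k => q (f (rx (t k) x v) - f x) *
    ((f (rx (t k) x v) - f x) / t k)); last first.
  apply/funext => k; rewrite /q subr_eq0; case: eqVneq => [->|ne].
    by rewrite !subrr mul0r mulr0.
  by rewrite subrK; field; rewrite null_neq0// subr_eq0 ne.
apply: cvgM; last exact: fa.
have -> : s' (f x) = q 0 by rewrite /q eqxx.
apply: continuous_cvg => //; rewrite -(subrr (f x)).
by apply: cvgB; [exact: rder_cvg fa|exact: cvg_cst].
Unshelve. all: by end_near. Qed.

End rotation_paths.

Section integration_by_parts.
Context {R : realType} {n : nat}.
Local Notation V := (@rvm R).
Variable g : probability (V n) R.
Hypothesis gg : std_gaussian g.
Implicit Types (f h : 'rV[R]_n -> R) (a b : 'rV[R]_n -> 'rV[R]_n).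

(** Functions of polynomial growth with a local Lipschitz constant of
    polynomial growth: rotation difference quotients of such functions are
    dominated by an integrable function. *)
Definition tame f : Prop :=
  measurable_fun setT (f : V n -> R) /\ exists C k, [/\ 0 <= C,
    forall x, `|f x| <= C * (1 + `|x|) ^+ k &
    forall x y, `|f x - f y| <= C * (1 + `|x| + `|y|) ^+ k * `|x - y|].

Definition mfield a : Prop :=
  forall i, measurable_fun setT (fun x : V n => a x ord0 i).

(** Derivatives are only asked for along rotation paths, and almost
    everywhere: this is what integration by parts uses. *)
Definition has_grad f a : Prop :=
  mfield a /\ {ae g, forall x, rder f x (a x)}.

Lemma pow1_le (x y : R) k l : 0 <= x -> x <= y -> (k <= l)%N ->
  (1 + x) ^+ k <= (1 + y) ^+ l.
Proof.
move=> x0 xy kl; apply: (@le_trans _ _ ((1 + y) ^+ k)).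
  have y0 := le_trans x0 xy.
  by rewrite lerXn2r ?nnegrE ?lerD2l// addr_ge0.
by rewrite ler_weXn2l// lerDl (le_trans x0).
Qed.

Lemma poly_lip_continuous (f : 'rV[R]_n -> R) C k : 0 <= C ->
  (forall x y, `|f x - f y| <= C * (1 + `|x| + `|y|) ^+ k * `|x - y|) -> continuous f.
Proof.
move=> C0 fL x; apply/(@cvgrPdist_le _ _ _ (nbhs x) (nbhs_filter x)) => e e0.
pose M := C * (2 + 2 * `|x|) ^+ k + 1.
have M0 : 0 < M by rewrite ltr_wpDl// mulr_ge0// exprn_ge0// addr_ge0// mulr_ge0.
have d0 : 0 < Num.min 1 (e / M) by rewrite lt_min ltr01 divr_gt0.
near=> y; have : `|x - y| < Num.min 1 (e / M).
  by near: y; exact: (@cvgr_dist_lt _ _ _ (nbhs x) _ id x cvg_id _ d0).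
rewrite lt_min => /andP[xy1 xye]; apply: le_trans (fL _ _) _.
have yx : `|y| <= `|x| + 1.
  have -> : y = x - (x - y) by rewrite opprB addrC subrK.
  by apply: le_trans (ler_normB _ _) _; lra.
apply: (@le_trans _ _ (M * `|x - y|)).
  apply: ler_wpM2r => //; apply: (@le_trans _ _ (C * (2 + 2 * `|x|) ^+ k)); last by rewrite /M lerDl.
  apply: ler_wpM2l => //; have := normr_ge0 x; have := normr_ge0 y => y0 x0.
  by rewrite lerXn2r ?nnegrE ?addr_ge0 ?mulr_ge0//; lra.
by rewrite mulrC -ler_pdivlMr//; exact: ltW.
Unshelve. all: by end_near. Qed.

Lemma tame_continuous f : tame f -> continuous f.
Proof. by move=> [_ [C [k [C0 _ fL]]]]; exact: poly_lip_continuous fL. Qed.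

Lemma tame_meas f : tame f -> measurable_fun setT (f : V n -> R).
Proof. by case. Qed.

Lemma tame_cst c : tame (fun=> c).
Proof.
split; first exact: measurable_cst.
exists `|c|, 0%N; split=> // [x|x y]; first by rewrite expr0 mulr1.
by rewrite subrr normr0 !mulr_ge0// exprn_ge0// !addr_ge0.
Qed.

Lemma tame_coord i : tame (fun x => x ord0 i).
Proof.
split; first exact: measurable_coord.
exists 1, 1%N; split=> // [x|x y].
  by rewrite mul1r expr1 (le_trans (rV_coord_le _ _))// lerDr.
have -> : x ord0 i - y ord0 i = (x - y) ord0 i by rewrite !mxE.
rewrite mul1r expr1 (le_trans (rV_coord_le _ _))// ler_peMl//.
by rewrite -addrA lerDl addr_ge0.
Qed.

Lemma tameD f h : tame f -> tame h -> tame (fun x => f x + h x).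
Proof.
move=> [mf [C [k [C0 fC fL]]]] [mh [D [l [D0 hD hL]]]].
split; first exact: measurable_funD.
exists (C + D), (k + l)%N; split=> [|x|x y]; first exact: addr_ge0.
  apply: le_trans (ler_normD _ _) _; rewrite mulrDl lerD//.
    apply: le_trans (fC _) _; rewrite ler_wpM2l//; apply: pow1_le => //.
    exact: leq_addr.
  apply: le_trans (hD _) _; rewrite ler_wpM2l//; apply: pow1_le => //.
  exact: leq_addl.
have -> : f x + h x - (f y + h y) = f x - f y + (h x - h y) by ring.
apply: le_trans (ler_normD _ _) _; rewrite !mulrDl lerD//.
  apply: le_trans (fL _ _) _; rewrite ler_wpM2r// ler_wpM2l// -!addrA.
  by apply: pow1_le; [exact: addr_ge0|exact: lexx|exact: leq_addr].
apply: le_trans (hL _ _) _; rewrite ler_wpM2r// ler_wpM2l// -!addrA.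
by apply: pow1_le; [exact: addr_ge0|exact: lexx|exact: leq_addl].
Qed.

Lemma tameM f h : tame f -> tame h -> tame (fun x => f x * h x).
Proof.
move=> [mf [C [k [C0 fC fL]]]] [mh [D [l [D0 hD hL]]]].
split; first exact: measurable_funM.
exists (2 * (C * D)), (k + l)%N; split=> [|x|x y]; first by rewrite !mulr_ge0.
  rewrite normrM exprD.
  apply: le_trans (ler_pM _ _ (fC x) (hD x)) _ => //.
  rewrite mulrACA; apply: ler_wpM2r; first by rewrite mulr_ge0// exprn_ge0// addr_ge0.
  by have := mulr_ge0 C0 D0; lra.
have -> : f x * h x - f y * h y = f x * (h x - h y) + (f x - f y) * h y by ring.
apply: le_trans (ler_normD _ _) _; rewrite !normrM.
set N := (1 + `|x| + `|y|).
have N0 : 0 <= N by rewrite /N !addr_ge0.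
have fx : `|f x| <= C * N ^+ k.
  apply: le_trans (fC _) _; rewrite ler_wpM2l// /N -addrA.
  by apply: pow1_le; rewrite ?lerDl.
have hy : `|h y| <= D * N ^+ l.
  apply: le_trans (hD _) _; rewrite ler_wpM2l// /N -addrA.
  by apply: pow1_le; rewrite ?lerDr.
have -> : 2 * (C * D) * N ^+ (k + l) * `|x - y| =
  (C * N ^+ k) * (D * N ^+ l * `|x - y|) + (C * N ^+ k * `|x - y|) * (D * N ^+ l).
  by rewrite exprD; ring.
by apply: lerD; apply: ler_pM.
Qed.

Lemma norm_lim_le (u : nat -> R) l C : u k @[k --> \oo] --> l ->
  (forall k, `|u k| <= C) -> `|l| <= C.
Proof.
move=> /(cvg_norm (F := \oo)) c uC; have {}c := c _.
rewrite -(cvg_lim (@Rhausdorff R) c); apply: limr_le; last exact: nearW.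
by apply/cvg_ex; eexists; exact: c.
Qed.

Lemma tame_comp (s : R -> R) L f : (forall y z, `|s y - s z| <= L * `|y - z|) ->
  tame f -> tame (fun x => s (f x)).
Proof.
move=> sL [mf [C [k [C0 fC fL]]]].
have L0 : 0 <= L by have := sL 1 0; rewrite subr0 normr1 mulr1; apply: le_trans.
split.
  suff ms : measurable_fun setT (s : measurableTypeR R -> measurableTypeR R).
    exact: (measurableT_comp ms mf).
  apply: continuous_measurable_fun => y.
  have L1 : 0 < L + 1 by lra.
  apply/cvgrPdist_lt => e e0; have eL : 0 < e / (L + 1) by rewrite divr_gt0.
  near=> z; apply: le_lt_trans (sL _ _) _.
  apply: (@le_lt_trans _ _ ((L + 1) * `|y - z|)); first by rewrite ler_wpM2r// lerDl.
  rewrite mulrC -ltr_pdivlMr//; near: z.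
exists (`|s 0| + L * C), k; split=> [|x|x y]; first by rewrite addr_ge0// mulr_ge0.
  have -> : s (f x) = s 0 + (s (f x) - s 0) by ring.
  apply: le_trans (ler_normD _ _) _; rewrite mulrDl; apply: lerD.
    by rewrite ler_peMr// exprn_ege1// lerDl.
  apply: le_trans (sL _ _) _; rewrite subr0 -mulrA; apply: ler_wpM2l => //.
apply: le_trans (sL _ _) _; rewrite mulrDl mulrDl -[leLHS]add0r; apply: lerD.
  by rewrite !mulr_ge0// exprn_ge0// !addr_ge0.
by rewrite -!mulrA; apply: ler_wpM2l => //; rewrite !mulrA.
Unshelve. all: by end_near. Qed.

Lemma tameZ c f : tame f -> tame (fun x => c * f x).
Proof. by move=> tf; apply: tameM => //; exact: tame_cst. Qed.

Lemma tame_sum (I : finType) (F : I -> 'rV[R]_n -> R) : (forall i, tame (F i)) ->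
  tame (fun x => \sum_i F i x).
Proof.
move=> tF; elim: (index_enum I) => [|i s IH].
  rewrite (_ : (fun x => _) = fun=> 0); first exact: tame_cst.
  by apply/funext => x; rewrite big_nil.
rewrite (_ : (fun x => _) = fun x => F i x + \sum_(j <- s) F j x); first exact: tameD.
by apply/funext => x; rewrite big_cons.
Qed.

Lemma tame_intg f : tame f -> intg g f.
Proof. by move=> [mf [C [k [_ fC _]]]]; exact: (intg_poly gg mf fC). Qed.

Lemma mfieldD a b : mfield a -> mfield b -> mfield (fun x => a x + b x).
Proof.
by move=> ma mb i; under eq_fun do rewrite mxE; exact: measurable_funD.
Qed.

Lemma mfieldZ f a : measurable_fun setT (f : V n -> R) -> mfield a ->
  mfield (fun x => f x *: a x).
Proof.
by move=> mf ma i; under eq_fun do rewrite mxE; exact: measurable_funM.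
Qed.

Lemma has_gradD f h a b : has_grad f a -> has_grad h b ->
  has_grad (fun x => f x + h x) (fun x => a x + b x).
Proof.
move=> [ma fa] [mb hb]; split; first exact: mfieldD.
by apply: aeS2 fa hb => x; exact: rderD.
Qed.

Lemma has_gradM f h a b : tame f -> tame h -> has_grad f a -> has_grad h b ->
  has_grad (fun x => f x * h x) (fun x => h x *: a x + f x *: b x).
Proof.
move=> tf th [ma fa] [mb hb]; split.
  by apply: mfieldD; apply: mfieldZ => //; exact: tame_meas.
by apply: aeS2 fa hb => x; exact: rderM.
Qed.

Lemma has_grad_cst c : has_grad (fun=> c) (fun=> 0).
Proof.
split; last by apply: aeW => x; exact: rder_cst.
by move=> i; under eq_fun do rewrite mxE; exact: measurable_cst.
Qed.

Lemma has_grad_comp (s s' : R -> R) f a : tame f ->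
  (forall y : R, is_derive y (1 : R) s (s' y)) ->
  measurable_fun setT (s' : measurableTypeR R -> measurableTypeR R) ->
  has_grad f a -> has_grad (fun x => s (f x)) (fun x => s' (f x) *: a x).
Proof.
move=> tf Hs ms [ma fa]; split.
  by apply: mfieldZ => //; apply: measurableT_comp => //; exact: tame_meas.
by apply: aeS fa => x; exact: rder_comp.
Qed.

Lemma has_gradZ c f a : tame f -> has_grad f a ->
  has_grad (fun x => c * f x) (fun x => c *: a x).
Proof.
move=> tf fa; have := has_gradM (tame_cst c) tf (has_grad_cst c) fa.
rewrite (_ : (fun x => f x *: 0 + c *: a x) = (fun x => c *: a x))//.
by apply/funext => x; rewrite scaler0 add0r.
Qed.

Lemma has_grad_coord i : has_grad (fun x => x ord0 i) (fun=> delta_mx ord0 i).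
Proof.
split; last by apply: aeW => x; exact: rder_coord.
by move=> j; exact: measurable_cst.
Qed.

Lemma has_grad_sum (I : finType) (F : I -> 'rV[R]_n -> R) (A : I -> 'rV[R]_n -> 'rV[R]_n) :
  (forall i, has_grad (F i) (A i)) ->
  has_grad (fun x => \sum_i F i x) (fun x => \sum_i A i x).
Proof.
move=> H; elim: (index_enum I) => [|i s IH].
  rewrite (_ : (fun x => \sum_(i <- _) F i x) = fun=> 0); last by apply/funext => x; rewrite big_nil.
  rewrite (_ : (fun x => \sum_(i <- _) A i x) = fun=> 0); last by apply/funext => x; rewrite big_nil.
  exact: has_grad_cst.
rewrite (_ : (fun x => \sum_(j <- _) F j x) = fun x => F i x + \sum_(j <- s) F j x); last by apply/funext => x; rewrite big_cons.
rewrite (_ : (fun x => \sum_(j <- _) A j x) = fun x => A i x + \sum_(j <- s) A j x); last by apply/funext => x; rewrite big_cons.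
exact: has_gradD.
Qed.

Lemma tame_quot f : tame f -> exists C k, 0 <= C /\
  forall t x v, 0 < t <= 1 ->
    `|(f (rx t x v) - f x) / t| <= C * (1 + `|x| + `|v|) ^+ k.
Proof.
move=> [_ [C [k [C0 _ fL]]]]; exists (C * 2 ^+ k), k.+1; split.
  by rewrite mulr_ge0// exprn_ge0.
move=> t x v /andP[t0 t1]; rewrite normrM normfV (gtr0_norm t0) ler_pdivrMr//.
apply: le_trans (fL _ _) _.
have rd := @rx_dist _ _ t x v; rewrite (ltW t0) t1 in rd.
set N := 1 + `|x| + `|v|.
have N0 : 0 <= N by rewrite /N !addr_ge0.
apply: (@le_trans _ _ (C * (2 * N) ^+ k * (t * N))).
  apply: ler_pM => //.
  - by rewrite mulr_ge0// exprn_ge0// !addr_ge0.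
  - apply: ler_wpM2l => //; rewrite lerXn2r ?nnegrE ?addr_ge0 ?mulr_ge0//.
    by have := rx_norm t x v; rewrite /N; have := normr_ge0 v; lra.
  - apply: le_trans (rd isT) _; apply: ler_wpM2l; first exact: ltW.
    by rewrite /N -addrA lerDr.
by rewrite exprMn exprS le_eqVlt; apply/orP; left; apply/eqP; ring.
Qed.

(** A partial derivative is a limit of difference quotients, which have
    polynomial growth. *)
Lemma tame_grad_bound f a : tame f -> has_grad f a ->
  exists C k, 0 <= C /\ {ae g, forall x, forall i, `|a x ord0 i| <= C * (1 + `|x : 'rV[R]_n|) ^+ k}.
Proof.
move=> tf [_ fa]; have [C [k [C0 fC]]] := tame_quot tf.
exists (C * 2 ^+ k), k; split; first by rewrite mulr_ge0// exprn_ge0.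
apply: aeS fa => x H i; have := H _ (delta_mx ord0 i) null_tk; rewrite dotp_delta => c.
apply: (norm_lim_le c) => k0; apply: le_trans (fC _ _ _ _) _; first by rewrite tk_gt0 tk_le1.
rewrite -mulrA; apply: ler_wpM2l => //; rewrite -exprMn lerXn2r ?nnegrE ?addr_ge0 ?mulr_ge0//.
have : `|delta_mx ord0 i : 'rV[R]_n| <= 1.
  case: (rV_norm_attained (delta_mx ord0 i : 'rV[R]_n)) => [->//|[j ->]].
  by rewrite mxE; case: (_ && _); rewrite ?normr1// normr0.
by have := normr_ge0 (x : 'rV[R]_n); lra.
Qed.

Lemma intg_ae_poly (f : V n -> R) C k : measurable_fun setT f ->
  {ae g, forall x, `|f x| <= C * (1 + `|x : 'rV[R]_n|) ^+ k} -> intg g f.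
Proof. by move=> mf fC; apply: (intg_ae_le mf fC); apply: intgZ; exact: intg_gaussian_pow. Qed.

Lemma tame_grad_intg f a i : tame f -> has_grad f a -> intg g (fun x : V n => a x ord0 i).
Proof.
move=> tf fa; have [C [k [_ H]]] := tame_grad_bound tf fa.
by apply: (@intg_ae_poly _ C k); [case: fa|apply: aeS H => x].
Qed.

Lemma tame_grad_sqr_intg f a i : tame f -> has_grad f a ->
  intg g (fun x : V n => a x ord0 i ^+ 2).
Proof.
move=> tf fa; have [C [k [C0 H]]] := tame_grad_bound tf fa.
apply: (@intg_ae_poly _ (C ^+ 2) (k * 2)); first by case: fa => ma _; apply: measurable_funX.
apply: aeS H => x /(_ i) H; rewrite normrX exprM -exprMn lerXn2r ?nnegrE ?mulr_ge0 ?exprn_ge0 ?addr_ge0//.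
Qed.

Lemma measurable_rot_tk (U : V n * V n -> R) t : measurable_fun setT U ->
  measurable_fun setT (fun z => U (rot (cos t) (sin t) z)).
Proof. by move=> mU; exact: (measurableT_comp mU (@measurable_rot R _ _ n)). Qed.

Lemma ae_psq_fst (p : V n -> Prop) : {ae g, forall x, p x} -> {ae psq g, forall z, p z.1}.
Proof. exact: ae_fst. Qed.

Lemma ae_psq_snd (p : V n -> Prop) : {ae g, forall x, p x} -> {ae psq g, forall z, p z.2}.
Proof. exact: ae_snd. Qed.

(** The integral of [U] along rotations is constant; its derivative at the
    origin vanishes. *)
Lemma rot_derivative (U U' : V n * V n -> R) C k :
  measurable_fun setT U -> measurable_fun setT U' -> intg (psq g) U ->
  (forall t (z : V n * V n), 0 < t <= 1 -> `|(U (rot (cos t) (sin t) z) - U z) / t| <=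
     C * (1 + `|z.1 : 'rV[R]_n| + `|z.2 : 'rV[R]_n|) ^+ k) ->
  {ae psq g, forall z, (U (rot (cos (tk k0)) (sin (tk k0)) z) - U z) / tk k0 @[k0 --> \oo] --> U' z} ->
  intg (psq g) U' /\ Ex (psq g) U' = 0.
Proof.
move=> mU mU' iU UC UU'.
have mF k0 : measurable_fun setT (fun z => (U (rot (cos (tk k0)) (sin (tk k0)) z) - U z) / tk k0).
  by apply: measurable_funM => //; apply: measurable_funB => //; exact: measurable_rot_tk.
have [iU' c] := Ex_cvg mF mU' UU' (aeW _ (fun z k0 => UC (tk k0) z (introT andP (conj (tk_gt0 k0) (tk_le1 k0)))))
   (intgZ C (intg_psq_pow gg k)).
split=> //; apply/esym.
apply: (cvg_unique _ _ c) => //.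
rewrite (_ : (fun k => _) = fun=> 0); first exact: cvg_cst.
apply/funext => k0.
have [iR ER] := Ex_rot gg (cos_gt01 (tk_itv k0)) (cos2Dsin2 (tk k0)) iU.
under eq_Ex do rewrite mulrC.
by rewrite ExZ ?ExB ?ER ?subrr ?mulr0//; exact: intgB.
Qed.

Lemma intg_tame_grad f h b i : tame f -> tame h -> has_grad h b ->
  intg g (fun x : V n => f x * b x ord0 i).
Proof.
move=> [mf [C [k [C0 fC _]]]] th hb; have [D [l [D0 H]]] := tame_grad_bound th hb.
apply: (@intg_ae_poly _ (C * D) (k + l)).
  by apply: measurable_funM => //; case: hb.
apply: aeS H => x /(_ i) H.
by rewrite normrM exprD mulrACA; apply: ler_pM.
Qed.

Lemma tame_poly2 f : tame f -> exists C k, 0 <= C /\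
  forall t (x v : 'rV[R]_n), `|f (rx t x v)| <= C * (1 + `|x| + `|v|) ^+ k.
Proof.
move=> [mf [C [k [C0 fC _]]]]; exists C, k; split=> // t x v.
apply: le_trans (fC _) _; apply: ler_wpM2l => //; rewrite -addrA.
by apply: pow1_le => //; exact: rx_norm.
Qed.

(** The integral set to zero is that of the rotation derivative of the product
    of [f], [phi] and [chi]. Here [D z] is the derivative of [f] at [z.1] in the
    direction [z.2], not yet known to be linear in [z.2]. *)
Lemma rot_ibp (D : V n * V n -> R) f phi chi dphi dchi :
  tame f -> tame phi -> tame chi -> has_grad phi dphi -> has_grad chi dchi ->
  measurable_fun setT D ->
  {ae psq g, forall z, (f (rx (tk k) z.1 z.2) - f z.1) / tk k @[k --> \oo] --> D z} ->
  intg (psq g) (fun z => D z * (phi z.1 * chi z.2)) /\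
  Ex (psq g) (fun z => D z * (phi z.1 * chi z.2)) =
  \sum_i (Ex g (fun x : V n => f x * phi x * x ord0 i) * Ex g (fun v : V n => dchi v ord0 i)
        - Ex g (fun x : V n => f x * dphi x ord0 i) * Ex g (fun v : V n => chi v * v ord0 i)).
Proof.
move=> tf tp tc hp hc mD fD.
pose F x := f x * phi x.
have tF : tame F by exact: tameM.
pose A i (z : V n * V n) := (f z.1 * dphi z.1 ord0 i) * (chi z.2 * z.2 ord0 i).
pose B i (z : V n * V n) := (F z.1 * z.1 ord0 i) * (dchi z.2 ord0 i).
have iA1 i : intg g (fun x : V n => f x * dphi x ord0 i) by exact: intg_tame_grad hp.
have iA2 i : intg g (fun x : V n => chi x * x ord0 i).
  by apply: tame_intg; apply: tameM => //; exact: tame_coord.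
have iB1 i : intg g (fun x : V n => F x * x ord0 i).
  by apply: tame_intg; apply: tameM => //; exact: tame_coord.
have iB2 i : intg g (fun x : V n => dchi x ord0 i) by exact: tame_grad_intg hc.
have iA i : intg (psq g) (A i) by exact: (intg_prod (iA1 i) (iA2 i)).
have iB i : intg (psq g) (B i) by exact: (intg_prod (iB1 i) (iB2 i)).
pose U (z : V n * V n) := F z.1 * chi z.2.
pose Dp z := D z * (phi z.1 * chi z.2).
pose U' z := Dp z + (\sum_i A i z - \sum_i B i z).
have m1 (h : V n -> R) : measurable_fun setT h -> measurable_fun setT (fun z : V n * V n => h z.1).
  by move=> mh; exact: (measurableT_comp mh measurable_fst).
have m2 (h : V n -> R) : measurable_fun setT h -> measurable_fun setT (fun z : V n * V n => h z.2).
  by move=> mh; exact: (measurableT_comp mh measurable_snd).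
have mU : measurable_fun setT U.
  by apply: measurable_funM; [apply: m1; exact: tame_meas|apply: m2; exact: tame_meas].
have mDp : measurable_fun setT Dp.
  apply: measurable_funM => //.
  by apply: measurable_funM; [apply: m1; exact: tame_meas|apply: m2; exact: tame_meas].
have iS : intg (psq g) (fun z => \sum_i A i z - \sum_i B i z).
  by apply: intgB; exact: intg_sum.
have mU' : measurable_fun setT U' by apply: measurable_funD => //; exact: intg_meas iS.
have iU : intg (psq g) U by exact: (intg_prod (tame_intg tF) (tame_intg tc)).
have [C1 [k1 [C10 q1]]] := tame_quot tF.
have [C2 [k2 [C20 q2]]] := tame_quot tc.
have [C3 [k3 [C30 q3]]] := tame_poly2 tF.
have [C4 [k4 [C40 q4]]] := tame_poly2 tc.
have bound t (z : V n * V n) : 0 < t <= 1 -> `|(U (rot (cos t) (sin t) z) - U z) / t| <=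
     (C1 * C4 + C3 * C2) * (1 + `|z.1 : 'rV[R]_n| + `|z.2 : 'rV[R]_n|) ^+ (k1 + k4 + (k3 + k2)).
  case: z => x v t1; rewrite rotE /U/=.
  have -> : (F (rx t x v) * chi (rx t v (- (x : 'rV_n))) - F x * chi v) / t =
    (F (rx t x v) - F x) / t * chi (rx t v (- (x : 'rV_n))) + F x * ((chi (rx t v (- (x : 'rV_n))) - chi v) / t).
    by rewrite mulrDl; ring.
  set N := 1 + `|x : 'rV[R]_n| + `|v : 'rV[R]_n|.
  have N1 : 1 <= N by rewrite /N -addrA lerDl addr_ge0.
  have sw : 1 + `|v : 'rV[R]_n| + `|- (x : 'rV[R]_n)| = N by rewrite normrN /N addrAC.
  have h1 := q1 _ x v t1; have h2 := q2 _ v (- (x : 'rV_n)) t1.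
  have h4 := q4 t v (- (x : 'rV_n)); have h3 := q3 0 x v.
  rewrite sw in h2 h4; rewrite /rx cos0 sin0 scale1r scale0r addr0 in h3.
  apply: le_trans (ler_normD _ _) _; rewrite !normrM mulrDl; apply: lerD.
    apply: (@le_trans _ _ (C1 * N ^+ k1 * (C4 * N ^+ k4))).
      by apply: ler_pM => //; rewrite -normrM.
    rewrite mulrACA -exprD; apply: ler_wpM2l; first exact: mulr_ge0.
    by apply: ler_weXn2l => //; exact: leq_addr.
  apply: (@le_trans _ _ (C3 * N ^+ k3 * (C2 * N ^+ k2))).
    by apply: ler_pM => //; rewrite -normrM.
  rewrite mulrACA -exprD; apply: ler_wpM2l; first exact: mulr_ge0.
  by apply: ler_weXn2l => //; exact: leq_addl.
have lim : {ae psq g, forall z, (U (rot (cos (tk k)) (sin (tk k)) z) - U z) / tk k @[k --> \oo] --> U' z}.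
  apply: (@filterS3 _ _ (ae_filter_ringOfSetsType (psq g))) fD (ae_psq_fst (proj2 hp)) (ae_psq_snd (proj2 hc)).
  move=> [x v]/= cD cp cc.
  have cp' := cp _ v null_tk; have cc' := cc _ (- (x : 'rV_n)) null_tk.
  have cx := rder_cvg (- (x : 'rV_n)) null_tk cc.
  have cf := rder_cvg v null_tk cp.
  have -> : U' (x, v) = D (x, v) * phi x * chi v + f x * dotp (dphi x) v * chi v +
      f x * phi x * dotp (dchi v) (- (x : 'rV_n)).
    rewrite /U' /Dp dotpNr /dotp mulrN !mulr_sumr mulr_suml -addrA/= mulrA; congr (_ + (_ - _)).
      by apply: eq_bigr => i _; rewrite /A/=; ring.
    by apply: eq_bigr => i _; rewrite /B/F/=; ring.
  rewrite (_ : (fun k => _) = fun k =>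
     (f (rx (tk k) x v) - f x) / tk k * phi (rx (tk k) x v) * chi (rx (tk k) v (- (x : 'rV_n))) +
     f x * ((phi (rx (tk k) x v) - phi x) / tk k) * chi (rx (tk k) v (- (x : 'rV_n))) +
     f x * phi x * ((chi (rx (tk k) v (- (x : 'rV_n))) - chi v) / tk k)); last first.
    apply/funext => k; rewrite rotE /U /F/=; ring.
  apply: cvgD; [apply: cvgD|].
  - by apply: cvgM => //; apply: cvgM.
  - by apply: cvgM => //; apply: cvgM => //; exact: cvg_cst.
  - by apply: cvgM => //; exact: cvg_cst.
have [iU' EU'] := rot_derivative mU mU' iU bound lim.
have iDp : intg (psq g) Dp.
  rewrite (_ : Dp = fun z => U' z - (\sum_i A i z - \sum_i B i z)); first exact: intgB.
  by apply/funext => z; rewrite /U' addrK.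
split=> //; have : Ex (psq g) U' = Ex (psq g) Dp + (\sum_i Ex (psq g) (A i) - \sum_i Ex (psq g) (B i)).
  by rewrite /U' ExD// ExB ?Ex_sum//; exact: intg_sum.
rewrite EU' => /esym/eqP; rewrite addr_eq0 opprB -sumrB => /eqP ->.
apply: eq_bigr => i _; congr (_ - _).
  exact: (Ex_prod (iB1 i) (iB2 i)).
exact: (Ex_prod (iA1 i) (iA2 i)).
Qed.

(** Gaussian integration by parts: the test functions are [1] and the [j]-th
    coordinate of the second vector, whose covariances with the other
    coordinates vanish. *)
Lemma gauss_ibp f a j : tame f -> has_grad f a ->
  Ex g (fun x : V n => a x ord0 j) = Ex g (fun x : V n => f x * x ord0 j).
Proof.
move=> tf fa; have [ma fa'] := fa.
have mD : measurable_fun setT (fun z : V n * V n => dotp (a z.1) z.2).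
  apply: measurable_sum => i; apply: measurable_funM.
    exact: (measurableT_comp (ma i) measurable_fst).
  exact: measurable_coord2.
have H : {ae psq g, forall z, (f (rx (tk k) z.1 z.2) - f z.1) / tk k @[k --> \oo] --> dotp (a z.1) z.2}.
  apply: aeS (ae_psq_fst fa') => z h.
  by apply: h; exact: null_tk.
have [_] := rot_ibp tf (tame_cst 1) (tame_coord j) (has_grad_cst 1) (has_grad_coord j) mD H.
have ia i : intg g (fun x : V n => a x ord0 i) by exact: tame_grad_intg fa.
rewrite (_ : (fun z : V n * V n => _) = fun z => \sum_i (a z.1 ord0 i * (z.2 ord0 i * z.2 ord0 j))); last first.
  by apply/funext => z; rewrite mul1r /dotp mulr_suml; apply: eq_bigr => i _; rewrite mulrA.
have ip i : intg (psq g) (fun z : V n * V n => a z.1 ord0 i * (z.2 ord0 i * z.2 ord0 j)).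
  exact: (intg_prod (ia i) (intg_coordM gg i j)).
rewrite Ex_sum// (bigD1 j)//= [X in _ + X]big1 ?addr0; last first.
  move=> i ij; rewrite [LHS](Ex_prod (ia i) (intg_coordM gg i j)) (Ex_coordM gg) (negbTE ij).
  by rewrite mulr0.
rewrite [LHS](Ex_prod (ia j) (intg_coordM gg j j)) (Ex_coordM gg) eqxx mulr1 => ->.
have E0 i : Ex g (fun=> (delta_mx ord0 j : 'rV[R]_n) ord0 i) = (i == j)%:R.
  by apply: etrans (Ex_cst _ _) _; rewrite mxE eqxx.
have Ez i : Ex g (fun x : V n => f x * (0 : 'rV[R]_n) ord0 i) = 0.
  by rewrite (@eq_Ex _ _ _ _ _ (cst 0)) ?Ex_cst// => x; rewrite mxE mulr0.
rewrite (bigD1 j)//= [X in _ + X]big1 ?addr0; last first.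
  by move=> i ij; rewrite E0 Ez (negbTE ij) mulr0 mul0r subr0.
rewrite E0 Ez eqxx mulr1 mul0r subr0.
by apply: eq_Ex => x; rewrite mulr1.
Qed.

End integration_by_parts.

(** * Almost everywhere differentiability of Lipschitz functions *)

Section existence_of_derivatives.
Context {R : realType} {n : nat}.
Local Notation V := (@rvm R).
Local Notation MR := (measurableTypeR R).
Variable g : probability (V n) R.
Hypothesis gg : std_gaussian g.
Variables (f : 'rV[R]_n -> R) (L : R).
Hypothesis L0 : 0 < L.
Hypothesis fL : forall x y, `|f x - f y| <= L * `|x - y|.

Lemma lipschitz_measurable : measurable_fun setT (f : V n -> R).
Proof.
apply: measurable_cts; apply: (@poly_lip_continuous _ _ _ L 0); first exact: ltW.
by move=> x y; rewrite expr0 mulr1.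
Qed.

Lemma lipschitz_tame : tame f.
Proof.
split; first exact: lipschitz_measurable.
exists (`|f 0| + L), 1%N; split=> [|x|x y].
- by rewrite addr_ge0// ltW.
- have -> : f x = f 0 + (f x - f 0) by ring.
  apply: le_trans (ler_normD _ _) _; have := fL x 0; rewrite subr0 expr1 => h.
  have h1 : 0 <= `|f 0| * `|x| by exact: mulr_ge0.
  by have := L0; rewrite mulrDr mulrDl; lra.
- apply: le_trans (fL _ _) _; apply: ler_wpM2r => //; rewrite expr1.
  have h1 : 0 <= (`|f 0| + L) * (`|x| + `|y|) by rewrite mulr_ge0// addr_ge0// ltW.
  by have := normr_ge0 (f 0); rewrite -addrA mulrDr; lra.
Qed.

Lemma rx_lip s t (x v : 'rV[R]_n) : `|rx s x v - rx t x v| <= `|s - t| * (`|x| + `|v|).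
Proof.
have -> : rx s x v - rx t x v = (cos s - cos t) *: x + (sin s - sin t) *: v.
  by rewrite !scalerBl opprD addrACA.
apply: le_trans (ler_normD _ _) _; rewrite !normrZ mulrDr; apply: lerD; apply: ler_wpM2r => //.
  rewrite -[leRHS]mul1r; apply: (derive_lipschitz (fun x => is_derive_cos x)) => y.
  by rewrite normrN ler_norml sin_geN1 sin_le1.
rewrite -[leRHS]mul1r; apply: (derive_lipschitz (fun x => is_derive_sin x)) => y.
by rewrite ler_norml cos_geN1 cos_le1.
Qed.

Definition rquot (t : R) (z : V n * V n) := (f (rx t z.1 z.2) - f z.1) / t.

Lemma measurable_rx t : measurable_fun setT (fun z : V n * V n => rx t z.1 z.2 : V n).
Proof.
apply: measurable_rvm => i; under eq_fun do rewrite !mxE.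
apply: measurable_funD; apply: measurable_funM => //.
  exact: measurable_coord1.
exact: measurable_coord2.
Qed.

Lemma measurable_rquot t : measurable_fun setT (rquot t).
Proof.
apply: measurable_funM => //; apply: measurable_funB.
  exact: (measurableT_comp lipschitz_measurable (@measurable_rx t)).
exact: (measurableT_comp lipschitz_measurable measurable_fst).
Qed.

Lemma rquot_bound t z : 0 < t <= 1 ->
  `|rquot t z| <= L * (`|z.1 : 'rV[R]_n| + `|z.2 : 'rV[R]_n|).
Proof.
move=> /andP[t0 t1]; rewrite normrM normfV (gtr0_norm t0) ler_pdivrMr//.
apply: le_trans (fL _ _) _; rewrite -mulrA; apply: ler_wpM2l; first exact: ltW.
by rewrite mulrC; apply: rx_dist; rewrite t1 ltW.
Qed.

(** Intersections over rational times are countable, hence measurable. *)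
Definition ratn (a : nat) : R := ratr (odflt 0 (unpickle a : option rat)).

Lemma ratn_dense (p q : R) : p < q -> exists2 a, p < ratn a & ratn a < q.
Proof.
move=> pq; have [r /itvP rpq] := rat_in_itvoo pq.
by exists (pickle r); rewrite /ratn pickleK/= rpq.
Qed.

(** The set of [z] at which the difference quotients satisfy the Cauchy criterion
    along the rationals, written so as to be visibly measurable. *)
Definition qcauchy : set (V n * V n) :=
  \bigcap_(m : nat) \bigcup_(k : nat) \bigcap_(a : nat) \bigcap_(b : nat)
  [set z | 0 < ratn a < tk k -> 0 < ratn b < tk k ->
     `|rquot (ratn a) z - rquot (ratn b) z| <= tk m].

Lemma measurable_qcauchy : measurable qcauchy.
Proof.
apply: bigcapT_measurable => m; apply: bigcupT_measurable => k.
apply: bigcapT_measurable => a; apply: bigcapT_measurable => b.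
have [ha|ha] := boolP (0 < ratn a < tk k); last first.
  by rewrite (_ : [set z | _] = setT)//; apply/seteqP; split.
have [hb|hb] := boolP (0 < ratn b < tk k); last first.
  by rewrite (_ : [set z | _] = setT)//; apply/seteqP; split.
rewrite (_ : [set z | _] = [set z | `|rquot (ratn a) z - rquot (ratn b) z| <= tk m]); last first.
  by apply/seteqP; split=> z /=; [apply|].
rewrite -[X in measurable X]setTI.
have m1 : measurable_fun setT (fun z => `|rquot (ratn a) z - rquot (ratn b) z|).
  apply: measurableT_comp; first exact: normr_measurable.
  by apply: measurable_funB; exact: measurable_rquot.
have := measurable_fun_ler m1 (measurable_cst (tk m)) measurableT.
by move=> /(_ [set true] I).
Qed.

(** The limit is over all real times, while [qcauchy] only looks at rational
    ones. *)
Definition rlim (z : V n * V n) (l : R) := forall e, 0 < e -> exists2 d, 0 < d &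
  forall t, 0 < t < d -> `|rquot t z - l| <= e.

Lemma rlim_seq z l t : rlim z l -> null_seq t -> rquot (t k) z @[k --> \oo] --> l.
Proof.
move=> zl [t01 t0]; apply/cvgrPdist_le => e e0; have [d d0 H] := zl _ e0.
near=> k; rewrite distrC; apply: H; have /andP[-> _] := t01 k => /=.
rewrite -[t k]subr0 -[ltLHS]ger0_norm; last by rewrite subr0; have /andP[/ltW] := t01 k.
by near: k; have /cvgrPdistC_lt := t0; apply.
Unshelve. all: by end_near. Qed.

Lemma rquot_cont z (t : R) : 0 < t -> rquot s z @[s --> t] --> rquot t z.
Proof.
move=> t0; apply: cvgM; last by apply: cvgV; [rewrite gt_eqF|exact: cvg_id].
apply: cvgB; last exact: cvg_cst.
pose M := L * (`|z.1 : 'rV[R]_n| + `|z.2 : 'rV[R]_n|) + 1.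
have M0 : 0 < M by rewrite ltr_wpDl// mulr_ge0// ?addr_ge0// ltW.
apply/cvgrPdist_le => e e0; near=> s.
apply: le_trans (fL _ _) _; apply: (@le_trans _ _ (M * `|t - s|)).
  rewrite [leRHS]mulrDl -mulrA [_ * `|t - s|]mulrC.
  by apply: ler_wpDr; rewrite ?mul1r//; apply: ler_wpM2l; [exact: ltW|exact: rx_lip].
rewrite mulrC -ler_pdivlMr//; near: s.
by apply: (@cvgr_dist_le _ _ _ (nbhs t) _ id t cvg_id); rewrite divr_gt0.
Unshelve. all: by end_near. Qed.

(** The quotient is continuous in time, so rational times are enough. *)
Lemma qcauchy_real z m : qcauchy z -> exists k, forall s t, 0 < s < tk k -> 0 < t < tk k ->
  `|rquot s z - rquot t z| <= tk m.
Proof.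
move=> /(_ m I)[k _ H]; exists k => s t.
have approx r e : 0 < r < tk k -> 0 < e -> exists a, 0 < ratn a < tk k /\
    `|rquot r z - rquot (ratn a) z| <= e.
  move=> /andP[r0 rk] e0.
  have /cvgrPdist_le/(_ _ e0) [d /= d0 D] := rquot_cont (z := z) r0.
  have : Num.max 0 (r - d) < r by rewrite gt_max r0 ltrBlDr ltrDl d0.
  move=> /ratn_dense[a]; rewrite gt_max => /andP[a0 ad] ar; exists a.
  rewrite a0 (lt_trans ar)//; split=> //; apply: D => /=.
  by rewrite gtr0_norm ?subr_gt0// ltrBlDl -ltrBlDr.
move=> sk tk0; apply/ler_addgt0Pr => e e0.
have e2 : 0 < e / 2 by rewrite divr_gt0.
have [a [ak sa]] := approx _ _ sk e2; have [b [bk tb]] := approx _ _ tk0 e2.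
have := H a I b I ak bk.
have -> : rquot s z - rquot t z = (rquot s z - rquot (ratn a) z) +
  (rquot (ratn a) z - rquot (ratn b) z) - (rquot t z - rquot (ratn b) z) by ring.
move=> hab; apply: le_trans (ler_normB _ _) _.
by have := ler_normD (rquot s z - rquot (ratn a) z) (rquot (ratn a) z - rquot (ratn b) z); lra.
Qed.

Lemma tk_small (e : R) : 0 < e -> exists m, tk m <= e :> R.
Proof.
move=> e0; have /cvgrPdist_le/(_ _ e0)[N _ HN] := @tk_cvg R.
exists N; have := HN N (leqnn N); rewrite /= sub0r normrN.
by apply: le_trans; rewrite ler_norm.
Qed.

Lemma tk_lt k j : (k < j)%N -> 0 < (tk j : R) < tk k.
Proof.
by move=> kj; rewrite tk_gt0/= /tk ltf_pV2 ?posrE// ltr_nat.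
Qed.

Lemma qcauchy_rlim z : qcauchy z -> exists l, rlim z l.
Proof.
move=> qz; set u := fun j => rquot (tk j) z.
have uc : cvgn u.
  apply/cauchy_cvgP/cauchy_exP => e e0; have [m me] := tk_small (divr_gt0 e0 (ltr0n _ 2)).
  have [k H] := qcauchy_real m qz; exists (u k.+1); exists k.+1 => // j /= kj.
  apply: (@le_lt_trans _ _ (tk m)); last by apply: le_lt_trans me _; lra.
  by apply: H; exact: tk_lt.
exists (limn u) => e e0; have [m me] := tk_small e0.
have [k H] := qcauchy_real m qz; exists (tk k); first exact: tk_gt0.
move=> t tk0; apply: le_trans me; rewrite -normrN opprB.
have c : (u j - rquot t z) @[j --> \oo] --> limn u - rquot t z by apply: cvgB => //; exact: cvg_cst.
have {}c := cvg_norm c.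
rewrite -(cvg_lim (@Rhausdorff R) (c _)); apply: limr_le; first by apply/cvg_ex; eexists; exact: c.
by exists k.+1 => // j /= kj; apply: H => //; exact: tk_lt.
Qed.

Lemma rx_rot h theta (z : V n * V n) :
  rx h (rot (cos theta) (sin theta) z).1 (rot (cos theta) (sin theta) z).2 =
  rx (h + theta) z.1 z.2.
Proof. by apply/rowP => i; rewrite !mxE cosD sinD; ring. Qed.

(** If the restriction of [f] to the rotation path of [z] is differentiable at
    time [theta], then the quotients at the rotated point converge. *)
Lemma derivable_qcauchy (z : V n * V n) (theta : R) :
  derivable (fun t : R => f (rx t z.1 z.2)) theta (1 : R) ->
  qcauchy (rot (cos theta) (sin theta) z).
Proof.
move=> /cvg_ex[/= l cl] m _.
have e0 : 0 < tk m / 2 :> R by rewrite divr_gt0// tk_gt0.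
have /cvgrPdist_le/(_ _ e0)[d /= d0 D] := cl.
have [k kd] := tk_small d0; exists k => // a _ b _.
have S t : 0 < t < tk k -> `|l - rquot t (rot (cos theta) (sin theta) z)| <= tk m / 2.
  move=> /andP[t0 tk0].
  have -> : rquot t (rot (cos theta) (sin theta) z) =
      t^-1 *: (f (rx (t *: 1 + theta) z.1 z.2) - f (rx theta z.1 z.2)).
    rewrite /rquot rx_rot -[t *: 1]/(t * 1) mulr1 -[_ *: _]/(_ * _) mulrC.
    by congr (_ * (_ - f _)); rewrite rotE.
  apply: D; last by rewrite gt_eqF.
  by rewrite /= sub0r normrN gtr0_norm// (lt_le_trans tk0).
move=> /S ha /S hb; have := ler_normB (l - rquot (ratn b) (rot (cos theta) (sin theta) z))
  (l - rquot (ratn a) (rot (cos theta) (sin theta) z)).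
set A := rquot _ _; set B := rquot _ _ in ha *; rewrite (_ : l - A - (l - B) = B - A); last by ring.
by move=> h; apply: le_trans h _; lra.
Qed.

Notation U := (uniform_prob (@ltr01 R) : probability MR R).

Lemma ae_uniform (p : R -> Prop) :
  {ae (@lebesgue_measure R), forall x, 0 < x < 1 -> p x} -> {ae U, forall x, p x}.
Proof.
move=> [N [mN N0 HN]]; exists (N `|` ~` `]0, 1[%classic); split.
- by apply: measurableU => //; exact: measurableC.
- have /null_content_dominatesP D := dominates_uniform_prob (@ltr01 R).
  have mI : measurable ((N `|` ~` `]0, 1[%classic) `&` `[0, 1]%classic : set MR).
    by apply: measurableI => //; apply: measurableU => //; exact: measurableC.
  apply: etrans (integral_uniform_pdf _ _ _) (D _ mI _).
  apply: (@subset_measure0 _ _ _ (@lebesgue_measure R) _ (N `|` ([set 0] `|` [set 1]))) => //.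
  + by apply: measurableU => //; exact: measurableU.
  + move=> x [[Nx|/= nx] /=]; first by left.
    rewrite in_itv/= => /andP[x0 x1]; right; move: nx; rewrite in_itv/=.
    move: x0 x1; rewrite !le_eqVlt => /orP[/eqP<-|x0]; first by left.
    by move=> /orP[/eqP->|x1]; [right|rewrite x0 x1].
  + apply: etrans (measureU0 mN _ _) N0; first exact: measurableU.
    by apply: etrans (measureU0 _ _ _) _ => //; exact: lebesgue_measure_set1.
- move=> x /= npx; apply: contrapT => /not_orP[nN /contrapT]; rewrite /= in_itv/= => x01.
  by apply: nN; apply: HN => /= H; apply: npx; exact: H.
Qed.

Lemma measurable_rot_angle :
  measurable_fun setT (fun w : (V n * V n) * MR => rot (cos w.2) (sin w.2) w.1).
Proof.
have mc : measurable_fun setT (fun w : (V n * V n) * MR => cos w.2 : MR).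
  have mc : measurable_fun setT (cos : MR -> MR) by apply: continuous_measurable_fun; exact: continuous_cos.
  exact: (measurableT_comp mc measurable_snd).
have ms : measurable_fun setT (fun w : (V n * V n) * MR => sin w.2 : MR).
  have ms : measurable_fun setT (sin : MR -> MR) by apply: continuous_measurable_fun; exact: continuous_sin.
  exact: (measurableT_comp ms measurable_snd).
have m1 i : measurable_fun setT (fun w : (V n * V n) * MR => (w.1.1 : 'rV[R]_n) ord0 i).
  exact: (measurableT_comp (measurable_coord1 i) measurable_fst).
have m2 i : measurable_fun setT (fun w : (V n * V n) * MR => (w.1.2 : 'rV[R]_n) ord0 i).
  exact: (measurableT_comp (measurable_coord2 i) measurable_fst).
apply: measurable_fun_pair; apply: measurable_rvm => i; under eq_fun do rewrite !mxE.
  by apply: measurable_funD; apply: measurable_funM.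
by apply: measurable_funD; apply: measurable_funM => //; apply: measurable_funN.
Qed.

(** On each rotation path, [f] is a Lipschitz function of time, hence
    differentiable at almost all times. A rotation by a uniform random time
    preserves the law of the pair, so by Fubini almost every pair is a point
    of differentiability. *)
Lemma ae_qcauchy : {ae psq g, forall z, qcauchy z}.
Proof.
pose B := ~` qcauchy.
have mB : measurable B by apply: measurableC; exact: measurable_qcauchy.
pose k (w : (V n * V n) * MR) : R := \1_B (rot (cos w.2) (sin w.2) w.1).
have mIB : measurable_fun setT (\1_B : V n * V n -> R) by exact: measurable_indic.
have mk : measurable_fun setT k by exact: (measurableT_comp mIB measurable_rot_angle).
have iIB : intg (psq g) (\1_B : V n * V n -> R).
  by apply: (intg_le mIB _ (intg_cst (psq g) 1)) => z; rewrite indicE/= normr_nat lern1 leq_b1.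
have ik : intg (psq g \x U : probability _ R)%E k.
  by apply: (intg_le mk _ (intg_cst _ 1)) => z; rewrite /k indicE/= normr_nat lern1 leq_b1.
have [i1 E1] := Ex_fubini ik.
have [i2 E2] := Ex_fubiniC ik.
have Ez z : Ex U (fun theta => k (z, theta)) = 0.
  pose M : R := Num.max 1 (L * (`|z.1 : 'rV[R]_n| + `|z.2 : 'rV[R]_n|)).
  have M0 : 0 < M by rewrite lt_max ltr01.
  have hL s t : `|f (rx s z.1 z.2) - f (rx t z.1 z.2)| <= M * `|s - t|.
    apply: le_trans (fL _ _) _; apply: (@le_trans _ _ (L * (`|z.1 : 'rV[R]_n| + `|z.2 : 'rV[R]_n|) * `|s - t|)).
      by rewrite -mulrA [X in _ <= L * X]mulrC; apply: ler_wpM2l; [exact: ltW|exact: rx_lip].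
    by apply: ler_wpM2r => //; rewrite le_max lexx orbT.
  have H := ae_uniform (lipschitz_ae_derivable01 M0 hL).
  rewrite -[RHS](Ex_cst U 0); apply: Ex_ae => //.
    exact: (measurableT_comp mk (measurable_pair1 _)).
  apply: aeS H => t Ht.
  by rewrite /k indicE/= memNset// => Bz; apply: Bz; exact: derivable_qcauchy.
have Et : {ae U, forall t, Ex (psq g) (fun z => k (z, t)) = Ex (psq g) (\1_B)}.
  apply: ae_uniform; apply: aeW => t t01.
  have [_] := Ex_rot gg
    (cos_gt01 (introT andP (conj (ltW (andP t01).1) (ltW (andP t01).2)))) (cos2Dsin2 t) iIB.
  exact.
have E3 : Ex U (fun t => Ex (psq g) (fun z => k (z, t))) = Ex (psq g) (\1_B).
  by rewrite -[RHS](Ex_cst U); apply: Ex_ae => //; exact: intg_meas i2.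
have E0 : Ex (psq g) (\1_B) = 0.
  rewrite -E3 -E2 E1 -[RHS](Ex_cst (psq g) 0); apply: eq_Ex => z; exact: Ez.
exists B; split => //.
have := ExE iIB; rewrite E0.
by apply: etrans; rewrite integral_indic// setIT.
Qed.

End existence_of_derivatives.

(** * Functions with vanishing integrals over orthants *)

Section density_measure.
Context {R : realType} {d : measure_display} {T : measurableType d}.
Variables (P : probability T R) (h : T -> R).
Hypotheses (h0 : forall x, 0 <= h x) (mh : measurable_fun setT h).

(** The proofs are arguments because the measure structure is attached to the
    whole expression. *)
Definition dens of (forall x, 0 <= h x) & (measurable_fun setT h) :=
  fun A : set T => (\int[P]_(x in A) (h x)%:E)%E.

Let dens0 : dens h0 mh set0 = 0%E.
Proof. by rewrite /dens integral_set0. Qed.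

Let dens_ge0 A : (0 <= dens h0 mh A)%E.
Proof. by apply: integral_ge0 => x _; rewrite lee_fin. Qed.

Let dens_sa : semi_sigma_additive (dens h0 mh).
Proof.
apply: semi_sigma_additive_nng_induced => [|x]; last by rewrite lee_fin.
exact/measurable_EFinP.
Qed.

HB.instance Definition _ := isMeasure.Build _ _ _ (dens h0 mh) dens0 dens_ge0 dens_sa.

Lemma densE A : measurable A -> intg P h -> dens h0 mh A = (Ex P (fun x => \1_A x * h x))%:E.
Proof.
move=> mA ih; rewrite /dens integral_mkcond -ExE.
  apply: eq_integral => x _; rewrite patchE /= indicE.
  by case: (x \in A); rewrite ?mul1r ?mul0r.
apply: (intg_le _ _ (intg_abs ih)); first by apply: measurable_funM.
move=> x; rewrite normrM indicE normr_nat.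
by case: (x \in A); rewrite ?mul1r ?mul0r.
Qed.

End density_measure.

Lemma Ex_abs_eq0 (R : realType) d (T : measurableType d) (P : probability T R) (f : T -> R) :
  intg P f -> Ex P (fun x => `|f x|) = 0 -> {ae P, forall x, f x = 0}.
Proof.
move=> fi f0; have mf := intg_meas fi.
have := ae_eq_integral_abs P measurableT (f := EFin \o f) ((measurable_EFinP _ _).2 mf).
move=> [+ _]; have -> : (\int[P]_(x in setT) `|(EFin \o f) x|)%E = 0%E by rewrite /= (ExE (intg_abs fi)) f0.
move=> /(_ erefl); apply: aeS => x /= /(_ I) [].
by [].
Qed.

(** The positive and negative parts of [W] are the densities of two finite
    measures that agree on products of orthants, hence on all measurable sets;
    comparing them on the set where [W] is nonnegative gives the claim. *)
Lemma orthant_integral_null (R : realType) n (g : probability (@rvm R n) R)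
    (W : @rvm R n * @rvm R n -> R) : intg (psq g) W ->
  (forall a b, Ex (psq g) (fun z => \1_(orthant a `*` orthant b) z * W z) = 0) ->
  {ae psq g, forall z, W z = 0}.
Proof.
move=> iW H; have mW := intg_meas iW.
pose p z := Num.max (W z) 0; pose q z := Num.max (- W z) 0.
have p0 z : 0 <= p z by rewrite le_max lexx orbT.
have q0 z : 0 <= q z by rewrite le_max lexx orbT.
have mp : measurable_fun setT p by apply: measurable_maxr.
have mq : measurable_fun setT q by apply: measurable_maxr => //; apply: measurable_funN.
have pq z : W z = p z - q z.
  by rewrite /p /q /Num.max; case: ltP => h1; case: ltP => h2; rewrite ?subr0 ?sub0r ?opprK//; lra.
have le_p z : `|p z| <= `|W z|.
  by rewrite ger0_norm// /p ge_max normr_ge0 ler_norm.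
have le_q z : `|q z| <= `|W z|.
  by rewrite ger0_norm// /q ge_max normr_ge0 -normrN ler_norm.
have ip : intg (psq g) p by exact: intg_le mp le_p (intg_abs iW).
have iq : intg (psq g) q by exact: intg_le mq le_q (intg_abs iW).
have i1 A (h : _ -> R) : measurable A -> intg (psq g) h -> intg (psq g) (fun z => \1_A z * h z).
  move=> mA ih; apply: (intg_le _ _ (intg_abs ih)).
    by apply: measurable_funM => //; exact: intg_meas ih.
  by move=> z; rewrite normrM indicE normr_nat; case: (z \in A); rewrite ?mul1r ?mul0r.
have E A : measurable A -> Ex (psq g) (fun z => \1_A z * W z) =
    Ex (psq g) (fun z => \1_A z * p z) - Ex (psq g) (fun z => \1_A z * q z).
  by move=> mA; rewrite -ExB; [apply: eq_Ex => z; rewrite pq mulrBr|exact: i1|exact: i1].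
have mO (a b : 'rV[R]_n) : measurable (orthant a `*` orthant b : set (@rvm R n * @rvm R n)).
  by apply: measurableX; exact: measurable_orthant.
pose mup : {measure set _ -> \bar R} := dens (psq g) p0 mp.
pose muq : {measure set _ -> \bar R} := dens (psq g) q0 mq.
have D A : measurable A -> mup A = muq A.
  apply: prod_rvm_measure_unique.
    move=> a b; apply: etrans (densE p0 mp (mO a b) ip) _.
    apply: etrans (esym (densE q0 mq (mO a b) iq)); congr EFin; apply/eqP.
    by rewrite -subr_eq0 -E// H.
  by rewrite [mup _](densE p0 mp measurableT ip) ltry.
have Z A : measurable A -> Ex (psq g) (fun z => \1_A z * W z) = 0.
  move=> mA; rewrite E//; apply/eqP; rewrite subr_eq0; apply/eqP.
  have [//] : (Ex (psq g) (fun z => \1_A z * p z))%:E = (Ex (psq g) (fun z => \1_A z * q z))%:E.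
  by rewrite -(densE p0 mp mA ip) -(densE q0 mq mA iq); exact: D.
pose A := [set z | 0 <= W z].
have mA : measurable A.
  rewrite -[A]setTI; have := measurable_fun_ler (measurable_cst (0 : R)) mW measurableT.
  by move=> /(_ [set true] I).
apply: Ex_abs_eq0 => //.
rewrite (@eq_Ex _ _ _ _ _ (fun z => \1_A z * W z - \1_(~` A) z * W z)); last first.
  move=> z; rewrite !indicE in_setC; case: (boolP (z \in A)) => /= h; rewrite ?inE ?notin_setE/= in h.
    by rewrite mul1r mul0r subr0 ger0_norm.
  by rewrite mul0r mul1r sub0r ltr0_norm// ltNge; exact/negP.
by rewrite ExB ?Z ?subrr//; [exact: measurableC|exact: i1|apply: i1 => //; exact: measurableC].
Qed.

(** * Smooth approximation of orthants *)

Section test_functions.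
Context {R : realType}.

(** A smooth step from [0] at [-oo] to [1] at [+oo]. *)
Definition step (y : R) := expR (- expR (- y)).

Definition dstep (y : R) := expR (- y) * step y.

Lemma is_derive_step (y : R) : is_derive y (1 : R) step (dstep y).
Proof.
have h1 : is_derive y (1 : R) (fun x : R => - x) (-1) by exact: is_deriveN.
have h2 : is_derive y (1 : R) (fun x : R => expR (- x)) (expR (- y) * -1).
  exact: (@is_derive1_comp _ expR (fun x : R => - x) y _ _ (is_derive_expR _) h1).
have h3 : is_derive y (1 : R) (fun x : R => - expR (- x)) (- (expR (- y) * -1)) by exact: is_deriveN.
have -> : dstep y = expR (- expR (- y)) * (- (expR (- y) * -1)) by rewrite /dstep /step mulrN1 opprK mulrC.
exact: (@is_derive1_comp _ expR (fun x : R => - expR (- x)) y _ _ (is_derive_expR _) h3).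
Qed.

Lemma step_ge0 y : 0 <= step y. Proof. exact: expR_ge0. Qed.

Lemma step_le1 y : step y <= 1.
Proof. by rewrite -expR0 ler_expR oppr_le0 expR_ge0. Qed.

Lemma dstep_bound y : `|dstep y| <= 1.
Proof.
rewrite ger0_norm ?mulr_ge0 ?expR_ge0// /dstep /step [X in _ * X]expRN ler_pdivrMr ?expR_gt0// mul1r.
by apply: le_trans (expR_ge1Dx _); rewrite lerDr.
Qed.

Lemma step_lip y z : `|step y - step z| <= 1 * `|y - z|.
Proof. exact: (derive_lipschitz is_derive_step dstep_bound). Qed.

Lemma measurable_dstep : measurable_fun setT (dstep : measurableTypeR R -> measurableTypeR R).
Proof.
have mN : measurable_fun setT (fun y : measurableTypeR R => expR (- y) : measurableTypeR R).
  apply: (measurableT_comp (@measurable_expR R)); exact: oppr_measurable.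
apply: measurable_funM => //.
apply: (measurableT_comp (@measurable_expR R)); apply: (measurableT_comp _ mN).
exact: oppr_measurable.
Qed.

Lemma exp_tk k (y : R) : k%:R <= y -> expR (- y) <= tk k.
Proof.
move=> ky; rewrite expRN /tk lef_pV2 ?posrE ?expR_gt0//.
by apply: le_trans (expR_ge1Dx _); rewrite -natr1 addrC lerD2l.
Qed.

(** The drift [- k] makes the limit [0] at the end point, as for the indicator
    of an open ray. *)
Lemma step_cvg (x : R) : step (k%:R ^+ 2 * x - k%:R) @[k --> \oo] --> ((0 < x)%R%:R : R).
Proof.
apply/cvgrPdist_le => e e0; have /cvgrPdist_le/(_ _ e0) H := @tk_cvg R.
have [x0|x0] := ltP 0 x; near=> k.
- apply: (@le_trans _ _ (tk k)); last first.
    apply: le_trans (ler_norm _) _; rewrite -normrN -sub0r; near: k; exact: H.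
  set y := (X in step X); have ky : k%:R <= y.
    rewrite /y lerBrDr expr2 -mulrA -mulr2n -[_ *+ 2]mulr_natr; apply: ler_wpM2l => //.
    by rewrite -ler_pdivrMr//; near: k; exact: nbhs_infty_ger.
  apply: le_trans (exp_tk ky); rewrite ger0_norm ?subr_ge0 ?step_le1// lerBlDr -lerBlDl.
  exact: expR_ge1Dx.
- apply: (@le_trans _ _ (tk k)); last first.
    apply: le_trans (ler_norm _) _; rewrite -normrN -sub0r; near: k; exact: H.
  set y := (X in step X); have ky : k%:R <= expR (- y).
    apply: le_trans (expR_ge1Dx _); rewrite /y opprB addrCA lerDl addr_ge0//.
    by rewrite oppr_ge0 mulr_ge0_le0// exprn_ge0.
  by rewrite sub0r normrN ger0_norm ?step_ge0//; exact: exp_tk.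
Unshelve. all: by end_near. Qed.

Context {n : nat}.
Local Notation V := (@rvm R).
Variable g : probability (V n) R.
Hypothesis gg : std_gaussian g.

(** The functions that integration by parts accepts as factors. *)
Definition testable (f : 'rV[R]_n -> R) := tame f /\ exists a, has_grad g f a.

Lemma testableM f h : testable f -> testable h -> testable (fun x => f x * h x).
Proof.
move=> [tf [a fa]] [th [b hb]]; split; first exact: tameM.
by exists (fun x => h x *: a x + f x *: b x); exact: has_gradM.
Qed.

Lemma testable_cst c : testable (fun=> c).
Proof. by split; [exact: tame_cst|exists (fun=> 0); exact: has_grad_cst]. Qed.

Lemma testable_coord i : testable (fun x => x ord0 i).
Proof. by split; [exact: tame_coord|exists (fun=> delta_mx ord0 i); exact: has_grad_coord]. Qed.

Lemma testable_step i (c b : R) : testable (fun x => step (c * x ord0 i - b)).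
Proof.
have t1 : tame (fun x : 'rV[R]_n => c * x ord0 i) by apply: tameZ; exact: tame_coord.
have t2 : tame (fun x : 'rV[R]_n => c * x ord0 i - b) by apply: tameD => //; exact: tame_cst.
split; first by apply: tame_comp t2 => y z; exact: step_lip.
exists (fun x => dstep (c * x ord0 i - b) *: (c *: delta_mx ord0 i + 0)).
apply: has_grad_comp => //; first exact: is_derive_step.
  exact: measurable_dstep.
apply: has_gradD; last exact: has_grad_cst.
by apply: has_gradZ; [exact: tame_coord|exact: has_grad_coord].
Qed.

Lemma orthant_test (a : 'rV[R]_n) : exists phi : nat -> 'rV[R]_n -> R,
  [/\ forall k, testable (phi k), forall k x, `|phi k x| <= 1 &
      forall x, phi k x @[k --> \oo] --> (\1_(orthant a) x : R)].
Proof.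
pose s k i (x : 'rV[R]_n) := step (k%:R ^+ 2 * (x ord0 i - a ord0 i) - k%:R).
exists (fun k x => \prod_i s k i x); split.
- move=> k; elim: (index_enum _) => [|i t IH].
    by under eq_fun do rewrite big_nil; exact: testable_cst.
  under eq_fun do rewrite big_cons; apply: testableM => //.
  rewrite (_ : s k i = fun x => step (k%:R ^+ 2 * x ord0 i - (k%:R ^+ 2 * a ord0 i + k%:R))).
    exact: testable_step.
  by apply/funext => x; rewrite /s mulrBr opprD addrA.
- move=> k x; rewrite normr_prod.
  suff /andP[] : 0 <= \prod_i `|s k i x| <= 1 by [].
  apply: (big_ind (fun y : R => 0 <= y <= 1)) => [|y z /andP[y0 y1] /andP[z0 z1]|i _]; first by rewrite ler01 lexx.
    by rewrite mulr_ge0// mulr_ile1.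
  by rewrite normr_ge0 ger0_norm ?step_ge0 ?step_le1.
- move=> x.
  have -> : \1_(orthant a) x = \prod_i ((0 < x ord0 i - a ord0 i)%R%:R : R).
    rewrite indicE; case: (boolP (x \in _)); rewrite ?inE ?notin_setE/= => H.
      by rewrite big1// => i _; rewrite subr_gt0 H.
    move: H => /existsNP[i /negP Hi]; rewrite (bigD1 i)//= subr_gt0 (negbTE Hi).
    by rewrite mul0r.
  elim: (index_enum _) => [|i t IH].
    by under eq_fun do rewrite big_nil; rewrite big_nil; exact: cvg_cst.
  under eq_fun do rewrite big_cons; rewrite big_cons; apply: cvgM => //.
  exact: step_cvg.
Qed.

End test_functions.

(** * Rademacher's theorem *)

Section rademacher.
Context {R : realType} {n : nat}.
Local Notation V := (@rvm R).
Variable g : probability (V n) R.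
Hypothesis gg : std_gaussian g.
Variables (f : 'rV[R]_n -> R) (L : R).
Hypothesis L0 : 0 < L.
Hypothesis fL : forall x y, `|f x - f y| <= L * `|x - y|.

Let tf : tame f. Proof. exact: lipschitz_tame fL. Qed.

Let qf (k : nat) (z : V n * V n) := \1_(qcauchy f) z * rquot f (tk k) z.

(** Directional derivative of [f], set to [0] where it does not exist. *)
Definition dird (z : V n * V n) : R := limn (qf ^~ z).

Lemma dird_rlim z : qcauchy f z -> rlim f z (dird z).
Proof.
move=> qz; have [l zl] := qcauchy_rlim L0 fL qz.
suff -> : dird z = l by [].
apply: cvg_lim; first exact: Rhausdorff.
under eq_cvg do rewrite /qf indicE mem_set// mul1r.
by apply: (rlim_seq zl); exact: null_tk.
Qed.

Lemma dird_cvg z : qf k z @[k --> \oo] --> dird z.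
Proof.
have [qz|qz] := pselect (qcauchy f z).
  under eq_cvg do rewrite /qf indicE mem_set// mul1r.
  by apply: (rlim_seq (dird_rlim qz)); exact: null_tk.
have E : qf ^~ z = fun=> 0 by apply/funext => k; rewrite /qf indicE memNset// mul0r.
by rewrite /dird E lim_cst//; exact: cvg_cst.
Qed.

Lemma measurable_dird : measurable_fun setT dird.
Proof.
apply: (measurable_fun_cvg (h := qf)) => [k|z _]; last exact: dird_cvg.
apply: measurable_funM; last exact: (measurable_rquot L0 fL).
by apply: measurable_indic; exact: (measurable_qcauchy L0 fL).
Qed.

Lemma dird_bound z : `|dird z| <= L * (1 + `|z.1 : 'rV[R]_n| + `|z.2 : 'rV[R]_n|) ^+ 1.
Proof.
apply: (norm_lim_le (@dird_cvg z)) => k; rewrite normrM indicE normr_nat expr1.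
apply: (@le_trans _ _ `|rquot f (tk k) z|); first by case: (_ \in _); rewrite ?mul1r ?mul0r.
apply: le_trans (rquot_bound L0 fL _ _) _; first by rewrite tk_gt0 tk_le1.
by apply: ler_wpM2l; [exact: ltW|rewrite -addrA lerDr].
Qed.

(** A linear function of a Gaussian vector has its [i]-th coefficient as
    covariance with the [i]-th coordinate. *)
Definition grd (x : 'rV[R]_n) : 'rV[R]_n := \row_i Ex g (fun v => dird (x, v) * v ord0 i).

Let idv i : intg (psq g) (fun z => dird z * z.2 ord0 i).
Proof.
apply: (@intg_psq_poly _ _ _ gg _ L 2).
  by apply: measurable_funM; [exact: measurable_dird|exact: measurable_coord2].
move=> z; rewrite normrM exprS expr1 mulrA; apply: ler_pM => //.
  exact: dird_bound.
by apply: le_trans (rV_coord_le _ _) _; rewrite lerDr addr_ge0.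
Qed.

Lemma intg_grd i : intg g (fun x => grd x ord0 i).
Proof.
have [+ _] := Ex_fubini (idv i).
by rewrite (_ : (fun x => grd x ord0 i) = fun x => Ex g (fun v => dird (x, v) * v ord0 i))//;
  apply/funext => x; rewrite mxE.
Qed.

Let idx i x : intg g (fun v => dird (x, v) * v ord0 i).
Proof.
apply: (@intg_poly _ _ _ gg _ (L * (1 + `|x : 'rV[R]_n|)) 2).
  apply: measurable_funM; last exact: measurable_coord.
  exact: (measurableT_comp measurable_dird (measurable_pair1 x)).
move=> v; rewrite normrM exprS expr1 mulrA; apply: ler_pM => //; last first.
  by apply: le_trans (rV_coord_le _ _) _; rewrite lerDr.
apply: le_trans (dird_bound _) _; rewrite -mulrA expr1; apply: ler_wpM2l; first exact: ltW.
have -> : (1 + `|x : 'rV[R]_n|) * (1 + `|v : 'rV[R]_n|) = 1 + `|x : 'rV[R]_n| + `|v : 'rV[R]_n| + `|x : 'rV[R]_n| * `|v : 'rV[R]_n| by ring.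
by rewrite lerDl mulr_ge0.
Qed.

Let grdM (phi : 'rV[R]_n -> R) i x :
  grd x ord0 i * phi x = Ex g (fun v => dird (x, v) * (phi x * v ord0 i)).
Proof.
rewrite mxE mulrC -ExZ; last exact: idx.
by apply: eq_Ex => v; ring.
Qed.

Let iphi i (phi : 'rV[R]_n -> R) : tame phi -> intg g (fun x => grd x ord0 i * phi x).
Proof.
move=> tp; have i1 : intg (psq g) (fun z => dird z * (phi z.1 * z.2 ord0 i)).
  have [C [k [C0 pC]]] := tame_poly2 tp.
  apply: (@intg_psq_poly _ _ _ gg _ (L * C) (1 + (k + 1))).
    apply: measurable_funM; first exact: measurable_dird.
    apply: measurable_funM; last exact: measurable_coord2.
    exact: (measurableT_comp (tame_meas tp) measurable_fst).
  move=> z; rewrite !normrM exprD mulrACA; apply: ler_pM => //.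
    exact: dird_bound.
  rewrite exprD mulrA; apply: ler_pM => //.
    have := pC 0 z.1 z.2; rewrite /rx cos0 sin0 scale1r scale0r addr0; exact.
  by apply: le_trans (rV_coord_le _ _) _; rewrite expr1 lerDr addr_ge0.
have [+ _] := Ex_fubini i1.
rewrite (_ : (fun x => grd x ord0 i * phi x) = fun x => Ex g (fun v => dird (x, v) * (phi x * v ord0 i)))//.
by apply/funext => x; exact: grdM.
Qed.

(** Integration by parts expresses the left-hand side by means of coefficients that
    do not depend on [chi]; taking a coordinate for [chi] identifies them. *)
Let gradM (phi chi : 'rV[R]_n -> R) : testable g phi -> testable g chi ->
  let c i := Ex g (fun x => grd x ord0 i * phi x) in
  intg (psq g) (fun z => dird z * (phi z.1 * chi z.2)) /\
  Ex (psq g) (fun z => dird z * (phi z.1 * chi z.2)) =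
  \sum_i c i * Ex g (fun v => chi v * v ord0 i).
Proof.
move=> tp tc.
have H : {ae psq g, forall z, (f (rx (tk k) z.1 z.2) - f z.1) / tk k @[k --> \oo] --> dird z}.
  apply: aeS (ae_qcauchy gg L0 fL) => z qz.
  by apply: (rlim_seq (dird_rlim qz)); exact: null_tk.
have [tp1 [dp hp]] := tp.
pose c' i := Ex g (fun x => f x * phi x * x ord0 i) - Ex g (fun x => f x * dp x ord0 i).
have E chi1 : testable g chi1 ->
    intg (psq g) (fun z => dird z * (phi z.1 * chi1 z.2)) /\
    Ex (psq g) (fun z => dird z * (phi z.1 * chi1 z.2)) = \sum_i c' i * Ex g (fun v => chi1 v * v ord0 i).
  move=> [tc1 [dc hc]]; have [i1 ->] := rot_ibp gg tf tp1 tc1 hp hc measurable_dird H.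
  by split=> //; apply: eq_bigr => i _; rewrite (gauss_ibp gg i tc1 hc) mulrBl.
have cE i : c' i = Ex g (fun x => grd x ord0 i * phi x).
  have [i1 E1] := E _ (testable_coord g i).
  have [_ E2] := Ex_fubini i1.
  rewrite (bigD1 i)//= [X in _ + X]big1 ?addr0 in E1; last first.
    by move=> j ji; rewrite (Ex_coordM gg) eq_sym (negbTE ji) mulr0.
  rewrite (Ex_coordM gg) eqxx mulr1 in E1; rewrite -E1 E2; apply: eq_Ex => x.
  by rewrite grdM.
have [i1 E1] := E _ tc; split=> //; rewrite E1.
by apply: eq_bigr => i _; rewrite cE.
Qed.

Let W (z : V n * V n) : R := dird z - dotp (grd z.1) z.2.

Let idotM (phi chi : 'rV[R]_n -> R) i : tame phi -> tame chi ->
  intg (psq g) (fun z => (grd z.1 ord0 i * phi z.1) * (chi z.2 * z.2 ord0 i)).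
Proof.
move=> tp tc; have i2 : intg g (fun v : V n => chi v * v ord0 i).
  by apply: tame_intg => //; apply: tameM => //; exact: tame_coord.
exact: (intg_prod (iphi i tp) i2).
Qed.

Let W_test phi chi : testable g phi -> testable g chi ->
  intg (psq g) (fun z => W z * (phi z.1 * chi z.2)) /\
  Ex (psq g) (fun z => W z * (phi z.1 * chi z.2)) = 0.
Proof.
move=> tp tc; have [i1 E1] := gradM tp tc.
have [tp1 _] := tp; have [tc1 _] := tc.
have iS : intg (psq g) (fun z => \sum_i (grd z.1 ord0 i * phi z.1) * (chi z.2 * z.2 ord0 i)).
  by apply: intg_sum => i; exact: idotM.
have WE z : W z * (phi z.1 * chi z.2) = dird z * (phi z.1 * chi z.2) -
    \sum_i (grd z.1 ord0 i * phi z.1) * (chi z.2 * z.2 ord0 i).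
  rewrite mulrBl /dotp mulr_suml; congr (_ - _); apply: eq_bigr => i _; ring.
under eq_fun do rewrite WE.
split; first exact: intgB.
rewrite ExB// E1 Ex_sum; last by move=> i; exact: idotM.
apply/eqP; rewrite subr_eq0; apply/eqP/eq_bigr => i _; apply/esym.
apply: (Ex_prod (iphi i tp1)).
by apply: tame_intg => //; apply: tameM => //; exact: tame_coord.
Qed.

(** By [W_test], [dird] and its linear candidate have the same integrals
    against all products of test functions, hence, in the limit, over all
    products of orthants. *)
Lemma dird_linear : {ae psq g, forall z, dird z = dotp (grd z.1) z.2}.
Proof.
have iW : intg (psq g) W.
  have [i _] := W_test (testable_cst g 1) (testable_cst g 1).
  by rewrite (_ : W = fun z => W z * (1 * 1))//; apply/funext => z; rewrite !mulr1.
suff H : {ae psq g, forall z, W z = 0}.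
  apply: aeS H => z /eqP.
  by rewrite subr_eq0 => /eqP.
apply: (orthant_integral_null iW) => a b.
have [phi [tphi phi1 phic]] := orthant_test g a.
have [chi [tchi chi1 chic]] := orthant_test g b.
pose F k z := W z * (phi k z.1 * chi k z.2).
have mF k : measurable_fun setT (F k) by exact: intg_meas (proj1 (W_test (tphi k) (tchi k))).
have mO : measurable (orthant a `*` orthant b : set (V n * V n)).
  by apply: measurableX; exact: measurable_orthant.
have mf : measurable_fun setT (fun z : V n * V n => \1_(orthant a `*` orthant b) z * W z : R).
  by apply: measurable_funM; [exact: measurable_indic|exact: intg_meas iW].
have a1 : {ae psq g, forall z, F ^~ z @ \oo --> \1_(orthant a `*` orthant b) z * W z}.
  apply: aeW => z; have -> : \1_(orthant a `*` orthant b) z * W z = W z * (\1_(orthant a) z.1 * \1_(orthant b) z.2).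
    by rewrite mulrC !indicE in_setX -natrM mulnb.
  by apply: cvgM; [exact: cvg_cst|apply: cvgM; [exact: phic|exact: chic]].
have a2 : {ae psq g, forall z k, `|F k z| <= `|W z|}.
  apply: aeW => z k; rewrite /F normrM ler_piMr// normrM; exact: mulr_ile1.
have [_ c] := Ex_cvg mF mf a1 a2 (intg_abs iW).
apply: (cvg_unique _ c) => //.
rewrite (_ : (fun k => _) = fun=> 0); first exact: cvg_cst.
by apply/funext => k; exact: (proj2 (W_test (tphi k) (tchi k))).
Qed.

End rademacher.

Section frechet_derivative.
Context {R : realType}.
Local Notation V := (@rvm R).
Local Notation mu := (@lebesgue_measure R).

Lemma normal_itv_gt0 (a b : R) : a < b -> (0 < normal_prob 0 1 `]a, b[)%E.
Proof.
move=> ab; rewrite lt0e measure_ge0 andbT; apply/eqP => H.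
have mp : measurable_fun (`]a, b[%classic : set (measurableTypeR R)) (EFin \o normal_pdf (0 : R) 1).
  by apply/measurable_EFinP; apply: measurable_funTS; exact: measurable_normal_pdf.
have p0 x : 0 < normal_pdf (0 : R) 1 x.
  by rewrite normal_pdfE ?oner_eq0// mulr_gt0 ?expR_gt0// normal_peak_gt0 ?oner_eq0.
have := (ae_eq_integral_abs mu (measurable_itv `]a, b[) mp).1.
have HH : (\int[mu]_(x in `]a, b[) `|(EFin \o normal_pdf 0 1) x|)%E = 0%E.
  by rewrite -[RHS]H; apply: eq_integral => x _ /=; rewrite gtr0_norm.
move=> /(_ HH) [N [mN N0 HN]].
have : (mu `]a, b[ <= mu N)%E.
  apply: le_measure; rewrite ?inE//; apply: subset_trans HN => x abx /= /(_ abx) [] h.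
  by have := p0 x; rewrite h ltxx.
by rewrite [mu N]N0 lebesgue_measure_itv/= lte_fin ab -EFinD lee_fin leNgt subr_gt0 ab.
Qed.

Context {n : nat}.
Variable g : probability (V n) R.
Hypothesis gg : std_gaussian g.

(** Cubes have positive Gaussian measure. *)
Lemma ae_dense (p : V n -> Prop) (u : 'rV[R]_n) (e : R) : {ae g, forall x, p x} -> 0 < e ->
  exists w : 'rV[R]_n, p w /\ `|u - w| < e.
Proof.
move=> [N [mN N0 HN]] e0; apply: contrapT => /forallNP H.
pose B i := `]u ord0 i - e, u ord0 i + e[%classic.
have mB i : measurable (B i : set (measurableTypeR R)) by exact: measurable_itv.
have sB : box B `<=` N.
  move=> w Bw; apply: HN => /= pw; apply: (H w); split=> //.
  have [->//|[i ->]] := rV_norm_attained (u - w); rewrite !mxE.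
  by have := Bw i; rewrite /B/= in_itv/= => /andP[h1 h2]; rewrite ltr_norml; lra.
have : (0 < g (box B))%E.
  rewrite gg//; apply: (big_ind (fun x : \bar R => (0 < x)%E)) => [|x y x0 y0|i _]; first exact: lte01.
    exact: mule_gt0.
  by apply: normal_itv_gt0; lra.
apply/negP; rewrite -leNgt -N0; apply: le_measure; rewrite ?inE//.
exact: measurable_box.
Qed.

Lemma ae_fubini (p : V n * V n -> Prop) : {ae psq g, forall z, p z} ->
  {ae g, forall x, {ae g, forall v, p (x, v)}}.
Proof.
move=> [N [mN N0 HN]].
have iN : intg (psq g) (\1_N : _ -> R).
  apply: (intg_le _ _ (intg_cst (psq g) 1)); first exact: measurable_indic.
  by move=> z; rewrite indicE/= normr_nat lern1 leq_b1.
have [i1 E1] := Ex_fubini iN.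
have E0 : Ex (psq g) (\1_N : _ -> R) = 0.
  have := ExE iN; rewrite integral_indic// setIT => h.
  have {h} : (Ex (psq g) (\1_N : _ -> R))%:E = 0%E :> \bar R by rewrite -h; exact: N0.
  by case.
have iv x : intg g (fun v => \1_N (x, v) : R).
  apply: (intg_le _ _ (intg_cst g 1)).
    exact: (measurableT_comp (measurable_indic mN) (measurable_pair1 x)).
  by move=> z; rewrite indicE/= normr_nat lern1 leq_b1.
have H : {ae g, forall x, Ex g (fun v => \1_N (x, v) : R) = 0}.
  apply: Ex_abs_eq0 => //; rewrite -[RHS]E0 E1; apply: eq_Ex => x.
  by rewrite ger0_norm//; apply: Ex_ge0.
apply: aeS H => x Hx.
have : {ae g, forall v, (\1_N (x, v) : R) = 0}.
  apply: Ex_abs_eq0 => //; rewrite -[RHS]Hx; apply: eq_Ex => v; by rewrite ger0_norm.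
apply: aeS => v; rewrite indicE.
case: (boolP (_ \in _)) => [_ /eqP|]; first by rewrite oner_eq0.
by rewrite notin_setE => nN _; apply: contrapT => np; apply: nN; apply: HN.
Qed.

Definition frechet (f : 'rV[R]_n -> R) (x a : 'rV[R]_n) : Prop :=
  forall e, 0 < e -> exists2 d, 0 < d &
    forall h, `|h| < d -> `|f (x + h) - f x - dotp a h| <= e * `|h|.

Lemma frechet_rder f x a : frechet f x a -> rder f x a.
Proof.
move=> H t v [t01 t0]; apply/cvgrPdist_le => e e0.
pose M := `|x| + `|v| + 1; have M0 : 0 < M by rewrite ltr_wpDl// addr_ge0.
pose C : R := n%:R * (`|a| * M); have C0 : 0 <= C by rewrite !mulr_ge0// ltW.
have [d d0 D] := H (e / (2 * M)) (divr_gt0 e0 (mulr_gt0 (ltr0n _ 2) M0)).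
have C1 : 0 < C + 1 by rewrite ltr_wpDl.
near=> k; have /andP[tk0 tk1] := t01 k.
have rd : `|rx (t k) x v - x| <= t k * M.
  apply: le_trans (rx_dist x v _) _; first by rewrite tk1 ltW.
  by apply: ler_wpM2l; [exact: ltW|rewrite lerDl].
have hl : `|rx (t k) x v - (x + t k *: v)| <= t k ^+ 2 * M.
  apply: le_trans (rx_line x v _) _; first by rewrite tk1 ltW.
  by apply: ler_wpM2l; [exact: sqr_ge0|rewrite lerDl].
have tkM : t k * M < d.
  rewrite -ltr_pdivlMr// -[t k]gtr0_norm// -normrN -sub0r; near: k.
  by have /cvgrPdist_lt := t0; apply; rewrite divr_gt0.
have tkC : t k * C <= e / 2.
  apply: (@le_trans _ _ (t k * (C + 1))); first by apply: ler_wpM2l; [exact: ltW|rewrite lerDl].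
  rewrite -ler_pdivlMr// -[t k]gtr0_norm// -normrN -sub0r; near: k.
  by have /cvgrPdist_le := t0; apply; rewrite !divr_gt0.
have := D (rx (t k) x v - x) (le_lt_trans rd tkM).
rewrite (_ : x + (rx (t k) x v - x) = rx (t k) x v) => [h1|]; last by rewrite addrC subrK.
have h2 : `|dotp a (rx (t k) x v - (x + t k *: v))| <= t k * (e / 2).
  apply: le_trans (dotp_norm _ _) _.
  apply: (@le_trans _ _ (t k * (t k * C))); last by apply: ler_wpM2l => //; exact: ltW.
  have -> : t k * (t k * C) = n%:R * (`|a| * (t k ^+ 2 * M)) by rewrite /C; ring.
  by rewrite !ler_wpM2l.
have h3 : e / (2 * M) * `|rx (t k) x v - x| <= t k * (e / 2).
  have -> : t k * (e / 2) = e / (2 * M) * (t k * M) by field; rewrite gt_eqF.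
  by apply: ler_wpM2l => //; rewrite divr_ge0 ?mulr_ge0// ltW.
have E r : dotp a v - (f r - f x) / t k =
   - ((f r - f x - dotp a (r - x)) + dotp a (r - (x + t k *: v))) / t k.
  by rewrite !dotpBr !dotpDr dotpZr; field; rewrite gt_eqF.
rewrite E normrM normrN normfV (gtr0_norm tk0) ler_pdivrMr//.
by apply: le_trans (ler_normD _ _) _; rewrite [leRHS]mulrC; lra.
Unshelve. all: by end_near. Qed.

Variables (f : 'rV[R]_n -> R) (L : R).
Hypothesis L0 : 0 < L.
Hypothesis fL : forall x y, `|f x - f y| <= L * `|x - y|.

(** Convergence of the difference quotients in a dense set of directions
    becomes uniform over all directions, by compactness of the unit ball and
    the Lipschitz bound. *)
Lemma rlim_frechet x a :
  {ae g, forall v : V n, rlim f (x, v) (dotp a v)} -> frechet f x a.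
Proof.
move=> H e e0.
pose B := [set u : 'rV[R]_n | `|u| <= 1].
have cB : compact B.
  apply: bounded_closed_compact.
    exists 1; split; first exact: num_real.
    by move=> r r1 u /= u1; apply: le_trans u1 (ltW r1).
  rewrite (_ : B = closed_ball_ (fun u : 'rV[R]_n => `|u|) 0 1).
    exact: closed_closed_ball_.
  by apply/seteqP; split=> u /=; rewrite /closed_ball_/= sub0r normrN.
pose P (t : R) (u : 'rV[R]_n) := `|f (x + t *: u) - f x - t * dotp a u| <= e * t.
pose M := L + n%:R * `|a| + 1.
have M1 : L + n%:R * `|a| <= M by rewrite lerDl.
have M0 : 0 < M by rewrite ltr_wpDl// addr_ge0 ?mulr_ge0// ltW.
have cov : forall u, B u -> \forall u' \near u & t \near 0^'+, P t u'.
  move=> u Bu; pose eta := e / (8 * M).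
  have eta0 : 0 < eta by rewrite divr_gt0// mulr_gt0.
  have [w [Hw uw]] := ae_dense u H eta0.
  have e4 : 0 < e / 4 by rewrite divr_gt0.
  have [d1 d10 D1] := Hw _ e4.
  pose N := L * (`|x : 'rV[R]_n| + `|w|) + 1.
  have N0 : 0 < N by rewrite ltr_wpDl// mulr_ge0 ?addr_ge0// ltW.
  pose d := Num.min 1 (Num.min d1 (e / (4 * N))).
  have d0 : 0 < d by rewrite !lt_min ltr01 d10 divr_gt0// mulr_gt0.
  exists ([set u' | `|u - u'| < eta], [set t | 0 < t < d]); first split => /=.
  - by apply/(@nbhs_ballP R); exists eta => // u'; rewrite -ball_normE.
  - by near=> t; apply/andP; split; near: t; [exact: nbhs_right_gt|exact: nbhs_right_lt].
  move=> [u' t]/= [uu' /andP[t0 td]].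
  move: td; rewrite !lt_min => /and3P[t1 td1 tN].
  have u'w : `|u' - w| <= 2 * eta.
    have -> : u' - w = (u - w) - (u - u') by apply/rowP => i; rewrite !mxE; ring.
    by apply: le_trans (ler_normB _ _) _; lra.
  have h1 : `|f (x + t *: u') - f (rx t x w)| <= L * (t * `|u' - w|) + t * (e / 4).
    apply: le_trans (fL _ _) _.
    have -> : x + t *: u' - rx t x w = t *: (u' - w) - (rx t x w - (x + t *: w)).
      by apply/rowP => i; rewrite !mxE; ring.
    apply: (@le_trans _ _ (L * (t * `|u' - w| + t ^+ 2 * (`|x : 'rV[R]_n| + `|w|)))).
      apply: ler_wpM2l; first exact: ltW.
      apply: le_trans (ler_normB _ _) _; apply: lerD; first by rewrite normrZ gtr0_norm.
      by apply: rx_line; rewrite !ltW.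
    rewrite mulrDr lerD2l.
    have -> : L * (t ^+ 2 * (`|x : 'rV[R]_n| + `|w|)) = t * (t * (N - 1)) by rewrite /N; ring.
    apply: ler_wpM2l; first exact: ltW.
    apply: (@le_trans _ _ (t * N)); first by apply: ler_wpM2l; [exact: ltW|rewrite lerBlDr lerDl].
    have -> : e / 4 = e / (4 * N) * N by field; rewrite gt_eqF.
    by apply: ler_wpM2r; exact: ltW.
  have h2 : `|f (rx t x w) - f x - t * dotp a w| <= t * (e / 4).
    have := D1 t; rewrite t0 td1 => /(_ isT); rewrite /rquot/= => h.
    have -> : f (rx t x w) - f x - t * dotp a w = t * ((f (rx t x w) - f x) / t - dotp a w).
      by field; rewrite gt_eqF.
    by rewrite normrM gtr0_norm//; apply: ler_wpM2l => //; exact: ltW.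
  have h3 : `|dotp a (w - u')| <= n%:R * `|a| * `|u' - w|.
    by apply: le_trans (dotp_norm _ _) _; rewrite mulrA distrC.
  have h4 : (L + n%:R * `|a|) * `|u' - w| <= e / 4.
    apply: (@le_trans _ _ (M * (2 * eta))).
      by apply: ler_pM => //; rewrite addr_ge0 ?mulr_ge0// ltW.
    by rewrite /eta le_eqVlt; apply/orP; left; apply/eqP; field; rewrite gt_eqF.
  rewrite /P (_ : f (x + t *: u') - f x - t * dotp a u' =
     (f (x + t *: u') - f (rx t x w)) + (f (rx t x w) - f x - t * dotp a w) + t * dotp a (w - u')).
    apply: le_trans (ler_normD _ _) _; rewrite (normrM t) (gtr0_norm t0).
    have h5 := ler_normD (f (x + t *: u') - f (rx t x w)) (f (rx t x w) - f x - t * dotp a w).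
    have h6 : t * `|dotp a (w - u')| <= t * (n%:R * `|a| * `|u' - w|) by apply: ler_wpM2l => //; exact: ltW.
    have h7 : t * ((L + n%:R * `|a|) * `|u' - w|) <= t * (e / 4) by apply: ler_wpM2l => //; exact: ltW.
    have h8 : L * (t * `|u' - w|) + t * (n%:R * `|a| * `|u' - w|) = t * ((L + n%:R * `|a|) * `|u' - w|) by ring.
    by have := mulr_gt0 e0 t0; lra.
  by rewrite dotpBr; ring.
have [d /= d0 D] := (compact_near_coveringP B).1 cB R (at_right 0) P _ cov.
exists d => // h hd; have [->|h0] := eqVneq h 0.
  by rewrite addr0 subrr sub0r dotpC dotp0l oppr0 !normr0 mulr0.
have nh : 0 < `|h| by rewrite normr_gt0.
have := D `|h|; rewrite /ball_/= sub0r normrN normr_id => /(_ hd nh (`|h|^-1 *: h)).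
rewrite /B /P/= normrZ normfV normr_id mulVf ?gt_eqF// => /(_ (lexx _)).
by rewrite dotpZr scalerA mulrA divff ?gt_eqF// scale1r mul1r.
Unshelve. all: by end_near. Qed.

(** Rademacher's theorem for the Gaussian measure: at almost every point, the
    derivative exists and is linear in almost every direction, hence in a
    dense set of directions. *)
Lemma rademacher : {ae g, forall x, frechet f x (grd g f x)}.
Proof.
have H : {ae psq g, forall z, rlim f z (dotp (grd g f z.1) z.2)}.
  apply: aeS2 (ae_qcauchy gg L0 fL) (dird_linear gg L0 fL) => z qz <-.
  exact: (dird_rlim L0 fL).
apply: aeS (ae_fubini H) => x Hx.
exact: (@rlim_frechet x (grd g f x) Hx).
Qed.

Lemma lipschitz_has_grad : has_grad g f (grd g f).
Proof.
split; last first.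
  by apply: aeS rademacher => x; exact: frechet_rder.
by move=> i; apply: intg_meas; exact: (intg_grd gg L0 fL).
Qed.

End frechet_derivative.

(** * Euclidean geometry and Jacobian matrices *)

Section euclidean_geometry.
Context {R : realType} {n : nat}.
Implicit Types x y h : 'rV[R]_n.

Lemma enorm_sqr x : enorm x ^+ 2 = dotp x x.
Proof.
rewrite sqr_sqrtr; last by apply: sumr_ge0 => i _; exact: sqr_ge0.
by apply: eq_bigr => i _; rewrite expr2.
Qed.

Lemma dotp_ge0 x : 0 <= dotp x x.
Proof. by apply: sumr_ge0 => i _; rewrite -expr2 sqr_ge0. Qed.

Lemma dotp_coord x i : x ord0 i ^+ 2 <= dotp x x.
Proof.
rewrite /dotp (bigD1 i)//= -expr2 lerDl; apply: sumr_ge0 => j _.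
by rewrite -expr2 sqr_ge0.
Qed.

Lemma dotp_eq0 x : dotp x x = 0 -> x = 0.
Proof.
move=> x0; apply/rowP => i; rewrite mxE; apply/eqP; rewrite -sqrf_eq0 eq_le sqr_ge0 andbT.
by rewrite -x0; exact: dotp_coord.
Qed.

Lemma dotpD2 x y : dotp (x + y) (x + y) = dotp x x + 2 * dotp x y + dotp y y.
Proof. by rewrite dotpDl !dotpDr (dotpC y x); ring. Qed.

Lemma dotpB2 x y : dotp (x - y) (x - y) = dotp x x - 2 * dotp x y + dotp y y.
Proof. by rewrite dotpD2 dotpNr dotpNl dotpNr; ring. Qed.

Lemma dotp_CS x y : dotp x y ^+ 2 <= dotp x x * dotp y y.
Proof.
have [y0|y0] := eqVneq (dotp y y) 0.
  by rewrite (dotp_eq0 y0) dotpC dotp0l dotp0l expr0n mulr0.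
have yp : 0 < dotp y y by rewrite lt_neqAle eq_sym y0 dotp_ge0.
have := dotp_ge0 (dotp y y *: x - dotp x y *: y).
rewrite dotpB2 !(dotpZl, dotpZr) => H.
have : 0 <= dotp y y * (dotp x x * dotp y y - dotp x y ^+ 2).
  by apply: le_trans H _; rewrite le_eqVlt; apply/orP; left; apply/eqP; ring.
by rewrite pmulr_rge0// subr_ge0.
Qed.

(** Cauchy-Schwarz in a form free of square roots. *)
Lemma dotp_le x y (M : R) : 0 <= M -> dotp x x <= M ^+ 2 * dotp y y ->
  dotp x y <= M * dotp y y.
Proof.
move=> M0 xy; have My : 0 <= M * dotp y y by rewrite mulr_ge0 ?dotp_ge0.
apply: le_trans (ler_norm _) _; rewrite -(ger0_norm My) -ler_sqr ?nnegrE//.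
rewrite !real_normK ?num_real//; apply: le_trans (dotp_CS _ _) _.
rewrite (_ : (M * dotp y y) ^+ 2 = M ^+ 2 * dotp y y * dotp y y); last by ring.
by apply: ler_wpM2r; rewrite ?dotp_ge0.
Qed.

Lemma dotp_norm_le x : dotp x x <= n%:R * `|x| ^+ 2.
Proof. by apply: le_trans (ler_norm _) _; rewrite expr2; exact: dotp_norm. Qed.

Lemma dotp_continuous_sqr y : continuous (fun x => dotp (y - x) (y - x)).
Proof.
have c i : continuous (fun x => (y - x) ord0 i).
  move=> x; rewrite (_ : (fun x => _) = fun x => y ord0 i - x ord0 i); last first.
    by apply/funext => z; rewrite !mxE.
  by apply: continuousB; [exact: cst_continuous|exact: coord_continuous].
rewrite /dotp; elim: (index_enum _) => [|i s IH].
  rewrite (_ : (fun x => _) = fun=> 0); first exact: cst_continuous.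
  by apply/funext => x; rewrite big_nil.
rewrite (_ : (fun x => _) = fun x => (y - x) ord0 i * (y - x) ord0 i +
    \sum_(j <- s) (y - x) ord0 j * (y - x) ord0 j); last first.
  by apply/funext => x; rewrite big_cons.
move=> x; apply: (@continuousD _ _ _ (fun x => (y - x) ord0 i * (y - x) ord0 i)); last exact: IH.
by apply: (@continuousM _ _ (fun x => (y - x) ord0 i)); exact: c.
Qed.

Definition nonexpansive (N : 'rV[R]_n -> 'rV[R]_n) : Prop :=
  forall x y, dotp (N x - N y) (N x - N y) <= dotp (x - y) (x - y).

(** The constant only accounts for the comparison of the Euclidean norm with the
    maximum norm; it is made positive for [n = 0]. *)
Lemma nonexpansive_lip N i x y : nonexpansive N ->
  `|N x ord0 i - N y ord0 i| <= n.+1%:R * `|x - y|.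
Proof.
move=> hN; rewrite -ler_sqr ?nnegrE ?mulr_ge0// real_normK ?num_real//.
have -> : N x ord0 i - N y ord0 i = (N x - N y) ord0 i by rewrite !mxE.
apply: le_trans (dotp_coord _ _) _; apply: le_trans (hN _ _) _.
apply: le_trans (dotp_norm_le _) _; rewrite exprMn; apply: ler_wpM2r; first exact: sqr_ge0.
rewrite expr2; apply: (@le_trans _ _ n.+1%:R); first by rewrite ler_nat.
by rewrite ler_peMl// ler1n.
Qed.

(** The matrix [jacobian G x] acts on row vectors from the right, which puts
    the gradient of the [j]-th component of [G] in its [j]-th column. *)
Lemma frechet_jacobian (G : 'rV[R]_n -> 'rV[R]_n) x (a : 'I_n -> 'rV[R]_n) :
  (forall j, frechet (fun y => G y ord0 j) x (a j)) ->
  forall i j, jacobian G x i j = a j ord0 i.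
Proof.
move=> H i j; pose A := \matrix_(i, j) a j ord0 i.
have AE h k : (h *m A) ord0 k = dotp (a k) h.
  by rewrite mxE /dotp; apply: eq_bigr => l _; rewrite mxE mulrC.
pose C := n%:R * (\sum_k `|a k|) + 1.
have C0 : 0 < C by rewrite ltr_wpDl// mulr_ge0// sumr_ge0.
pose df : {linear 'rV[R]_n -> 'rV[R]_n} := mulmxr A.
suff D : 'd G x = df :> ('rV[R]_n -> 'rV[R]_n).
  by rewrite /jacobian mxE D /= -rowE !mxE.
apply: diff_unique.
  have df_bound u : `|df u| <= C * `|u|.
    have [->|[k ->]] := rV_norm_attained (df u); first by rewrite mulr_ge0// ltW.
    rewrite [df u]/(u *m A) AE; apply: le_trans (dotp_norm _ _) _; rewrite mulrA.
    apply: ler_wpM2r => //; rewrite /C mulr_sumr (bigD1 k)//= -addrA lerDl addr_ge0//.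
    by apply: sumr_ge0 => l _; rewrite mulr_ge0.
  move=> h; apply/(@cvgrPdist_le _ _ _ (nbhs h) (nbhs_filter h)) => e e0; near=> u.
  rewrite -linearB; apply: le_trans (df_bound _) _; rewrite mulrC -ler_pdivlMr//.
  near: u; have eC : 0 < e / C by rewrite divr_gt0.
  exact: (@cvgr_dist_le _ _ _ (nbhs h) _ id h cvg_id _ eC).
apply/eqaddoP => e e0.
have Hj : forall j, \forall h \near (0 : 'rV[R]_n),
    `|G (x + h) ord0 j - G x ord0 j - dotp (a j) h| <= e * `|h|.
  move=> k; have [d d0 D] := H k e e0.
  apply/(@nbhs_ballP R); exists d => // h; rewrite -ball_normE /= sub0r normrN; exact: D.
have Hall : forall s : seq 'I_n, \forall h \near (0 : 'rV[R]_n), forall j, j \in s ->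
    `|G (x + h) ord0 j - G x ord0 j - dotp (a j) h| <= e * `|h|.
  elim=> [|k s IH]; first by near=> h.
  by apply: filterS2 (Hj k) IH => h h1 h2 l; rewrite in_cons => /orP[/eqP ->|/h2].
apply: filterS (Hall (index_enum _)) => h Hh; rewrite /= -[id h]/h.
set u := (X in `|X|).
have uE k : u ord0 k = G (x + h) ord0 k - G x ord0 k - dotp (a k) h.
  by rewrite /u !fctE/= -AE !mxE (addrC h x) opprD addrA.
have [->|[k ->]] := rV_norm_attained u; first by rewrite mulr_ge0// ltW.
by rewrite uE; apply: Hh; rewrite mem_index_enum.
Unshelve. all: by end_near. Qed.

End euclidean_geometry.

(** * The metric projection *)

Section projection.
Context {R : realType} {n : nat}.
Variables (K : set 'rV[R]_n) (mu0 : 'rV[R]_n).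
Hypotheses (Kcl : closed K) (Kcv : @convex_set R 'rV[R]_n K) (mu0K : K mu0).
Implicit Types x y z h : 'rV[R]_n.

Local Notation sq x := (dotp x x).

Let proj_exists x : exists y, K y /\ forall z, K z -> sq (x - y) <= sq (x - z).
Proof.
pose B := K `&` [set z | sq (x - z) <= sq (x - mu0)].
have B0 : B !=set0 by exists mu0; split => //=.
have cB : compact B.
  apply: bounded_closed_compact.
    exists (`|x| + (1 + sq (x - mu0))); split; first exact: num_real.
    move=> M MM z [_ /= zx]; apply: le_trans (ltW MM).
    have -> : z = x - (x - z) by rewrite opprB addrC subrK.
    apply: le_trans (ler_normB _ _) _; rewrite lerD2l.
    have [->|[i ->]] := rV_norm_attained (x - z); first by rewrite addr_ge0// dotp_ge0.
    have h : `|(x - z) ord0 i| ^+ 2 <= sq (x - mu0).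
      by rewrite real_normK ?num_real//; exact: le_trans (dotp_coord _ _) zx.
    have [h1|h1] := leP `|(x - z) ord0 i| 1.
      by apply: le_trans h1 _; rewrite lerDl dotp_ge0.
    apply: (@le_trans _ _ (sq (x - mu0))); last by rewrite lerDr.
    by apply: le_trans h; rewrite expr2 ler_peMl// ltW.
  apply: closedI => //.
  rewrite (_ : [set z | _] = (fun z => sq (x - z)) @^-1` [set r | r <= sq (x - mu0)])//.
  apply: closed_comp => [z _|]; [exact: dotp_continuous_sqr|exact: closed_le].
have [|y] := compact_EVT_min (f := fun z => sq (x - z)) B0 cB.
  by apply: continuous_subspaceT => z; exact: dotp_continuous_sqr.
rewrite inE => -[Ky /= yx] H; exists y; split=> // z Kz.
have [zx|zx] := leP (sq (x - z)) (sq (x - mu0)); first by apply: H; rewrite inE.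
exact: le_trans yx (ltW zx).
Qed.

Local Notation Pi := (metric_proj K).

Lemma proj_min x : K (Pi x) /\ forall z, K z -> sq (x - Pi x) <= sq (x - z).
Proof.
rewrite /metric_proj; case: xgetP => [y _ [Ky Hy]|H].
  by split=> // z Kz; rewrite -!enorm_sqr; exact: Hy.
have [y [Ky Hy]] := proj_exists x; exfalso; apply: (H y); split=> // z Kz.
by rewrite !enorm_sqr; exact: Hy.
Qed.

(** Moving from the projection of [x] towards [z] stays in [K], hence does not
    decrease the distance to [x]; to first order this is the claim. *)
Lemma proj_obtuse x z : K z -> dotp (x - Pi x) (z - Pi x) <= 0.
Proof.
move=> Kz; have [KP min] := proj_min x; set d := dotp _ _.
have H (l : R) : 0 < l -> l <= 1 -> 2 * d <= l * sq (z - Pi x).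
  move=> l0 l1.
  have l01 : (0 <= l <= 1)%R by rewrite ltW.
  pose t : {i01 R} := Itv01 (ltW l0) l1.
  have Kw : K (l *: z + (1 - l) *: Pi x).
    by have := Kcv t (mem_set Kz) (mem_set KP); rewrite inE.
  have := min _ Kw.
  have -> : x - (l *: z + (1 - l) *: Pi x) = (x - Pi x) - l *: (z - Pi x).
    by apply/rowP => i; rewrite !mxE; ring.
  rewrite [leRHS]dotpB2 !(dotpZl, dotpZr) -/d -[X in X <= _]addr0 -addrA lerD2l => h.
  have : 0 <= l * (l * sq (z - Pi x) - 2 * d).
    by apply: le_trans h _; rewrite le_eqVlt; apply/orP; left; apply/eqP; ring.
  by rewrite pmulr_rge0// subr_ge0.
rewrite leNgt; apply/negP => d0.
have S0 : 0 <= sq (z - Pi x) := dotp_ge0 _.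
have S1 : 0 < sq (z - Pi x) + 2 * d by rewrite ltr_wpDl// mulr_gt0.
have := H (d / (sq (z - Pi x) + 2 * d)) (divr_gt0 d0 S1).
rewrite ler_pdivrMr// mul1r => /(_ _) h.
have {}h : 2 * d <= d / (sq (z - Pi x) + 2 * d) * sq (z - Pi x) by apply: h; lra.
have : d / (sq (z - Pi x) + 2 * d) * sq (z - Pi x) <= d.
  by rewrite mulrAC ler_pdivrMr//; apply: ler_wpM2l; [exact: ltW|lra].
lra.
Qed.

(** Centering at [mu0] makes both functions vanish at [0]. *)
Definition Gp x := Pi (mu0 + x) - mu0.
Definition Fp x := lrt_stat K mu0 (mu0 + x).

Lemma proj_nonexpansive x y : sq (Pi x - Pi y) <= sq (x - y).
Proof.
have := proj_obtuse y (proj_min x).1; have := proj_obtuse x (proj_min y).1.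
move: (Pi x) (Pi y) => p q h1 h2.
have h3 : sq (p - q) <= dotp (x - y) (p - q).
  have E : dotp (x - y) (p - q) - sq (p - q) = - dotp (x - p) (q - p) - dotp (y - q) (p - q).
    by rewrite !(dotpBl, dotpBr) (dotpC q p); ring.
  by rewrite -subr_ge0 E subr_ge0 (le_trans h2)// oppr_ge0.
have := dotp_ge0 ((x - y) - (p - q)); rewrite dotpB2; move: h3.
move: (sq (p - q)) (dotp (x - y) (p - q)) (sq (x - y)) => a b c; lra.
Qed.

Lemma Gp_nonexpansive x y : sq (Gp x - Gp y) <= sq (x - y).
Proof.
have -> : Gp x - Gp y = Pi (mu0 + x) - Pi (mu0 + y) by rewrite /Gp opprB addrA subrK.
by apply: le_trans (proj_nonexpansive _ _) _; rewrite opprD addrACA subrr add0r.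
Qed.

Lemma FpE x : Fp x = sq x - sq (mu0 + x - Pi (mu0 + x)).
Proof. by rewrite /Fp /lrt_stat !enorm_sqr addrAC subrr add0r. Qed.

Let Fp_lower x h : 2 * dotp (Gp x) h <= Fp (x + h) - Fp x.
Proof.
have := (proj_min (mu0 + (x + h))).2 _ (proj_min (mu0 + x)).1.
rewrite !FpE.
have E y : mu0 + y - Pi (mu0 + x) = y - Gp x.
  by rewrite /Gp opprB addrCA addrA.
rewrite (E (x + h)) (E x) (addrAC x h).
rewrite !dotpD2 (dotpBl x (Gp x) h).
move: (dotp (Gp x) h) (dotp x h) (dotp h h) (dotp x x) (dotp (_ - _) _) => p q r s t.
move: (dotp _ _) => u; lra.
Qed.

(** For the lower bound, the projection of [mu0 + x] competes with that of
    [mu0 + (x + h)]. The upper bound is the lower bound at [x + h] in the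
    direction [- h], since [Gp] is nonexpansive. *)
Lemma Fp_bounds x h : 2 * dotp (Gp x) h <= Fp (x + h) - Fp x <= 2 * dotp (Gp x) h + 2 * sq h.
Proof.
rewrite Fp_lower/=.
have := Fp_lower (x + h) (- h); rewrite addrK dotpNr.
have : dotp (Gp (x + h) - Gp x) h <= 1 * sq h.
  apply: dotp_le => //; rewrite expr1n mul1r; apply: le_trans (Gp_nonexpansive _ _) _.
  by rewrite addrAC subrr add0r.
rewrite dotpBl; move: (dotp (Gp (x + h)) h) (dotp (Gp x) h) (dotp h h) (Fp x) (Fp (x + h)) => p q r s t; lra.
Qed.

Lemma proj_id z : K z -> Pi z = z.
Proof.
move=> Kz; have [_ /(_ _ Kz)] := proj_min z; rewrite subrr dotp0l => h.
have : sq (z - Pi z) = 0 by apply/eqP; rewrite eq_le h dotp_ge0.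
by move/dotp_eq0/eqP; rewrite subr_eq0 => /eqP <-.
Qed.

Lemma Gp0 : Gp 0 = 0.
Proof. by rewrite /Gp addr0 proj_id// subrr. Qed.

Lemma Fp0 : Fp 0 = 0.
Proof. by rewrite FpE addr0 proj_id// subrr dotp0l subrr. Qed.

Lemma Gp_neq0 : K <> [set mu0] -> exists x, Gp x != 0.
Proof.
move=> K1; apply: contrapT => H; apply: K1; apply/seteqP; split=> [z Kz /=|z -> //].
apply: contrapT => zm; apply: H; exists (z - mu0).
by rewrite /Gp (_ : mu0 + (z - mu0) = z) ?proj_id ?subr_eq0//; [exact/eqP|rewrite addrC subrK].
Qed.

End projection.

(** * The first two Gaussian chaoses *)

Section second_order_ibp.
Context {R : realType} {n : nat}.
Local Notation V := (@rvm R).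
Variable g : probability (V n) R.
Hypothesis gg : std_gaussian g.

(** Integration by parts for the product of [f] with a coordinate. *)
Lemma gauss_ibp2 f b i j : tame f -> has_grad g f b ->
  Ex g (fun x : V n => f x * (x ord0 i * x ord0 j - (i == j)%:R)) =
  Ex g (fun x : V n => b x ord0 i * x ord0 j).
Proof.
move=> tf fb; have tc j : tame (fun x : 'rV[R]_n => x ord0 j) := tame_coord j.
have := gauss_ibp gg i (tameM tf (tc j)) (has_gradM tf (tc j) fb (has_grad_coord g j)).
have i1 : intg g (fun x : V n => b x ord0 i * x ord0 j).
  rewrite (_ : (fun x => _) = fun x : V n => x ord0 j * b x ord0 i); last by apply/funext => x; rewrite mulrC.
  exact: intg_tame_grad tf fb.
have i2 : intg g (fun x : V n => (i == j)%:R * f x) by apply: intgZ; exact: tame_intg.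
have i3 : intg g (fun x : V n => f x * x ord0 j * x ord0 i).
  by apply: tame_intg => //; apply: tameM => //; exact: tameM.
rewrite (@eq_Ex _ _ _ _ _ (fun x : V n => b x ord0 i * x ord0 j + (i == j)%:R * f x)); last first.
  by move=> x; rewrite !mxE eqxx mulrC [f x * _]mulrC.
rewrite ExD// => H; apply: (addIr (Ex g (fun x : V n => (i == j)%:R * f x))).
rewrite H -ExD//.
  by apply: eq_Ex => x; ring.
rewrite (_ : (fun x => _) = fun x : V n => f x * x ord0 j * x ord0 i - (i == j)%:R * f x); last by apply/funext => x; ring.
exact: intgB.
Qed.

Variables (a : 'I_n -> R) (A : 'I_n -> 'I_n -> R).

(** The general element of the first two Gaussian chaoses: the products of
    coordinates are centred as Hermite polynomials are. *)
Definition chaos (x : 'rV[R]_n) : R := \sum_i a i * x ord0 i +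
  \sum_i \sum_j 2^-1 * A i j * (x ord0 i * x ord0 j - (i == j)%:R).

Lemma tame_chaos : tame chaos.
Proof.
have tc j : tame (fun x : 'rV[R]_n => x ord0 j) := tame_coord j.
apply: tameD; first by apply: tame_sum => i; apply: tameZ.
apply: tame_sum => i; apply: tame_sum => j; apply: tameZ.
by apply: tameD; [exact: tameM|exact: tame_cst].
Qed.

Lemma Ex_chaos f b : tame f -> has_grad g f b ->
  Ex g (fun x => f x * chaos x) = \sum_i a i * Ex g (fun x : V n => b x ord0 i) +
    \sum_i \sum_j 2^-1 * A i j * Ex g (fun x : V n => b x ord0 i * x ord0 j).
Proof.
move=> tf fb; have tc j : tame (fun x : 'rV[R]_n => x ord0 j) := tame_coord j.
have i1 i : intg g (fun x : V n => f x * x ord0 i) by apply: tame_intg => //; exact: tameM.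
have i2 i j : intg g (fun x : V n => f x * (x ord0 i * x ord0 j - (i == j)%:R)).
  apply: tame_intg => //; apply: tameM => //; apply: tameD; last exact: tame_cst.
  exact: tameM.
have i3 i : intg g (fun x => \sum_j (2^-1 * A i j) * (f x * (x ord0 i * x ord0 j - (i == j)%:R))).
  by apply: intg_sum => j; exact: intgZ.
rewrite (@eq_Ex _ _ _ _ _ (fun x : V n => \sum_i a i * (f x * x ord0 i) +
   \sum_i \sum_j (2^-1 * A i j) * (f x * (x ord0 i * x ord0 j - (i == j)%:R)))); last first.
  move=> x; rewrite /chaos mulrDr !mulr_sumr; congr (_ + _); apply: eq_bigr => i _; first by ring.
  by rewrite mulr_sumr; apply: eq_bigr => j _; ring.
rewrite ExD; [|by apply: intg_sum => i; exact: intgZ|exact: intg_sum].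
congr (_ + _).
  rewrite Ex_sum; last by move=> i; exact: intgZ.
  by apply: eq_bigr => i _; rewrite ExZ// (gauss_ibp gg i tf fb).
rewrite Ex_sum//; apply: eq_bigr => i _; rewrite Ex_sum; last by move=> j; exact: intgZ.
by apply: eq_bigr => j _; rewrite ExZ// (gauss_ibp2 i j tf fb).
Qed.

Hypothesis Asym : forall i j, A i j = A j i.

Definition dchaos (x : 'rV[R]_n) : 'rV[R]_n := \row_i (a i + \sum_j A i j * x ord0 j).

Lemma has_grad_chaos : has_grad g chaos dchaos.
Proof.
have tc j : tame (fun x : 'rV[R]_n => x ord0 j) := tame_coord j.
have hc j := has_grad_coord g j.
have H : has_grad g chaos (fun x => \sum_i a i *: delta_mx ord0 i +
   \sum_i \sum_j (2^-1 * A i j) *: (x ord0 j *: delta_mx ord0 i + x ord0 i *: delta_mx ord0 j + 0)).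
  apply: has_gradD; first by apply: has_grad_sum => i; apply: has_gradZ.
  apply: has_grad_sum => i; apply: has_grad_sum => j; apply: has_gradZ.
    by apply: tameD; [exact: tameM|exact: tame_cst].
  apply: has_gradD; last exact: has_grad_cst.
  exact: has_gradM.
move: H; set D := (X in has_grad _ _ X); suff -> : D = dchaos by [].
  apply/esym/funext => x; apply/rowP => k; rewrite /D !mxE !summxE; congr (_ + _).
    rewrite (bigD1 k)//= big1 ?addr0 ?mxE ?eqxx ?mulr1// => i ik.
    by rewrite !mxE eqxx eq_sym (negbTE ik) mulr0.
  have E i j : ((2^-1 * A i j) *: (x ord0 j *: delta_mx ord0 i + x ord0 i *: delta_mx ord0 j + 0)) ord0 k =
     2^-1 * A i j * x ord0 j * (k == i)%:R + 2^-1 * A i j * x ord0 i * (k == j)%:R.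
    by rewrite !mxE !eqxx /=; ring.
  transitivity (\sum_i \sum_j (2^-1 * A i j * x ord0 j * (k == i)%:R + 2^-1 * A i j * x ord0 i * (k == j)%:R)); last first.
    by apply: eq_bigr => i _; rewrite summxE; apply: eq_bigr => j _; rewrite E.
  under [RHS]eq_bigr do rewrite big_split/=.
  rewrite big_split/= [X in _ = X + _](bigD1 k)//= [X in _ = _ + X + _]big1 ?addr0; last first.
    by move=> i ik; rewrite big1// => j _; rewrite eq_sym (negbTE ik) mulr0.
  rewrite [X in _ = _ + X]exchange_big/= [X in _ = _ + X](bigD1 k)//= [X in _ = _ + (_ + X)]big1 ?addr0; last first.
    by move=> i ik; rewrite big1// => j _; rewrite eq_sym (negbTE ik) mulr0.
  rewrite -big_split/=; apply: eq_bigr => j _; rewrite eqxx !mulr1 (Asym j k).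
  by rewrite -mulrDl -mulrDl -[RHS]mulrA; field.
Qed.

End second_order_ibp.

(** * Lower bound on the variance *)

Section envelopes.
Context {R : realType} {n : nat}.
Local Notation V := (@rvm R).

(** [F] is squeezed between its tangent plane and a paraboloid, and half its
    gradient [G] is nonexpansive for the Euclidean norm. *)
Definition envelope (F : 'rV[R]_n -> R) (G : 'rV[R]_n -> 'rV[R]_n) : Prop :=
  [/\ F 0 = 0, G 0 = 0,
      forall x h, 2 * dotp (G x) h <= F (x + h) - F x <= 2 * dotp (G x) h + 2 * dotp h h &
      nonexpansive G].

Variable g : probability (V n) R.
Hypothesis gg : std_gaussian g.
Variables (F : 'rV[R]_n -> R) (G : 'rV[R]_n -> 'rV[R]_n).
Hypothesis FG : envelope F G.

Let L : R := n.+1%:R.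
Let L0 : 0 < L. Proof. exact: ltr0Sn. Qed.

Lemma envelope_lip i x y : `|G x ord0 i - G y ord0 i| <= L * `|x - y|.
Proof. by case: FG => _ _ _; exact: nonexpansive_lip. Qed.

Lemma tame_G i : tame (fun x => G x ord0 i).
Proof. exact: (lipschitz_tame L0 (envelope_lip i)). Qed.

Lemma tame_sqr_G : tame (fun x => dotp (G x) (G x)).
Proof. by apply: tame_sum => i; apply: tameM; exact: tame_G. Qed.

Definition JG i := grd g (fun x => G x ord0 i).

Lemma has_grad_G i : has_grad g (fun x => G x ord0 i) (JG i).
Proof. exact: (lipschitz_has_grad gg L0 (envelope_lip i)). Qed.

Lemma envelope_norm x : `|G x| <= L * `|x|.
Proof.
have [_ G0 _ _] := FG.
have [->|[i ->]] := rV_norm_attained (G x); first by rewrite mulr_ge0// ltW.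
by have := envelope_lip i x 0; rewrite G0 mxE !subr0.
Qed.

Let incr x h : `|F (x + h) - F x| <= 2 * n%:R * (L * `|x| + `|h|) * `|h|.
Proof.
have [_ _ /(_ x h) /andP[h1 h2] _] := FG.
have h3 := dotp_norm (G x) h; have h4 := dotp_norm_le h.
have h5 : n%:R * (`|G x| * `|h|) <= n%:R * (L * `|x| * `|h|).
  by apply: ler_wpM2l => //; apply: ler_wpM2r => //; exact: envelope_norm.
have -> : 2 * n%:R * (L * `|x| + `|h|) * `|h| = 2 * (n%:R * (L * `|x| * `|h|)) + 2 * (n%:R * `|h| ^+ 2) by ring.
rewrite ler_norml; move: h3; rewrite ler_norml => /andP[h3 h3']; have h6 := dotp_ge0 h.
move: (dotp _ _) (dotp _ _) (n%:R * _) (n%:R * _) (n%:R * _) h1 h2 h3 h3' h4 h5 h6 => p q r s t *.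
by apply/andP; split; lra.
Qed.

Lemma tame_F : tame F.
Proof.
have [F0 _ _ _] := FG.
pose C : R := 2 * n%:R * (L + 1).
have C0 : 0 <= C by rewrite !mulr_ge0// addr_ge0// ltW.
have hL x y : `|F x - F y| <= C * (1 + `|x| + `|y|) * `|x - y|.
  have := incr y (x - y); rewrite (_ : y + (x - y) = x) => [h|]; last by rewrite addrC subrK.
  apply: le_trans h _.
  apply: ler_wpM2r => //; rewrite /C -!mulrA; apply: ler_wpM2l => //; apply: ler_wpM2l => //.
  have h1 := ler_normB x y; have h2 := normr_ge0 x; have h3 := normr_ge0 y.
  have h4 := mulr_ge0 (ltW L0) h2.
  by rewrite mulrDl mul1r !mulrDr mulr1; have := L0; lra.
split.
  apply: measurable_cts; apply: (poly_lip_continuous (k := 1) C0) => x y.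
  by rewrite expr1.
exists C, 2%N; split=> // [x|x y].
  have := hL x 0; rewrite F0 !subr0 normr0 addr0 => h; apply: le_trans h _.
  rewrite -mulrA; apply: ler_wpM2l => //; rewrite expr2; apply: ler_wpM2l; first by rewrite addr_ge0.
  by rewrite lerDr.
apply: le_trans (hL _ _) _; apply: ler_wpM2r => //; apply: ler_wpM2l => //.
by rewrite expr2 ler_peMl// ?addr_ge0// -addrA lerDl addr_ge0.
Qed.

Lemma frechet_F x : frechet F x (2 *: G x).
Proof.
have [_ _ hF _] := FG; move=> e e0.
have d0 : 0 < e / (2 * L) by rewrite divr_gt0// mulr_gt0.
exists (e / (2 * L)) => // h hd; rewrite dotpZl.
have /andP[h1 h2] := hF x h; have h3 := dotp_norm_le h.
rewrite ger0_norm; last by rewrite subr_ge0.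
apply: (@le_trans _ _ (2 * dotp h h)); first by rewrite lerBlDl.
apply: (@le_trans _ _ (2 * (L * `|h| ^+ 2))).
  apply: ler_wpM2l => //; apply: le_trans h3 _; apply: ler_wpM2r; first exact: sqr_ge0.
  by rewrite ler_nat.
rewrite expr2 !mulrA; apply: ler_wpM2r => //.
by rewrite mulrC -ler_pdivlMr ?mulr_gt0// ltW.
Qed.

Lemma has_grad_F : has_grad g F (fun x => 2 *: G x).
Proof.
split; last by apply: aeW => x; exact: frechet_rder (frechet_F x).
move=> i; under eq_fun do rewrite mxE.
by apply: measurable_funM; [exact: measurable_cst|exact: tame_meas (tame_G i)].
Qed.

(** Bessel's inequality for the first two Gaussian chaoses. Let [q] be the
    element of these chaoses with coefficients [a], the mean gradient of [F],
    and [A], its mean Hessian. By integration by parts, [F * q] and the square of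
    [q] have the same mean, and the claim is that the mean of the square of
    [F - E F - q] is nonnegative. *)
Lemma variance_lower_bound :
  2 * (2 * (\sum_i Ex g (fun x : V n => G x ord0 i) ^+ 2) +
       \sum_i \sum_j Ex g (fun x : V n => JG i x ord0 j) ^+ 2) <=
  Ex g (fun x => F x ^+ 2) - Ex g F ^+ 2.
Proof.
have tF := tame_F; have hF := has_grad_F.
pose a i := 2 * Ex g (fun x : V n => G x ord0 i).
pose A i j := 2 * Ex g (fun x : V n => JG i x ord0 j).
have iG i : intg g (fun x : V n => G x ord0 i) by apply: tame_intg => //; exact: tame_G.
have iGx i j : intg g (fun x : V n => G x ord0 i * x ord0 j).
  by apply: tame_intg => //; apply: tameM; [exact: tame_G|exact: tame_coord].
have aE i : Ex g (fun x : V n => (2 *: G x) ord0 i) = a i.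
  by rewrite (@eq_Ex _ _ _ _ _ (fun x : V n => 2 * G x ord0 i)) ?ExZ// => x; rewrite mxE.
have AE i j : Ex g (fun x : V n => (2 *: G x) ord0 i * x ord0 j) = A i j.
  rewrite (@eq_Ex _ _ _ _ _ (fun x : V n => 2 * (G x ord0 i * x ord0 j))); last by move=> x; rewrite mxE mulrA.
  by rewrite ExZ// /A (gauss_ibp gg j (tame_G i) (has_grad_G i)).
(* both are the covariance of [F] with the product of two coordinates *)
have Asym i j : A i j = A j i.
  rewrite -!AE -(gauss_ibp2 gg i j tF hF) -(gauss_ibp2 gg j i tF hF).
  by apply: eq_Ex => x; rewrite eq_sym [X in X - _]mulrC.
pose q : V n -> R := chaos a A.
have tq : tame q := tame_chaos a A.
pose S := \sum_i a i ^+ 2 + \sum_i \sum_j 2^-1 * A i j ^+ 2.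
have EFq : Ex g (fun x => F x * q x) = S.
  rewrite (Ex_chaos gg a A tF hF); congr (_ + _); apply: eq_bigr => i _.
    by rewrite aE expr2.
  by apply: eq_bigr => j _; rewrite AE -mulrA expr2.
have Eqq : Ex g (fun x => q x * q x) = S.
  rewrite (Ex_chaos gg a A tq (has_grad_chaos g a Asym)).
  have ic j : intg g (fun x : V n => x ord0 j) by exact: intg_coord.
  have icc i j : intg g (fun x : V n => x ord0 i * x ord0 j) by exact: intg_coordM.
  congr (_ + _); apply: eq_bigr => i _.
    rewrite (@eq_Ex _ _ _ _ _ (fun x : V n => cst (a i) x + \sum_j A i j * x ord0 j)); last by move=> x; rewrite mxE.
    rewrite ExD; [|exact: intg_cst|by apply: intg_sum => j; exact: intgZ].
    rewrite Ex_cst Ex_sum; last by move=> j; exact: intgZ.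
    by rewrite big1 ?addr0 ?expr2// => j _; rewrite ExZ// Ex_coord0// mulr0.
  apply: eq_bigr => j _; rewrite expr2 -mulrA; congr (_ * (_ * _)).
  rewrite (@eq_Ex _ _ _ _ _ (fun x : V n => a i * x ord0 j + \sum_k A i k * (x ord0 k * x ord0 j))); last first.
    by move=> x; rewrite mxE mulrDl mulr_suml; congr (_ + _); apply: eq_bigr => k _; rewrite mulrA.
  rewrite ExD; [|exact: intgZ|by apply: intg_sum => k; exact: intgZ].
  rewrite ExZ// Ex_coord0// mulr0 add0r Ex_sum; last by move=> k; exact: intgZ.
  rewrite (bigD1 j)//= ExZ// (Ex_coordM gg) eqxx mulr1 big1 ?addr0// => k kj.
  by rewrite ExZ// (Ex_coordM gg) (negbTE kj) mulr0.
have Eq0 : Ex g q = 0.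
  have := Ex_chaos gg a A (tame_cst 1) (has_grad_cst g 1).
  rewrite (@eq_Ex _ _ _ _ (fun x : V n => 1 * chaos a A x) q) => [->|x]; last by rewrite mul1r.
  have Z (f : V n -> R) : (forall x, f x = 0) -> Ex g f = 0.
    by move=> f0; rewrite (eq_Ex _ (g := cst 0)) ?Ex_cst.
  rewrite big1 ?add0r => [|i _]; last by rewrite Z ?mulr0// => x; rewrite mxE.
  by rewrite big1// => i _; rewrite big1// => j _; rewrite Z ?mulr0// => x; rewrite mxE mul0r.
pose m := Ex g F.
have iF : intg g F := tame_intg gg tF.
have iq : intg g q := tame_intg gg tq.
have iFF : intg g (fun x => F x ^+ 2).
  by rewrite (_ : (fun x => _) = fun x => F x * F x); [apply: tame_intg => //; exact: tameM|apply/funext => x; rewrite expr2].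
have iFq : intg g (fun x => F x * q x) by apply: tame_intg => //; exact: tameM.
have iqq : intg g (fun x => q x * q x) by apply: tame_intg => //; exact: tameM.
have : 0 <= Ex g (fun x => (F x - m - q x) ^+ 2) by apply: Ex_ge0 => x; exact: sqr_ge0.
rewrite (@eq_Ex _ _ _ _ _ (fun x : V n => (F x ^+ 2 + (- (2 * m)) * F x + (-2) * (F x * q x)) +
   (q x * q x + (2 * m) * q x + cst (m ^+ 2) x))); last by move=> x /=; ring.
have i1 : intg g (fun x => F x ^+ 2 + (- (2 * m)) * F x) by apply: intgD => //; exact: intgZ.
have i2 : intg g (fun x => (-2) * (F x * q x)) by exact: intgZ.
have i3 : intg g (fun x => q x * q x + (2 * m) * q x) by apply: intgD => //; exact: intgZ.
have ic : intg g (cst (m ^+ 2)) := intg_cst g _.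
rewrite (ExD (intgD i1 i2) (intgD i3 ic)) (ExD i1 i2) (ExD i3 ic) (ExD iFF (intgZ _ iF)) (ExD iqq (intgZ _ iq)).
rewrite (ExZ _ iF) (ExZ _ iFq) (ExZ _ iq) (Ex_cst g) EFq Eqq Eq0 -/m.
have -> : 2 * (2 * (\sum_i Ex g (fun x : V n => G x ord0 i) ^+ 2) +
       \sum_i \sum_j Ex g (fun x : V n => JG i x ord0 j) ^+ 2) = S.
  rewrite /S mulrDr !mulr_sumr; congr (_ + _).
    by apply: eq_bigr => i _; rewrite /a; ring.
  apply: eq_bigr => i _; rewrite !mulr_sumr; apply: eq_bigr => j _; rewrite /A; by field.
by move: (Ex g _) => p; lra.
Qed.

End envelopes.

(** * Covariance along the Mehler interpolation *)

Section interpolation.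
Context {R : realType} {n : nat}.
Local Notation V := (@rvm R).
Variable g : probability (V n) R.
Hypothesis gg : std_gaussian g.

Lemma intg_psq_ae (f : V n * V n -> R) C k : measurable_fun setT f ->
  {ae psq g, forall z, `|f z| <= C * (1 + `|z.1 : 'rV[R]_n| + `|z.2 : 'rV[R]_n|) ^+ k} ->
  intg (psq g) f.
Proof. by move=> mf fC; apply: (intg_ae_le mf fC); apply: intgZ; exact: intg_psq_pow. Qed.

Lemma cvg_if_seq (A B : nat -> R) (c : nat -> bool) (l : R) :
  A k @[k --> \oo] --> l -> B k @[k --> \oo] --> l ->
  (fun k => if c k then A k else B k) k @[k --> \oo] --> l.
Proof.
move=> /cvgrPdist_le hA /cvgrPdist_le hB; apply/cvgrPdist_le => e e0.
by apply: filterS2 (hA _ e0) (hB _ e0) => k; case: (c k).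
Qed.

Lemma tame_rx theta x f : tame f -> tame (fun v : 'rV[R]_n => f (rx theta x v)).
Proof.
move=> [mf [C [k [C0 fC fL]]]]; split.
  exact: (measurableT_comp mf (measurableT_comp (measurable_rx theta) (measurable_pair1 (x : V n)))).
have sw (a c : R) : 0 <= a -> 0 <= c -> 1 + a + c <= (1 + a) * (1 + c).
  by move=> a0 c0; have := mulr_ge0 a0 c0; rewrite mulrDl mulrDr; lra.
exists (C * (1 + 2 * `|x|) ^+ k), k; split=> [|v|v w].
- by rewrite mulr_ge0// exprn_ge0// addr_ge0// mulr_ge0.
- apply: le_trans (fC _) _; rewrite -mulrA; apply: ler_wpM2l => //; rewrite -exprMn.
  have h1 := rx_norm theta x v; have h2 := normr_ge0 x; have h3 := normr_ge0 v.
  rewrite lerXn2r ?nnegrE ?mulr_ge0 ?addr_ge0 ?mulr_ge0//.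
  apply: (@le_trans _ _ (1 + 2 * `|x| + `|v|)); first by lra.
  by apply: sw; rewrite ?mulr_ge0.
- apply: le_trans (fL _ _) _; apply: ler_pM => //.
  + by rewrite mulr_ge0// exprn_ge0// !addr_ge0.
  + rewrite -mulrA; apply: ler_wpM2l => //; rewrite -exprMn.
    have h1 := rx_norm theta x v; have h1' := rx_norm theta x w.
    have h2 := normr_ge0 x; have h3 := normr_ge0 v; have h4 := normr_ge0 w.
    rewrite lerXn2r ?nnegrE ?mulr_ge0 ?addr_ge0 ?mulr_ge0//.
    rewrite -(addrA 1 `|v|); apply: le_trans (sw _ _ _ _); rewrite ?mulr_ge0 ?addr_ge0//.
    by lra.
  + have -> : rx theta x v - rx theta x w = sin theta *: (v - w).
      by apply/rowP => i; rewrite !mxE; ring.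
    by rewrite normrZ ler_piMl// ler_norml sin_geN1 sin_le1.
Qed.

Lemma frechet_rx theta x v (f : 'rV[R]_n -> R) a : frechet f (rx theta x v) a ->
  frechet (fun v => f (rx theta x v)) v (sin theta *: a).
Proof.
move=> fa e e0; have [d d0 D] := fa _ e0; exists d => // h hd.
have sh : `|sin theta *: h| <= `|h|.
  by rewrite normrZ ler_piMl// ler_norml sin_geN1 sin_le1.
have -> : rx theta x (v + h) = rx theta x v + sin theta *: h.
  by rewrite /rx scalerDr addrA.
rewrite dotpZl -dotpZr; apply: le_trans (D _ _) _; first exact: le_lt_trans hd.
by apply: ler_wpM2l => //; exact: ltW.
Qed.

Lemma measurable_rx_comp (f : V n -> R) t : measurable_fun setT f ->
  measurable_fun setT (fun z : V n * V n => f (rx t z.1 z.2)).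
Proof. by move=> mf; exact: (measurableT_comp mf (measurable_rx t)). Qed.

(** Dominated convergence for expectations depending on a real parameter. *)
Lemma Ex_continuous d (T : measurableType d) (P : probability T R)
    (K : R -> T -> R) (h : T -> R) (s : R) :
  (forall t, measurable_fun setT (K t)) -> (forall z, {for s, continuous (K ^~ z)}) ->
  (forall t, {ae P, forall z, `|K t z| <= h z}) -> intg P h ->
  {for s, continuous (fun t => Ex P (K t))}.
Proof.
move=> mK cK Kh ih; apply/continuous_withinNx/cvgr_dnbhsP => u [us uc].
apply: (proj2 (Ex_cvg (fun k => mK (u k)) (mK s) _ _ ih)).
  apply: aeW => z; exact: (cvg_comp _ _ uc (cK z)).
apply/ae_foralln => k; exact: Kh.
Qed.

Variables (F : 'rV[R]_n -> R) (G : 'rV[R]_n -> 'rV[R]_n).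
Hypothesis FG : envelope F G.
Variables (H : 'rV[R]_n -> R) (b : 'rV[R]_n -> 'rV[R]_n).
Hypotheses (tH : tame H) (Hb : has_grad g H b).

Let tF : tame F := tame_F FG.

(** It interpolates between [E (F * H)] at the angle [0] and [E F * E H] at
    the angle [pi / 2]. *)
Definition Phi theta := Ex (psq g) (fun z => F (rx theta z.1 z.2) * H z.1).

Let mFH theta t : measurable_fun setT (fun z : V n * V n => F (rx theta z.1 z.2) * H (rx t z.1 z.2)).
Proof. by apply: measurable_funM; apply: measurable_rx_comp; exact: tame_meas. Qed.

Let iFH theta t : intg (psq g) (fun z => F (rx theta z.1 z.2) * H (rx t z.1 z.2)).
Proof.
have [C [k [C0 hF]]] := tame_poly2 tF; have [C' [k' [C0' hH]]] := tame_poly2 tH.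
apply: (@intg_psq_poly _ _ _ gg _ (C * C') (k + k')) => // z.
by rewrite normrM exprD mulrACA; apply: ler_pM => //; exact: normr_ge0.
Qed.

Lemma rxN t (x v : 'rV[R]_n) : rx (- t) x v = rx t x (- v).
Proof. by rewrite /rx cosN sinN scaleNr scalerN. Qed.

Lemma rx0 (x v : 'rV[R]_n) : rx 0 x v = x.
Proof. by rewrite /rx cos0 sin0 scale1r scale0r addr0. Qed.

(** A rotation of the pair moves the increment [t] of the angle from [F] to
    [H]. *)
Lemma Phi_shift theta t : `|t| <= 1 ->
  Phi (t + theta) = Ex (psq g) (fun z => F (rx theta z.1 z.2) * H (rx (- t) z.1 z.2)).
Proof.
move=> t1.
have ct : 0 < cos t.
  have [t0|t0] := leP 0 t; first by apply: cos_gt01; rewrite t0 -(ger0_norm t0).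
  by rewrite -cosN; apply: cos_gt01; rewrite -(ltr0_norm t0) t1 normr_ge0.
have [_ E] := Ex_rot gg ct (cos2Dsin2 t) (iFH theta (- t)).
rewrite -E; apply: eq_Ex => z /=.
by rewrite !rx_rot addNr rx0 addrC.
Qed.

Definition dPhi theta := Ex (psq g) (fun z => F (rx theta z.1 z.2) * dotp (b z.1) z.2).

Let mdot : measurable_fun setT (fun z : V n * V n => dotp (b z.1) z.2).
Proof.
apply: measurable_sum => i; apply: measurable_funM; last exact: measurable_coord2.
by have [mb _] := Hb; exact: (measurableT_comp (mb i) measurable_fst).
Qed.

(** By [Phi_shift] the increments of the angle act on [H] at the first vector,
    where [H] is differentiable almost surely. *)
Lemma Phi_derive (theta : R) : is_derive theta (1 : R) Phi (- dPhi theta).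
Proof.
suff c : (h^-1 *: (Phi (h *: 1 + theta) - Phi theta)) @[h --> 0^'] --> - dPhi theta.
  by split; [apply/cvg_ex; eexists; exact: c|exact: cvg_lim c].
apply/cvgr_dnbhsP => u0 [u0n u0c].
have [N _ HN] : \forall k \near \oo, `|u0 k| <= 1.
  have /cvgrPdist_le/(_ _ (@ltr01 R)) := u0c.
  by apply: filterS => k; rewrite sub0r normrN.
rewrite -(cvg_shiftn N); pose u k := u0 (k + N)%N.
have un k : u k != 0 by exact: u0n.
have u1 k : `|u k| <= 1 by apply: HN => /=; rewrite leq_addl.
have uc : u k @[k --> \oo] --> (0 : R) by rewrite (cvg_shiftn N).
have t0 : null_seq (fun k => `|u k|).
  split; first by move=> k; rewrite normr_gt0 un u1.
  by rewrite -[X in _ --> X](@normr0 R R); exact: cvg_norm.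
pose q k (z : V n * V n) := F (rx theta z.1 z.2) * ((H (rx (- u k) z.1 z.2) - H z.1) / u k).
have qE k z : (H (rx (- u k) z.1 z.2) - H z.1) / u k =
  if 0 < u k then (H (rx `|u k| z.1 (- z.2)) - H z.1) / `|u k|
  else - ((H (rx `|u k| z.1 z.2) - H z.1) / `|u k|).
  case: ltP => uk; first by rewrite (gtr0_norm uk) rxN.
  by rewrite (ler0_norm uk) invrN mulrN opprK.
have mq k : measurable_fun setT (q k).
  apply: measurable_funM; first by apply: measurable_rx_comp; exact: tame_meas.
  apply: measurable_funM => //; apply: measurable_funB.
    by apply: measurable_rx_comp; exact: tame_meas.
  exact: (measurableT_comp (tame_meas tH) measurable_fst).
have ml : measurable_fun setT (fun z : V n * V n => F (rx theta z.1 z.2) * - dotp (b z.1) z.2).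
  apply: measurable_funM; first by apply: measurable_rx_comp; exact: tame_meas.
  exact: measurable_funN.
have lim : {ae psq g, forall z, q k z @[k --> \oo] --> F (rx theta z.1 z.2) * - dotp (b z.1) z.2}.
  apply: aeS (ae_psq_fst (proj2 Hb)) => z hz.
  apply: cvgM; first exact: cvg_cst.
  under eq_cvg do rewrite qE; apply: cvg_if_seq.
    by rewrite -dotpNr; exact: hz.
  by apply: cvgN; exact: hz.
have [C [k1 [C0 hF]]] := tame_poly2 tF; have [C' [k2 [C0' hH]]] := tame_quot tH.
have bd : {ae psq g, forall z k, `|q k z| <= C * C' * (1 + `|z.1 : 'rV[R]_n| + `|z.2 : 'rV[R]_n|) ^+ (k1 + k2)}.
  apply: aeW => z k; rewrite /q normrM exprD mulrACA; apply: ler_pM => //.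
  have t01 : 0 < `|u k| <= 1 by rewrite normr_gt0 un u1.
  rewrite qE; case: ifP => _; last by rewrite normrN; exact: hH.
  by have := hH _ z.1 (- (z.2 : 'rV_n)) t01; rewrite normrN.
have [_ c] := Ex_cvg mq ml lim bd (intgZ _ (intg_psq_pow gg _)).
have <- : Ex (psq g) (fun z => F (rx theta z.1 z.2) * - dotp (b z.1) z.2) = - dPhi theta.
  rewrite -ExN; first by apply: eq_Ex => z; rewrite mulrN.
  have [i _] := Ex_cvg mq ml lim bd (intgZ _ (intg_psq_pow gg _)).
  by have := intgN i; under eq_fun do rewrite mulrN opprK.
apply: cvg_trans c; apply: near_eq_cvg; apply: nearW => k /=.
have i0 := iFH theta 0.
have i1 : intg (psq g) (fun z => F (rx theta z.1 z.2) * H z.1).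
  by move: i0; under eq_fun do rewrite rx0.
rewrite -[u0 _ *: 1]/(u0 (k + N)%N * 1) mulr1 -/(u k) Phi_shift// /Phi.
rewrite -[_ *: _]/(_ * _) -ExB// -ExZ; last exact: intgB.
by apply: eq_Ex => z; rewrite /q; ring.
Qed.

(** Integration by parts in the second vector, the first one being fixed;
    along its coordinates the rotated point moves with speed [sin theta]. *)
Lemma dPhiE theta : dPhi theta =
  sin theta * Ex (psq g) (fun z => dotp (b z.1) (2 *: G (rx theta z.1 z.2))).
Proof.
have [mb _] := Hb.
have [CF [kF [CF0 hF]]] := tame_poly2 tF.
have [Cb [kb [Cb0 hb]]] := tame_grad_bound tH Hb.
have mb1 i : measurable_fun setT (fun z : V n * V n => b z.1 ord0 i).
  exact: (measurableT_comp (mb i) measurable_fst).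
have one (z : V n * V n) : 1 <= 1 + `|z.1 : 'rV[R]_n| + `|z.2 : 'rV[R]_n|.
  by rewrite -addrA lerDl addr_ge0.
have hb1 i : {ae psq g, forall z, `|b z.1 ord0 i| <= Cb * (1 + `|z.1 : 'rV[R]_n| + `|z.2 : 'rV[R]_n|) ^+ kb}.
  apply: aeS (ae_psq_fst hb) => z /(_ i) h.
  apply: le_trans h _; apply: ler_wpM2l => //; rewrite -addrA; apply: pow1_le => //.
  by rewrite lerDl.
have iA i : intg (psq g) (fun z => b z.1 ord0 i * (F (rx theta z.1 z.2) * z.2 ord0 i)).
  apply: (@intg_psq_ae _ (Cb * CF) (kb + (kF + 1))).
    apply: measurable_funM => //; apply: measurable_funM; last exact: measurable_coord2.
    by apply: measurable_rx_comp; exact: tame_meas.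
  apply: aeS (hb1 i) => z h.
  rewrite !normrM exprD mulrACA; apply: ler_pM => //; rewrite exprD mulrA expr1.
  apply: ler_pM => //; apply: le_trans (rV_coord_le _ _) _.
  by rewrite lerDr addr_ge0.
have iB i : intg (psq g) (fun z => b z.1 ord0 i * (2 * G (rx theta z.1 z.2) ord0 i)).
  have [CG [kG [CG0 hG]]] := tame_poly2 (tame_G FG i).
  apply: (@intg_psq_ae _ (Cb * (2 * CG)) (kb + kG)).
    apply: measurable_funM => //; apply: measurable_funM; first exact: measurable_cst.
    exact: (measurable_rx_comp theta (tame_meas (tame_G FG i))).
  apply: aeS (hb1 i) => z h.
  rewrite !normrM exprD mulrACA; apply: ler_pM => //; rewrite normr_nat -mulrA.
  by apply: ler_wpM2l.
transitivity (\sum_i Ex (psq g) (fun z => b z.1 ord0 i * (F (rx theta z.1 z.2) * z.2 ord0 i))).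
  rewrite -Ex_sum//; apply: eq_Ex => z; rewrite mulr_sumr.
  by apply: eq_bigr => i _; ring.
rewrite (@eq_Ex _ _ _ _ (fun z => dotp _ _) (fun z : V n * V n => \sum_i b z.1 ord0 i * (2 * G (rx theta z.1 z.2) ord0 i))); last first.
  by move=> z; apply: eq_bigr => i _; rewrite mxE.
rewrite Ex_sum// mulr_sumr; apply: eq_bigr => i _.
rewrite (proj2 (Ex_fubini (iA i))) (proj2 (Ex_fubini (iB i))) -ExZ; last exact: (proj1 (Ex_fubini (iB i))).
apply: eq_Ex => x /=.
have tfx : tame (fun v => F (rx theta x v)) by exact: tame_rx.
have hfx : has_grad g (fun v => F (rx theta x v)) (fun v => sin theta *: (2 *: G (rx theta x v))).
  split; last by apply: aeW => v; apply: frechet_rder; apply: frechet_rx; exact: frechet_F.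
  move=> j; under eq_fun do rewrite !mxE.
  apply: measurable_funM; first exact: measurable_cst.
  apply: measurable_funM; first exact: measurable_cst.
  exact: tame_meas (tame_rx theta x (tame_G FG j)).
have E := gauss_ibp gg i tfx hfx.
rewrite ExZ; last by apply: tame_intg => //; apply: tameM => //; exact: tame_coord.
have iG : intg g (fun v : V n => 2 * G (rx theta x v) ord0 i).
  by apply: intgZ; apply: tame_intg => //; exact: (tame_rx theta x (tame_G FG i)).
have -> : Ex g (fun v : V n => b x ord0 i * (2 * G (rx theta x v) ord0 i)) =
    b x ord0 i * Ex g (fun v : V n => 2 * G (rx theta x v) ord0 i) := ExZ _ iG.
rewrite mulrCA; congr (_ * _); rewrite -E -(ExZ _ iG).
by apply: eq_Ex => v; rewrite !mxE.
Qed.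

End interpolation.

Section mehler.
Context {R : realType}.
Local Notation V := (@rvm R).
Local Notation MR := (measurableTypeR R).
Local Notation mu := (@lebesgue_measure R).
Notation U := (uniform_prob (@ltr01 R) : probability MR R).

Lemma Ex_uniform (h : MR -> R) : intg U h ->
  (\int[mu]_(x in `[0%R, 1%R]) (h x)%:E)%E = (Ex U h)%:E.
Proof.
move=> ih; have mh : measurable_fun setT (EFin \o h) by apply/measurable_EFinP; exact: intg_meas ih.
rewrite -(ExE ih) integralE [RHS]integralE.
rewrite (integral_uniform (@ltr01 R) (measurable_funepos mh))//.
by rewrite (integral_uniform (@ltr01 R) (measurable_funeneg mh))// subr0 invr1 !mul1e.
Qed.

(** Truncation to [[0, 1]], which makes the interpolation below globally
    defined. *)
Definition cl (s : R) := Num.max 0 (Num.min 1 s).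

Lemma cl01 s : 0 <= cl s <= 1.
Proof. by rewrite /cl le_max lexx/= ge_max ler01 ge_min lexx. Qed.

Lemma clE s : 0 <= s <= 1 -> cl s = s.
Proof. by move=> /andP[s0 s1]; rewrite /cl (min_idPr s1) (max_idPr s0). Qed.

Lemma cl_continuous : continuous cl.
Proof.
move=> s; apply: continuous_max; first exact: cst_continuous.
by apply: continuous_min; [exact: cst_continuous|exact: cvg_id].
Qed.

Definition ang s := acos (cl s).

Let cl11 s : -1 <= cl s <= 1.
Proof. by have /andP[h ->] := cl01 s; rewrite andbT (le_trans _ h)// lerN10. Qed.

Lemma cos_ang s : cos (ang s) = cl s.
Proof. by rewrite acosK// in_itv/= cl11. Qed.

Lemma sin_ang s : sin (ang s) = Num.sqrt (1 - cl s ^+ 2).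
Proof. by rewrite sin_acos// cl11. Qed.

Lemma sin_ang_continuous : continuous (fun s => sin (ang s)).
Proof.
rewrite (_ : (fun s => _) = fun s => Num.sqrt (1 - cl s ^+ 2)); last by apply/funext => s; exact: sin_ang.
move=> s; apply: (@continuous_comp _ _ _ (fun s => 1 - cl s ^+ 2) Num.sqrt); last exact: sqrt_continuous.
apply: continuousB; first exact: cst_continuous.
by apply: (@continuous_comp _ _ _ cl (fun x => x ^+ 2)); [exact: cl_continuous|exact: exprn_continuous].
Qed.

Lemma cos_ang_continuous : continuous (fun s => cos (ang s)).
Proof.
by rewrite (_ : (fun s => _) = cl); [exact: cl_continuous|apply/funext => s; exact: cos_ang].
Qed.

Context {n : nat}.

Lemma rx_ang_continuous (x v : 'rV[R]_n) : continuous (fun s => rx (ang s) x v).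
Proof.
move=> s; apply: cvgD; apply: cvgZr_tmp.
  exact: cos_ang_continuous.
exact: sin_ang_continuous.
Qed.

Lemma tame_ang_continuous (f : 'rV[R]_n -> R) x v : tame f -> continuous (fun s => f (rx (ang s) x v)).
Proof.
move=> tf s; apply: (@continuous_comp _ _ _ (fun s => rx (ang s) x v) f).
  exact: rx_ang_continuous.
exact: tame_continuous.
Qed.

End mehler.

Section mehler_formula.
Context {R : realType} {n : nat}.
Local Notation V := (@rvm R).
Local Notation MR := (measurableTypeR R).
Local Notation mu := (@lebesgue_measure R).
Notation U := (uniform_prob (@ltr01 R) : probability MR R).

Variable g : probability (V n) R.
Hypothesis gg : std_gaussian g.

Let PU : probability ((V n * V n) * MR)%type R := (psq g \x U)%E.

Lemma measurable_rx_ang :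
  measurable_fun setT (fun w : (V n * V n) * MR => rx (ang w.2) w.1.1 w.1.2 : V n).
Proof.
have mc (f : MR -> MR) : continuous (f : R -> R) -> measurable_fun setT (fun w : (V n * V n) * MR => f w.2).
  by move=> cf; exact: (measurableT_comp (continuous_measurable_fun cf) measurable_snd).
apply: measurable_rvm => i; under eq_fun do rewrite !mxE.
apply: measurable_funD; apply: measurable_funM.
- exact: (mc (fun s => cos (ang s)) (@cos_ang_continuous R)).
- exact: (measurableT_comp (measurable_coord1 i) measurable_fst).
- exact: (mc (fun s => sin (ang s)) (@sin_ang_continuous R)).
- exact: (measurableT_comp (measurable_coord2 i) measurable_fst).
Qed.

Lemma intg_ang_poly (f : 'rV[R]_n -> R) : tame f ->
  intg PU (fun w => f (rx (ang w.2) w.1.1 w.1.2)) /\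
  forall z : V n * V n, intg U (fun s => f (rx (ang s) z.1 z.2)).
Proof.
move=> tf; have [C [k [C0 fC]]] := tame_poly2 tf.
have mf : measurable_fun setT (fun w : (V n * V n) * MR => f (rx (ang w.2) w.1.1 w.1.2)).
  exact: (measurableT_comp (tame_meas tf) measurable_rx_ang).
split.
  have ih := intgZ C (intg_fst U (intg_psq_pow gg k)).
  by apply: (intg_le mf _ ih) => w; exact: fC.
move=> z; apply: (intg_le _ _ (intg_cst U (C * (1 + `|z.1 : 'rV[R]_n| + `|z.2 : 'rV[R]_n|) ^+ k))) => //.
exact: (measurableT_comp mf (measurable_pair1 z)).
Qed.

(** The average of [h] along the quarter of circle from [z.2] to [z.1], for
    the uniform law of the cosine of the angle. *)
Definition avgt (h : 'rV[R]_n -> R) (z : V n * V n) : R :=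
  Ex U (fun s => h (rx (ang s) z.1 z.2)).

Definition avg h (x : 'rV[R]_n) : R := Ex g (fun v => avgt h (x, v)).

Lemma measurable_avgt h : tame h -> measurable_fun setT (avgt h).
Proof. by move=> th; have [i1 _] := intg_ang_poly th; exact: intg_meas (proj1 (Ex_fubini i1)). Qed.

Lemma intg_avgt h x : tame h -> intg g (fun v => avgt h (x, v)).
Proof.
move=> th; have [C [k [C0 hC]]] := tame_poly2 th.
apply: (@intg_poly _ _ _ gg _ (C * (1 + `|x : 'rV[R]_n|) ^+ k) k).
  exact: (measurableT_comp (measurable_avgt th) (measurable_pair1 x)).
move=> v; have [_ iz] := intg_ang_poly th.
apply: le_trans (Ex_norm (iz (x, v))) _.
rewrite -[leRHS](Ex_cst U); apply: Ex_le => //; first exact: intg_abs (iz (x, v)).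
  exact: intg_cst.
move=> s /=; apply: le_trans (hC _ _ _) _; rewrite -mulrA; apply: ler_wpM2l => //.
rewrite -exprMn lerXn2r ?nnegrE ?mulr_ge0 ?addr_ge0//.
have h1 := mulr_ge0 (normr_ge0 (x : 'rV[R]_n)) (normr_ge0 (v : 'rV[R]_n)).
by rewrite mulrDl mulrDr; lra.
Qed.

Variables (F : 'rV[R]_n -> R) (G : 'rV[R]_n -> 'rV[R]_n).
Hypothesis FG : envelope F G.

(** The gradient of [F], averaged over the interpolation. *)
Definition mehler_grad (x : 'rV[R]_n) : 'rV[R]_n :=
  \row_i avg (fun x => 2 * G x ord0 i) x.

Let t2G i : tame (fun x => 2 * G x ord0 i).
Proof. by apply: tameZ; exact: tame_G FG i. Qed.

Variables (H : 'rV[R]_n -> R) (b : 'rV[R]_n -> 'rV[R]_n).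
Hypotheses (tH : tame H) (Hb : has_grad g H b).

Let B s := Ex (psq g) (fun z => dotp (b z.1) (2 *: G (rx (ang s) z.1 z.2))).
Let K (w : (V n * V n) * MR) := dotp (b w.1.1) (2 *: G (rx (ang w.2) w.1.1 w.1.2)).

Let mK : measurable_fun setT K.
Proof.
apply: measurable_sum => i; apply: measurable_funM.
  by have [mb _] := Hb; exact: (measurableT_comp (mb i) (measurableT_comp measurable_fst measurable_fst)).
under eq_fun do rewrite mxE.
exact: (measurableT_comp (tame_meas (t2G i)) measurable_rx_ang).
Qed.

Let Kbound : exists C k, {ae psq g, forall z, forall s, `|K (z, s)| <= C * (1 + `|z.1 : 'rV[R]_n| + `|z.2 : 'rV[R]_n|) ^+ k}.
Proof.
have [Cb [kb [Cb0 hb]]] := tame_grad_bound tH Hb.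
exists (n%:R * (Cb * (2 * n.+1%:R))), (kb + 1)%N.
apply: aeS (ae_psq_fst hb) => -[x v]/= hx s.
apply: le_trans (dotp_norm _ _) _; rewrite -mulrA; apply: ler_wpM2l => //.
rewrite exprD mulrACA; apply: ler_pM => //.
  have [->|[i ->]] := rV_norm_attained (b x); first by rewrite mulr_ge0// exprn_ge0// !addr_ge0.
  apply: le_trans (hx i) _; apply: ler_wpM2l => //; rewrite -addrA; apply: pow1_le => //.
  by rewrite lerDl.
rewrite normrZ normr_nat -mulrA expr1; apply: ler_wpM2l => //.
apply: le_trans (envelope_norm FG _) _; apply: ler_wpM2l => //.
by apply: le_trans (rx_norm _ _ _) _; rewrite -addrA lerDr.
Qed.

Let iK : intg PU K.
Proof.
have [C [k hK]] := Kbound.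
have ih := intgZ C (intg_fst U (intg_psq_pow gg k)).
apply: (intg_ae_le mK _ ih).
by apply: aeS (ae_fst U hK) => -[z s] /(_ s).
Qed.

Let B_continuous : continuous B.
Proof.
have [C [k hK]] := Kbound.
move=> s; apply: (Ex_continuous (P := psq g) (K := fun s z => K (z, s))
  (h := fun z => C * (1 + `|z.1 : 'rV[R]_n| + `|z.2 : 'rV[R]_n|) ^+ k)).
- by move=> t; exact: (measurableT_comp mK (measurable_pair2 t)).
- move=> z; rewrite /K/dotp; elim: (index_enum _) => [|i r IH].
    rewrite (_ : (fun t => _) = fun=> 0); first exact: cst_continuous.
    by apply/funext => t; rewrite big_nil.
  rewrite (_ : (fun t => _) = fun t => b z.1 ord0 i * (2 * G (rx (ang t) z.1 z.2) ord0 i) +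
     \sum_(j <- r) b z.1 ord0 j * (2 *: G (rx (ang t) z.1 z.2)) ord0 j); last first.
    by apply/funext => t; rewrite big_cons mxE.
  apply: continuousD => //; apply: continuousM; first exact: cst_continuous.
  have cc := @tame_ang_continuous R n (fun x => 2 * G x ord0 i) z.1 z.2 (t2G i).
  exact: (cc s).
- move=> t; apply: aeS hK => z; exact.
- by apply: intgZ; exact: intg_psq_pow.
Qed.

Let psi_continuous : continuous (fun s => Phi g F H (ang s)).
Proof.
have tF := tame_F FG.
have [C [k [C0 hF]]] := tame_poly2 tF; have [C' [k' [C0' hH]]] := tame_poly2 tH.
move=> s; apply: (Ex_continuous (P := psq g) (K := fun s z => F (rx (ang s) z.1 z.2) * H z.1)
  (h := fun z => C * C' * (1 + `|z.1 : 'rV[R]_n| + `|z.2 : 'rV[R]_n|) ^+ (k + k'))).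
- move=> t; apply: measurable_funM; first by apply: measurable_rx_comp; exact: tame_meas.
  exact: (measurableT_comp (tame_meas tH) measurable_fst).
- move=> z; apply: continuousM; last exact: cst_continuous.
  have cc := @tame_ang_continuous R n F z.1 z.2 tF.
  exact: (cc s).
- move=> t; apply: aeW => z; rewrite normrM exprD mulrACA; apply: ler_pM => //.
  by have := hH 0 z.1 z.2; rewrite rx0.
- by apply: intgZ; exact: intg_psq_pow.
Qed.

Let angE (s : R) : 0 <= s <= 1 -> ang s = acos s.
Proof. by move=> s01; rewrite /ang clE. Qed.

Let Ex_B : Ex U B = Ex g (fun x => F x * H x) - Ex g F * Ex g H.
Proof.
have tF := tame_F FG.
have [iB _] := Ex_fubiniC iK.
have E := Ex_uniform iB.
pose psi (s : R) := Phi g F H (acos s).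
have dpsi (s : R) : 0 < s < 1 -> is_derive s (1 : R) psi (B s).
  move=> /andP[s0 s1].
  have h1 : -1 < s < 1 by rewrite s1 (lt_trans _ s0)// ltrN10.
  have D := @is_derive1_comp _ (Phi g F H) acos s _ _ (Phi_derive gg FG tH Hb (acos s)) (is_derive1_acos h1).
  have -> : B s = - dPhi g F b (acos s) * - (Num.sqrt (1 - s ^+ 2))^-1.
    rewrite (dPhiE gg FG tH Hb) -angE ?(ltW s0) ?(ltW s1)// sin_ang clE ?(ltW s0) ?(ltW s1)//.
    rewrite mulrNN mulrAC mulfV ?mul1r// gt_eqF// sqrtr_gt0 subr_gt0.
    by rewrite expr_lt1// ltW.
  exact: D.
have L : derivable_oo_LRcontinuous psi 0 1.
  split.
  - move=> s; rewrite in_itv/= => s01; exact: (@ex_derive _ _ _ _ _ _ _ (dpsi s s01)).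
  - have <- : Phi g F H (ang 0) = psi 0 by rewrite /psi angE ?lexx ?ler01.
    have := cvg_at_right_filter (@psi_continuous 0); apply: cvg_trans; apply: near_eq_cvg.
    near=> s; rewrite /psi angE//; apply/andP; split; near: s; [exact: nbhs_right_ge|exact: nbhs_right_le].
  - have <- : Phi g F H (ang 1) = psi 1 by rewrite /psi angE ?lexx ?ler01.
    have := cvg_at_left_filter (@psi_continuous 1); apply: cvg_trans; apply: near_eq_cvg.
    near=> s; rewrite /psi angE//; apply/andP; split; near: s; [exact: nbhs_left_ge|exact: nbhs_left_le].
have := continuous_FTC2 (@ltr01 R) (continuous_subspaceT B_continuous) L.
have dB : {in `]0, 1[%R, (psi^`())%classic =1 B}.
  by move=> s; rewrite in_itv/= derive1E => s01; exact: (@derive_val _ _ _ _ _ _ _ (dpsi s s01)).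
move=> /(_ dB); rewrite E -EFinB => -[] H1.
apply: etrans H1 _; rewrite /psi acos1 acos0 /Phi; congr (_ - _).
  rewrite -psqE_fst; first by apply: eq_Ex => z; rewrite rx0.
  by apply: tame_intg => //; exact: tameM.
rewrite (mulrC (Ex g F)); transitivity (Ex (psq g) (fun z : V n * V n => H z.1 * F z.2)).
  by apply: eq_Ex => z; rewrite /rx cos_pihalf sin_pihalf scale0r scale1r add0r mulrC.
exact: (Ex_prod (tame_intg gg tH) (tame_intg gg tF)).
Unshelve. all: by end_near. Qed.

(** Mehler's formula for the covariance. In the variable [s = cos theta], the
    factor [sin theta] of the derivative of [Phi] cancels, and the fundamental
    theorem of calculus on the unit interval gives the claim. *)
Lemma mehler : Ex g (fun x => F x * H x) - Ex g F * Ex g H =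
  Ex g (fun x => dotp (b x) (mehler_grad x)).
Proof.
rewrite -Ex_B -(proj2 (Ex_fubiniC iK)) (proj2 (Ex_fubini iK)).
have [i1 _] := Ex_fubini iK.
rewrite (proj2 (Ex_fubini i1)); apply: eq_Ex => x.
have iz i := proj2 (intg_ang_poly (t2G i)).
have iN i := intg_avgt x (t2G i).
rewrite (@eq_Ex _ _ _ _ _ (fun v => \sum_i b x ord0 i * avgt (fun x => 2 * G x ord0 i) (x, v))).
  rewrite Ex_sum; last by move=> i; apply: intgZ.
  by apply: eq_bigr => i _; rewrite ExZ// mxE.
move=> v; rewrite /K /dotp Ex_sum/=.
  by apply: eq_bigr => i _; rewrite -(ExZ _ (iz i (x, v))); apply: eq_Ex => s; rewrite mxE.
move=> i; under eq_fun do rewrite mxE.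
by apply: intgZ; exact: (iz i (x, v)).
Qed.

End mehler_formula.

(** * The Poincare inequality *)

Section poincare.
Context {R : realType} {n : nat}.
Local Notation V := (@rvm R).
Variable g : probability (V n) R.
Hypothesis gg : std_gaussian g.

Lemma sqr_sum_le N (d : 'I_N -> R) : (\sum_j d j) ^+ 2 <= N%:R * \sum_j d j ^+ 2.
Proof.
have := dotp_CS (\row_j d j) (const_mx 1).
have -> : dotp (\row_j d j) (const_mx 1) = \sum_j d j.
  by apply: eq_bigr => j _; rewrite !mxE mulr1.
have -> : dotp (\row_j d j) (\row_j d j) = \sum_j d j ^+ 2.
  by apply: eq_bigr => j _; rewrite !mxE expr2.
have -> : dotp (const_mx 1 : 'rV[R]_N) (const_mx 1) = N%:R.
  rewrite /dotp (eq_bigr (fun=> 1)) => [|j _]; last by rewrite !mxE mulr1.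
  by rewrite sumr_const card_ord.
by rewrite mulrC.
Qed.

(** The inequality [t * cos t <= sin t] at [pi / 6], where the sine is a root
    of the polynomial of triple angles. *)
Lemma pi_sqr_le12 : (pi : R) ^+ 2 <= 12.
Proof.
pose t : R := pi / 6; have p0 := @pi_gt0 R.
have t0 : 0 < t by rewrite divr_gt0.
have tpi : t < pi / 2 by rewrite ltr_pM2l// ltf_pV2 ?posrE// ltr_nat.
have c0 : 0 < cos t by apply: cos_gt0_pihalf; rewrite tpi andbT (lt_trans _ t0)// oppr_lt0 divr_gt0.
have s0 : 0 <= sin t.
  by apply: sin_ge0_pi; rewrite (ltW t0) (ltW (lt_trans tpi _))// gtr_pMr// invf_lt1 ?ltr1n.
have cs := cos2Dsin2 t.
have s_half : sin t = 2^-1.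
  have E : sin (pi / 2 : R) = 1 by exact: sin_pihalf.
  have t3 : pi / 2 = t + t + t :> R by rewrite /t; field.
  move: E; rewrite t3 sinD sinD cosD => E.
  have {}E : (sin t + 1) * (2 * sin t - 1) ^+ 2 = 0.
    have c2 : cos t ^+ 2 = 1 - sin t ^+ 2 by rewrite -cs addrK.
    have e : sin t * 3 - 4 * sin t ^+ 3 = 1.
      apply: etrans E; move: (sin t) (cos t) c2 => s c c2.
      have -> : (s * c + c * s) * c + (c * c - s * s) * s = 3 * s * c ^+ 2 - s ^+ 3 by ring.
      by rewrite c2; ring.
    have -> : (sin t + 1) * (2 * sin t - 1) ^+ 2 = 1 - (sin t * 3 - 4 * sin t ^+ 3) by ring.
    by rewrite e subrr.
  move/eqP: E; rewrite mulf_eq0 expf_eq0/= gt_eqF/=; last by rewrite ltr_wpDl.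
  by rewrite subr_eq0 => /eqP E; apply: (mulfI (_ : 2 != 0 :> R)); rewrite ?pnatr_eq0// E mulfV ?pnatr_eq0.
have tc : t * cos t <= sin t.
  have [|c cin] := @MVT_segment R sin cos 0 t (ltW t0) (fun y _ => is_derive_sin y).
    exact/continuous_subspaceT/continuous_sin.
  rewrite sin0 !subr0 => ->; rewrite mulrC; apply: ler_wpM2r; first exact: ltW.
  move: cin; rewrite in_itv/= => /andP[ct0 ct1].
  rewrite leNgt ltr_cos -?leNgt// in_itv/=; apply/andP; split=> //; try exact: ltW; lra.
have c2 : cos t ^+ 2 = 3 / 4 by move: cs; rewrite s_half => cs; lra.
have h : (t * cos t) ^+ 2 <= 4^-1.
  rewrite (_ : 4^-1 = (sin t) ^+ 2); last by rewrite s_half; field.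
  by rewrite lerXn2r ?nnegrE// mulr_ge0// ltW.
move: h; rewrite exprMn c2 /t => h.
have -> : (pi : R) ^+ 2 = 48 * ((pi / 6) ^+ 2 * (3 / 4)) by field.
by lra.
Qed.

Variables (f : 'rV[R]_n -> R) (b : 'rV[R]_n -> 'rV[R]_n).
Hypotheses (tf : tame f) (fb : has_grad g f b).

Let theta (k : nat) : R := pi / 2 / k.+2%:R.

Let theta_gt0 k : 0 < theta k.
Proof. by rewrite !divr_gt0// pi_gt0. Qed.

Let theta_le1 k : theta k <= 1.
Proof.
rewrite ler_pdivrMr// mul1r (@le_trans _ _ 2)//; last by rewrite ler_nat.
by have /andP[_ /ltW] := pihalf_02 R.
Qed.

Let null_theta : null_seq theta.
Proof.
split; first by move=> k; rewrite theta_gt0 theta_le1.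
rewrite (_ : theta = fun k => (pi / 2) * tk (k + 1)%N); last first.
  by apply/funext => k; rewrite /theta /tk addn1.
rewrite -[X in _ --> X](mulr0 (pi / 2 : R)); apply: cvgM; first exact: cvg_cst.
by have := @tk_cvg R; rewrite -(cvg_shiftn 1).
Qed.

Let dq k (z : V n * V n) := f (rx (theta k) z.1 z.2) - f z.1.

Let mdq k : measurable_fun setT (dq k).
Proof.
apply: measurable_funB; first by apply: measurable_rx_comp; exact: tame_meas.
exact: (measurableT_comp (tame_meas tf) measurable_fst).
Qed.

Let tame_sq C k (h : V n * V n -> R) : measurable_fun setT h ->
  (forall z, `|h z| <= C * (1 + `|z.1 : 'rV[R]_n| + `|z.2 : 'rV[R]_n|) ^+ k) ->
  intg (psq g) (fun z => h z ^+ 2).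
Proof.
move=> mh hC; apply: (@intg_psq_poly _ _ _ gg _ (C * C) (k + k)).
  by apply: measurable_funX.
by move=> z; rewrite normrX expr2 exprD mulrACA; apply: ler_pM.
Qed.

Let idq k : intg (psq g) (fun z => dq k z ^+ 2).
Proof.
have [C [l [C0 hC]]] := tame_poly2 tf.
apply: (@tame_sq (2 * C) l _ (mdq k)) => z.
apply: le_trans (ler_normB _ _) _; have := hC (theta k) z.1 z.2; have := hC 0 z.1 z.2.
by rewrite rx0 -mulrA; move: (_ ^+ l) (`|f z.1|) => p q; lra.
Qed.

Let steps k (z : V n * V n) : f z.2 - f z.1 =
  \sum_(j < k.+2) dq k (rot (cos (j%:R * theta k)) (sin (j%:R * theta k)) z).
Proof.
pose u j := f (rx (j%:R * theta k) z.1 z.2).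
transitivity (\sum_(0 <= j < k.+2) (u j.+1 - u j)).
  rewrite telescope_sumr// /u mul0r rx0 /theta mulrCA divff ?mulr1 ?pnatr_eq0//.
  by rewrite /rx cos_pihalf sin_pihalf scale0r scale1r add0r.
rewrite big_mkord; apply: eq_bigr => j _; rewrite /dq rx_rot /u; congr (f _ - f _).
  by rewrite -natr1 mulrDl mul1r addrC.
Qed.

Let chain k : Ex (psq g) (fun z => (f z.2 - f z.1) ^+ 2) <=
  (pi / 2) ^+ 2 * Ex (psq g) (fun z => (dq k z / theta k) ^+ 2).
Proof.
have r (j : 'I_k.+2) : let phi := rot (cos (j%:R * theta k)) (sin (j%:R * theta k)) in
    intg (psq g) (fun z => dq k (phi z) ^+ 2) /\
    Ex (psq g) (fun z => dq k (phi z) ^+ 2) = Ex (psq g) (fun z => dq k z ^+ 2).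
  have ct : 0 < cos (j%:R * theta k).
    apply: cos_gt0_pihalf; have p0 := @pi_gt0 R.
    rewrite (@lt_le_trans _ _ 0) ?oppr_lt0 ?divr_gt0//=; last by rewrite mulr_ge0// ltW.
    by rewrite /theta mulrCA gtr_pMr ?divr_gt0// ltr_pdivrMr// mul1r ltr_nat.
  exact: (Ex_rot gg ct (cos2Dsin2 _) (idq k)).
have iS : intg (psq g) (fun z => \sum_(j < k.+2) dq k (rot (cos (j%:R * theta k)) (sin (j%:R * theta k)) z) ^+ 2).
  by apply: intg_sum => j; have [] := r j.
apply: (@le_trans _ _ (Ex (psq g) (fun z => k.+2%:R *
    \sum_(j < k.+2) dq k (rot (cos (j%:R * theta k)) (sin (j%:R * theta k)) z) ^+ 2))).
  apply: Ex_le; last by move=> z; rewrite (steps k); exact: sqr_sum_le.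
    have [C [l [C0 hC]]] := tame_poly2 tf.
    apply: (@tame_sq (2 * C) l) => [|z].
      apply: measurable_funB; first exact: (measurableT_comp (tame_meas tf) measurable_snd).
      exact: (measurableT_comp (tame_meas tf) measurable_fst).
    apply: le_trans (ler_normB _ _) _; have := hC (pi / 2) z.1 z.2; have := hC 0 z.1 z.2.
    rewrite rx0 /rx cos_pihalf sin_pihalf scale0r scale1r add0r -mulrA.
    by move: (_ ^+ l) (`|f z.1|) => p q; lra.
  exact: intgZ.
rewrite ExZ// Ex_sum; last by move=> j; have [] := r j.
under eq_bigr => j _ do rewrite (proj2 (r j)).
rewrite sumr_const card_ord -[Ex _ _ *+ _]mulr_natl.
rewrite (@eq_Ex _ _ _ _ (fun z => (dq k z / theta k) ^+ 2) (fun z => (theta k) ^- 2 * dq k z ^+ 2)); last first.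
  by move=> z; rewrite exprMn exprVn mulrC.
rewrite ExZ// !mulrA le_eqVlt; apply/orP; left; apply/eqP; congr (_ * _).
have N0 : k.+2%:R != 0 :> R by rewrite pnatr_eq0.
have p0 : pi != 0 :> R by rewrite gt_eqF// pi_gt0.
rewrite /theta; move: (k.+2%:R : R) (pi : R) N0 p0 => N p N0 p0; field.
by rewrite N0.
Qed.

(** Pisier's argument. The left-hand side is the mean square of [f v - f x] for
    independent vectors. The quarter of circle from [x] to [v] is cut into equal
    steps, whose increments have the same law because rotations preserve the law
    of the pair. By the Cauchy-Schwarz inequality, the mean square quotient of
    one step, times [(pi / 2) ^+ 2], is an upper bound, and the number of steps
    is made to grow. *)
Lemma poincare : 2 * (Ex g (fun x => f x ^+ 2) - Ex g f ^+ 2) <=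
  (pi / 2) ^+ 2 * Ex g (fun x : V n => dotp (b x) (b x)).
Proof.
have [mb hb] := fb.
have [C [l [C0 hC]]] := tame_quot tf.
have mdot : measurable_fun setT (fun z : V n * V n => dotp (b z.1) z.2 ^+ 2).
  apply: measurable_funX; apply: measurable_sum => i; apply: measurable_funM; last exact: measurable_coord2.
  exact: (measurableT_comp (mb i) measurable_fst).
have mq k : measurable_fun setT (fun z => (dq k z / theta k) ^+ 2).
  by apply: measurable_funX; apply: measurable_funM.
have lim : {ae psq g, forall z, (dq k z / theta k) ^+ 2 @[k --> \oo] --> dotp (b z.1) z.2 ^+ 2}.
  apply: aeS (ae_psq_fst hb) => z hz.
  by rewrite expr2; under eq_cvg do rewrite expr2; apply: cvgM; exact: hz.
have bd : {ae psq g, forall z k, `|(dq k z / theta k) ^+ 2| <=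
    C * C * (1 + `|z.1 : 'rV[R]_n| + `|z.2 : 'rV[R]_n|) ^+ (l + l)}.
  apply: aeW => z k; rewrite normrX expr2 exprD mulrACA.
  by apply: ler_pM => //; apply: hC; rewrite theta_gt0 theta_le1.
have [i1 c] := Ex_cvg mq mdot lim bd (intgZ _ (intg_psq_pow gg _)).
have ib i j : intg g (fun x : V n => b x ord0 i * b x ord0 j).
  by apply: intg_mul => //; exact: tame_grad_sqr_intg fb.
have -> : Ex g (fun x : V n => dotp (b x) (b x)) = Ex (psq g) (fun z => dotp (b z.1) z.2 ^+ 2).
  rewrite Ex_sum; last by move=> i; exact: ib.
  have im i j : intg (psq g) (fun z : V n * V n => (b z.1 ord0 i * b z.1 ord0 j) * (z.2 ord0 i * z.2 ord0 j)).
    exact: (intg_prod (ib i j) (intg_coordM gg i j)).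
  rewrite (@eq_Ex _ _ _ _ (fun z : V n * V n => dotp (b z.1) z.2 ^+ 2)
     (fun z : V n * V n => \sum_i \sum_j (b z.1 ord0 i * b z.1 ord0 j) * (z.2 ord0 i * z.2 ord0 j))); last first.
    move=> z; rewrite expr2 /dotp mulr_suml; apply: eq_bigr => i _; rewrite mulr_sumr.
    by apply: eq_bigr => j _; ring.
  rewrite Ex_sum; last by move=> i; exact: intg_sum.
  apply: eq_bigr => i _; rewrite Ex_sum// (bigD1 i)//= [X in _ = _ + X]big1 ?addr0.
    apply/esym; apply: etrans (Ex_prod (ib i i) (intg_coordM gg i i)) _.
    by rewrite (Ex_coordM gg) eqxx mulr1.
  move=> j ji; apply: etrans (Ex_prod (ib i j) (intg_coordM gg i j)) _.
  by rewrite (Ex_coordM gg) eq_sym (negbTE ji) mulr0.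
have -> : 2 * (Ex g (fun x => f x ^+ 2) - Ex g f ^+ 2) = Ex (psq g) (fun z => (f z.2 - f z.1) ^+ 2).
  have iff : intg g (fun x => f x ^+ 2).
    rewrite (_ : (fun x => _) = fun x => f x * f x); first by apply: tame_intg => //; exact: tameM.
    by apply/funext => x; rewrite expr2.
  have i_ : intg g f := tame_intg gg tf.
  rewrite (@eq_Ex _ _ _ _ (fun z : V n * V n => (f z.2 - f z.1) ^+ 2)
    (fun z : V n * V n => f z.2 ^+ 2 + f z.1 ^+ 2 - 2 * (f z.1 * f z.2))); last by move=> z; ring.
  have j1 := intg_snd g iff; have j2 := intg_fst g iff; have j3 := intg_prod i_ i_.
  have -> : Ex (psq g) (fun z : V n * V n => f z.2 ^+ 2 + f z.1 ^+ 2 - 2 * (f z.1 * f z.2)) =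
    Ex (psq g) (fun z : V n * V n => f z.2 ^+ 2) + Ex (psq g) (fun z : V n * V n => f z.1 ^+ 2) -
    2 * Ex (psq g) (fun z : V n * V n => f z.1 * f z.2).
    rewrite (ExB (intgD j1 j2) (intgZ 2 j3)) (ExD j1 j2); congr (_ - _); exact: ExZ.
  rewrite (psqE_snd iff) (psqE_fst iff) [Ex (psq g) (fun z => f z.1 * f z.2)](Ex_prod i_ i_).
  by ring.
have c2 : (pi / 2) ^+ 2 * Ex (psq g) (fun z => (dq k z / theta k) ^+ 2) @[k --> \oo] -->
  (pi / 2) ^+ 2 * Ex (psq g) (fun z => dotp (b z.1) z.2 ^+ 2).
  by apply: cvgM => //; exact: cvg_cst.
rewrite -(cvg_lim (@Rhausdorff R) c2); apply: limr_ge; first by apply/cvg_ex; eexists; exact: c2.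
by apply: nearW => k; exact: chain.
Qed.

End poincare.

(** * The representative of the covariance and its variance *)

Lemma ae_forall_fin (R : realType) d (T : measurableType d) (P : probability T R) (I : finType)
    (p : I -> T -> Prop) : (forall i, {ae P, forall x, p i x}) ->
  {ae P, forall x, forall i, p i x}.
Proof.
move=> H; suff S (s : seq I) : {ae P, forall x, forall i, i \in s -> p i x}.
  apply: aeS (S (enum I)) => x h i.
  by apply: h; rewrite mem_enum.
elim: s => [|i s IH]; first by apply: aeW.
apply: aeS2 (H i) IH => x h1 h2 j.
by rewrite in_cons => /orP[/eqP ->|/h2].
Qed.

Lemma Ex_le_ae (R : realType) d (T : measurableType d) (P : probability T R) (f h : T -> R) :
  intg P f -> intg P h -> {ae P, forall x, f x <= h x} -> Ex P f <= Ex P h.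
Proof.
move=> fi hi H; apply: (@le_trans _ _ (Ex P (fun x => Num.min (f x) (h x)))).
  rewrite le_eqVlt; apply/orP; left; apply/eqP; apply: Ex_ae.
  - exact: intg_meas fi.
  - by apply: measurable_minr; [exact: intg_meas fi|exact: intg_meas hi].
  - by apply: aeS H => x fh; rewrite (min_idPl fh).
apply: Ex_le => //; last by move=> x; rewrite ge_min lexx orbT.
apply: (intg_le _ _ (intgD (intg_abs fi) (intg_abs hi))).
  by apply: measurable_minr; [exact: intg_meas fi|exact: intg_meas hi].
by move=> x; rewrite /Num.min; case: ifP => _; rewrite ?lerDl ?lerDr.
Qed.

Section covariance_representative.
Context {R : realType} {n : nat}.
Local Notation V := (@rvm R).
Local Notation MR := (measurableTypeR R).
Notation U := (uniform_prob (@ltr01 R) : probability MR R).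
Variable g : probability (V n) R.
Hypothesis gg : std_gaussian g.

(** The transpose of a contraction is a contraction; the difference quotients
    of [N] are taken in the direction [w] of the sum itself. *)
Lemma nonexpansive_gradient (N : 'rV[R]_n -> 'rV[R]_n) (J : 'I_n -> 'rV[R]_n) (x u : 'rV[R]_n) :
  nonexpansive N ->
  (forall i, rder (fun x => N x ord0 i) x (J i)) ->
  dotp (\sum_i u ord0 i *: J i) (\sum_i u ord0 i *: J i) <= dotp u u.
Proof.
move=> hN hJ; set w := \sum_i _.
have [w0|w0] := eqVneq (dotp w w) 0; first by rewrite w0 dotp_ge0.
have wp : 0 < dotp w w by rewrite lt_neqAle eq_sym w0 dotp_ge0.
suff : dotp w w * dotp w w <= dotp w w * dotp u u by rewrite ler_pM2l.
pose q k := rx (tk k) x w - x; pose D k := N (rx (tk k) x w) - N x.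
have sum_cvg (a c : nat -> 'I_n -> R) (a1 c1 : 'I_n -> R) :
   (forall i, a k i @[k --> \oo] --> a1 i) -> (forall i, c k i @[k --> \oo] --> c1 i) ->
   (\sum_i a k i * c k i) @[k --> \oo] --> \sum_i a1 i * c1 i.
  move=> ha hc; apply: cvg_big => [|i _]; first exact: (@add_continuous R).
  by apply: cvgM.
have c1 : (\sum_i u ord0 i * ((N (rx (tk k) x w) ord0 i - N x ord0 i) / tk k)) @[k --> \oo] --> \sum_i u ord0 i * dotp (J i) w.
  by apply: sum_cvg => i; [exact: cvg_cst|exact: hJ null_tk].
have c2 : (\sum_i ((rx (tk k) x w ord0 i - x ord0 i) / tk k) * ((rx (tk k) x w ord0 i - x ord0 i) / tk k)) @[k --> \oo] --> \sum_i w ord0 i * w ord0 i.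
  by apply: sum_cvg => i; have := @rder_coord R n i x tk w null_tk; rewrite dotpC dotp_delta.
have E1 : \sum_i u ord0 i * dotp (J i) w = dotp w w.
  rewrite {2}/w /dotp; under eq_bigr do rewrite mulr_sumr.
  rewrite exchange_big/=; apply: eq_bigr => j _; rewrite summxE mulr_suml.
  by apply: eq_bigr => i _; rewrite !mxE mulrA.
rewrite E1 in c1.
pose a k := \sum_i u ord0 i * ((N (rx (tk k) x w) ord0 i - N x ord0 i) / tk k).
pose c k := \sum_i ((rx (tk k) x w ord0 i - x ord0 i) / tk k) * ((rx (tk k) x w ord0 i - x ord0 i) / tk k).
have c3 : a k * a k @[k --> \oo] --> dotp w w * dotp w w by exact: cvgM.
have c4 : dotp u u * c k @[k --> \oo] --> dotp u u * dotp w w by apply: cvgM => //; exact: cvg_cst.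
rewrite [leRHS]mulrC; apply: (ler_cvg_to c3 c4); apply: nearW => k; rewrite /a /c.
have t0 := @tk_gt0 R k.
have -> : \sum_i u ord0 i * ((N (rx (tk k) x w) ord0 i - N x ord0 i) / tk k) = dotp u (D k) / tk k.
  by rewrite /dotp mulr_suml; apply: eq_bigr => i _; rewrite !mxE mulrA.
have -> : \sum_i ((rx (tk k) x w ord0 i - x ord0 i) / tk k) * ((rx (tk k) x w ord0 i - x ord0 i) / tk k) =
   dotp (q k) (q k) / tk k ^+ 2.
  rewrite /dotp mulr_suml; apply: eq_bigr => i _; rewrite !mxE.
  by field; rewrite gt_eqF.
rewrite -expr2 expr_div_n mulrA; apply: ler_wpM2r; first by rewrite invr_ge0 sqr_ge0.
apply: le_trans (dotp_CS _ _) _; apply: ler_wpM2l; first exact: dotp_ge0.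
exact: hN.
Qed.

Lemma nonexpansive_gradientZ (N : 'rV[R]_n -> 'rV[R]_n) (J : 'I_n -> 'rV[R]_n) x (c : R) (u : 'rV[R]_n) :
  nonexpansive N ->
  (forall i, rder (fun x => N x ord0 i) x (J i)) ->
  dotp (\sum_i (c * u ord0 i) *: J i) (\sum_i (c * u ord0 i) *: J i) <= c ^+ 2 * dotp u u.
Proof.
move=> hN hJ; under eq_bigr do rewrite -scalerA.
rewrite -scaler_sumr dotpZl dotpZr mulrA -expr2; apply: ler_wpM2l; first exact: sqr_ge0.
exact: nonexpansive_gradient.
Qed.

Variables (F : 'rV[R]_n -> R) (G : 'rV[R]_n -> 'rV[R]_n).
Hypothesis FG : envelope F G.
Local Notation M := (mehler_grad g G).

Lemma Ex_cl : Ex U (@cl R) = 2^-1.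
Proof.
have mcl : measurable_fun setT (cl : MR -> MR) by apply: continuous_measurable_fun; exact: cl_continuous.
have icl : intg U (@cl R).
  apply: (intg_le mcl _ (intg_cst U 1)) => s; have /andP[c0 c1] := cl01 s.
  by rewrite ger0_norm.
have := Ex_uniform icl.
have D (s : R) : is_derive s (1 : R) (fun x : R => 2^-1 * x ^+ 2) s.
  have H := is_deriveZ 2^-1 (is_deriveM (is_derive_id s (1 : R)) (is_derive_id s (1 : R))).
  rewrite (_ : (fun x : R => 2^-1 * x ^+ 2) = 2^-1 \*: (id * id)); last first.
    by apply/funext => x; rewrite expr2.
  apply: (is_derive_eq H).
  by rewrite -[_ *: (_ + _)]/(_ * (s * 1 + s * 1)); field.
have L : derivable_oo_LRcontinuous (fun x : R => 2^-1 * x ^+ 2) 0 1.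
  have c : continuous (fun x : R => 2^-1 * x ^+ 2) := derive_continuous D.
  split.
  - move=> s _; exact: (@ex_derive _ _ _ _ _ _ _ (D s)).
  - exact: cvg_at_right_filter (c 0).
  - exact: cvg_at_left_filter (c 1).
have dB : {in `]0, 1[%R, ((fun x : R => 2^-1 * x ^+ 2)^`())%classic =1 @cl R}.
  move=> s; rewrite in_itv/= derive1E => /andP[s0 s1].
  by rewrite (@derive_val _ _ _ _ _ _ _ (D s)) clE// !ltW.
have := continuous_FTC2 (@ltr01 R) (continuous_subspaceT (@cl_continuous R)) L dB.
move=> -> []; rewrite expr1n mulr1 expr0n mulr0 subr0 => <-.
by [].
Qed.

(** Each interpolated point has the law [g]. *)
Lemma Ex_avg h : tame h -> intg g (avg g h) /\ Ex g (avg g h) = Ex g h.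
Proof.
move=> th; have [i1 _] := intg_ang_poly gg th.
have [i2 E2] := Ex_fubini i1; have [i3 E3] := Ex_fubini i2.
have [i4 E4] := Ex_fubiniC i1.
split=> //; have -> : Ex g (avg g h) = Ex U (fun s => Ex (psq g) (fun z => h (rx (ang s) z.1 z.2))).
  by rewrite -E4 E2 E3.
rewrite -[RHS](Ex_cst U); apply: Ex_ae => //; first exact: intg_meas i4.
apply: ae_uniform; apply: aeW => s /andP[s0 s1].
have ct : 0 < cos (ang s) by rewrite cos_ang clE// !ltW.
have [_ E] := Ex_rot gg ct (cos2Dsin2 _) (intg_fst g (tame_intg gg th)).
by rewrite -(psqE_fst (tame_intg gg th)) -E.
Qed.

Lemma avg_sqr_le h x : tame h -> avg g h x ^+ 2 <= avg g (fun x => h x ^+ 2) x.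
Proof.
move=> th; have th2 : tame (fun x => h x ^+ 2).
  by rewrite (_ : (fun x => _) = fun x => h x * h x); [exact: tameM|apply/funext => y; rewrite expr2].
have [_ iz] := intg_ang_poly gg th; have [_ iz2] := intg_ang_poly gg th2.
have le1 v : avgt h (x, v) ^+ 2 <= avgt (fun x => h x ^+ 2) (x, v).
  by apply: Ex_sqr_le; [exact: intg_meas (iz (x, v))|exact: (iz2 (x, v))].
have m1 : measurable_fun setT (fun v => avgt h (x, v)) := intg_meas (intg_avgt gg x th).
have i2 := intg_avgt gg x th2.
have i1 : intg g (fun v => avgt h (x, v) ^+ 2).
  by apply: (intg_le _ _ i2) => [|v]; [exact: measurable_funX|rewrite ger0_norm ?sqr_ge0].
by apply: le_trans (Ex_sqr_le m1 i1) _; apply: Ex_le.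
Qed.

(** Averaging contracts increments by the mean of the first coordinate [cl s] of
    the interpolation. *)
Lemma avg_diff_le h x y (C : R) : tame h ->
  (forall t v, h (rx t x v) - h (rx t y v) <= C * `|cos t|) ->
  avg g h x - avg g h y <= C / 2.
Proof.
move=> th hC; have [_ iz] := intg_ang_poly gg th.
have icl : intg U (@cl R).
  apply: (intg_le _ _ (intg_cst U 1)) => [|s]; first by apply: continuous_measurable_fun; exact: cl_continuous.
  by have /andP[c0 c1] := cl01 s; rewrite ger0_norm.
have -> : avg g h x - avg g h y = Ex g (fun v => avgt h (x, v) - avgt h (y, v)).
  by rewrite ExB//; exact: intg_avgt.
rewrite -[leRHS](Ex_cst g); apply: Ex_le; first by apply: intgB; exact: intg_avgt.
  exact: intg_cst.
move=> v; rewrite -ExB; [|exact: iz (x, v)|exact: iz (y, v)].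
rewrite /= -Ex_cl -ExZ//; apply: Ex_le; last first.
- move=> s; apply: le_trans (hC _ _) _; rewrite cos_ang ger0_norm//.
  by have /andP[] := cl01 s.
- exact: intgZ.
- by apply: intgB; [exact: iz (x, v)|exact: iz (y, v)].
Qed.

Lemma avg_sum (u : 'I_n -> R) (h : 'I_n -> 'rV[R]_n -> R) x : (forall i, tame (h i)) ->
  avg g (fun x => \sum_i u i * h i x) x = \sum_i u i * avg g (h i) x.
Proof.
move=> th; have iz i := proj2 (intg_ang_poly gg (th i)).
transitivity (Ex g (fun v => \sum_i u i * avgt (h i) (x, v))).
  apply: eq_Ex => v; rewrite /avgt Ex_sum; last by move=> i; apply: intgZ; exact: iz (x, v).
  by apply: eq_bigr => i _; rewrite ExZ//; exact: iz (x, v).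
rewrite Ex_sum; last by move=> i; apply: intgZ; exact: intg_avgt.
by apply: eq_bigr => i _; rewrite ExZ//; exact: intg_avgt.
Qed.

Let t2G i : tame (fun x => 2 * G x ord0 i).
Proof. by apply: tameZ; exact: tame_G FG i. Qed.

Let dotp2G u : (fun x => dotp u (2 *: G x)) = fun x => \sum_i u ord0 i * (2 * G x ord0 i).
Proof. by apply/funext => y; apply: eq_bigr => i _; rewrite mxE. Qed.

Lemma dotp_mehler u x : dotp u (M x) = avg g (fun x => dotp u (2 *: G x)) x.
Proof.
by rewrite dotp2G avg_sum//; apply: eq_bigr => i _; rewrite mxE.
Qed.

Lemma dotp_enorm (x y : 'rV[R]_n) : dotp x y <= enorm x * enorm y.
Proof.
have e0 (z : 'rV[R]_n) : 0 <= enorm z by exact: sqrtr_ge0.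
apply: le_trans (ler_norm _) _; rewrite -ler_sqr ?nnegrE ?mulr_ge0//.
by rewrite real_normK ?num_real// exprMn !enorm_sqr; exact: dotp_CS.
Qed.

(** The field [2 *: G] has Lipschitz constant [2], and averaging halves it. *)
Lemma mehler_nonexpansive x y : dotp (M x - M y) (M x - M y) <= dotp (x - y) (x - y).
Proof.
have [_ _ _ hG] := FG; have e0 (z : 'rV[R]_n) : 0 <= enorm z by exact: sqrtr_ge0.
set u := M x - M y.
have H : dotp u u <= enorm u * enorm (x - y).
  have -> : dotp u u = avg g (fun x => dotp u (2 *: G x)) x - avg g (fun x => dotp u (2 *: G x)) y.
    by rewrite -!dotp_mehler -dotpBr.
  have -> : enorm u * enorm (x - y) = (2 * (enorm u * enorm (x - y))) / 2 by field.
  apply: avg_diff_le.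
    by rewrite dotp2G; apply: tame_sum => i; exact: tameZ.
  move=> t v; rewrite -dotpBr -scalerBr dotpZr -!mulrA; apply: ler_wpM2l => //.
  apply: le_trans (dotp_enorm _ _) _; apply: ler_wpM2l => //.
  rewrite -ler_sqr ?nnegrE ?mulr_ge0// exprMn !enorm_sqr real_normK ?num_real//.
  apply: le_trans (hG _ _) _.
  have -> : rx t x v - rx t y v = cos t *: (x - y) by apply/rowP => i; rewrite !mxE; ring.
  by rewrite dotpZl dotpZr le_eqVlt; apply/orP; left; apply/eqP; ring.
have [u0|u0] := eqVneq (enorm u) 0.
  by rewrite -enorm_sqr u0 expr0n/= dotp_ge0.
have up : 0 < enorm u by rewrite lt_neqAle eq_sym u0 e0.
move: H; rewrite -enorm_sqr expr2 ler_pM2l// => H.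
by rewrite -[leRHS]enorm_sqr -expr2 lerXn2r ?nnegrE.
Qed.

Lemma mehler_lip i x y : `|M x ord0 i - M y ord0 i| <= n.+1%:R * `|x - y|.
Proof. exact: nonexpansive_lip mehler_nonexpansive. Qed.

Lemma tame_M i : tame (fun x => M x ord0 i).
Proof. exact: (lipschitz_tame (ltr0Sn _ n) (mehler_lip i)). Qed.

Definition JM i := grd g (fun x => M x ord0 i).

Lemma has_grad_M i : has_grad g (fun x => M x ord0 i) (JM i).
Proof. exact: (lipschitz_has_grad gg (ltr0Sn _ n) (mehler_lip i)). Qed.

(** By [mehler], its mean is the variance of [F]; its fluctuations control the
    distance from the law of [F] to a Gaussian law. *)
Definition covT x := dotp (2 *: G x) (M x).

Let dTG x := \sum_i (2 * M x ord0 i) *: JG g G i x.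
Let dTM x := \sum_i (2 * G x ord0 i) *: JM i x.
Let dT x := dTG x + dTM x.

Lemma covTE x : covT x = \sum_i 2 * G x ord0 i * M x ord0 i.
Proof. by apply: eq_bigr => i _; rewrite mxE. Qed.

Lemma tame_covT : tame covT.
Proof.
rewrite (_ : covT = fun x => \sum_i 2 * G x ord0 i * M x ord0 i); last by apply/funext => x; exact: covTE.
by apply: tame_sum => i; apply: tameM => //; exact: tame_M.
Qed.

Let has_grad_covT : has_grad g covT dT.
Proof.
rewrite (_ : covT = fun x => \sum_i 2 * G x ord0 i * M x ord0 i); last by apply/funext => x; exact: covTE.
have H : has_grad g (fun x => \sum_i 2 * G x ord0 i * M x ord0 i)
   (fun x => \sum_i (M x ord0 i *: (2 *: JG g G i x) + (2 * G x ord0 i) *: JM i x)).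
  apply: has_grad_sum => i; apply: has_gradM => //.
  - exact: tame_M.
  - exact: (has_gradZ 2 (tame_G FG i) (has_grad_G gg FG i)).
  - exact: has_grad_M.
move: H; set D := (X in has_grad _ _ X); suff -> : D = dT by [].
apply/funext => x; rewrite /D /dT big_split/=; congr (_ + _).
by apply: eq_bigr => i _; rewrite scalerA mulrC.
Qed.

(** By convexity of the square. *)
Lemma mehler_sqr : Ex g (fun x => dotp (M x) (M x)) <= 4 * Ex g (fun x => dotp (G x) (G x)).
Proof.
have t4 i : tame (fun x => (2 * G x ord0 i) ^+ 2).
  by rewrite (_ : (fun x => _) = fun x => (2 * G x ord0 i) * (2 * G x ord0 i)); [exact: tameM|apply/funext => x; rewrite expr2].
rewrite Ex_sum; last by move=> i; apply: tame_intg => //; apply: tameM; exact: tame_M.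
rewrite Ex_sum; last by move=> i; apply: tame_intg => //; apply: tameM; exact: tame_G FG i.
rewrite mulr_sumr; apply: ler_sum => i _.
have [i4 E4] := Ex_avg (t4 i).
apply: (@le_trans _ _ (Ex g (avg g (fun x => (2 * G x ord0 i) ^+ 2)))).
  apply: Ex_le => //; first by apply: tame_intg => //; apply: tameM; exact: tame_M.
  by move=> x; rewrite -expr2 mxE; exact: avg_sqr_le.
rewrite E4 -ExZ; last by apply: tame_intg => //; apply: tameM; exact: tame_G FG i.
rewrite le_eqVlt; apply/orP; left; apply/eqP; apply: eq_Ex => x; ring.
Qed.

(** Poincare's inequality for [covT]. Its gradient is the sum of [2] times the
    transposed derivative of [G] applied to [M] and of [2] times that of [M]
    applied to [G]; both fields are nonexpansive. *)
Lemma variance_covT :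
  Ex g (fun x => covT x ^+ 2) - Ex g covT ^+ 2 <= 64 * Ex g (fun x => dotp (G x) (G x)).
Proof.
have := poincare gg tame_covT has_grad_covT.
have iM : intg g (fun x => dotp (M x) (M x)).
  by apply: intg_sum => i; apply: tame_intg => //; apply: tameM; exact: tame_M.
have iG := tame_intg gg (tame_sqr_G FG).
have [mdT _] := has_grad_covT.
have bd : {ae g, forall x, dotp (dT x) (dT x) <= 6 * dotp (M x) (M x) + 12 * dotp (G x) (G x)}.
  have aJG : {ae g, forall x, forall i, rder (fun x => G x ord0 i) x (JG g G i x)}.
    by apply: ae_forall_fin => i; have [_] := has_grad_G gg FG i.
  have aJM : {ae g, forall x, forall i, rder (fun x => M x ord0 i) x (JM i x)}.
    by apply: ae_forall_fin => i; have [_] := has_grad_M i.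
  apply: aeS2 aJG aJM => x h1 h2.
  have [_ _ _ hG] := FG.
  have hA : dotp (dTG x) (dTG x) <= 2 ^+ 2 * dotp (M x) (M x) := nonexpansive_gradientZ 2 (M x) hG h1.
  have hB : dotp (dTM x) (dTM x) <= 2 ^+ 2 * dotp (G x) (G x) := nonexpansive_gradientZ 2 (G x) mehler_nonexpansive h2.
  have -> : dT x = dTG x + dTM x by [].
  move: (dTG x) (dTM x) (M x) (G x) hA hB => A B m q hA hB.
  (* [|A + B|^2 <= 3/2 |A|^2 + 3 |B|^2] balances the two terms, as the mean of
     [|M|^2] is at most four times that of [|G|^2] *)
  rewrite dotpD2; have := dotp_ge0 (A - 2 *: B); rewrite dotpB2 !(dotpZl, dotpZr).
  move: (dotp A A) (dotp A B) (dotp B B) (dotp m m) (dotp q q) hA hB => a b c p r; lra.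
move=> H; have GG0 : 0 <= Ex g (fun x => dotp (G x) (G x)) by apply: Ex_ge0 => x; exact: dotp_ge0.
have K : Ex g (fun x : V n => dotp (dT x) (dT x)) <= 36 * Ex g (fun x => dotp (G x) (G x)).
  apply: (@le_trans _ _ (Ex g (fun x => 6 * dotp (M x) (M x) + 12 * dotp (G x) (G x)))).
    apply: Ex_le_ae => //.
      by apply: intg_sum => i; apply: intg_mul => //; exact: (tame_grad_sqr_intg gg i tame_covT has_grad_covT).
    by apply: intgD; apply: intgZ.
  rewrite ExD ?ExZ//; [|exact: intgZ|exact: intgZ].
  by have := mehler_sqr; lra.
have p12 := @pi_sqr_le12 R.
have q : (pi / 2 : R) ^+ 2 <= 3 by rewrite expr_div_n; lra.
have dd0 : 0 <= Ex g (fun x : V n => dotp (dT x) (dT x)) by apply: Ex_ge0 => x; exact: dotp_ge0.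
have : (pi / 2 : R) ^+ 2 * Ex g (fun x : V n => dotp (dT x) (dT x)) <= 3 * (36 * Ex g (fun x => dotp (G x) (G x))).
  by apply: ler_pM => //; exact: sqr_ge0.
lra.
Qed.

End covariance_representative.

(** * Stein's equation *)

Section stein_equation.
Context {R : realType}.
Local Notation MR := (measurableTypeR R).
Local Notation mu := (@lebesgue_measure R).
Notation Nm := (normal_prob 0 1 : probability MR R).
Local Notation pdf := (normal_pdf (0 : R) 1).

Lemma integral_normal (h : MR -> R) : measurable_fun setT h ->
  (\int[Nm]_x (h x)%:E = \int[mu]_x (h x * pdf x)%:E)%E.
Proof.
move=> mh; have mE : measurable_fun setT (EFin \o h) by apply/measurable_EFinP.
rewrite integralE [RHS]integralE; congr (_ - _)%E.
  rewrite ge0_integral_normal_prob//; last exact: measurable_funepos.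
  apply: eq_integral => x _; rewrite !funeposE -!EFin_max -EFinM; congr EFin.
  by rewrite maxr_pMl ?normal_pdf_ge0// mul0r.
rewrite ge0_integral_normal_prob//; last exact: measurable_funeneg.
apply: eq_integral => x _; rewrite !funenegE -!EFinN -!EFin_max -EFinM; congr EFin.
by rewrite maxr_pMl ?normal_pdf_ge0// mul0r mulNr.
Qed.

Lemma normal_pdfE0 (x : R) : pdf x = normal_peak 1 * expR (- x ^+ 2 / 2).
Proof. by rewrite normal_pdfE ?oner_eq0// /normal_fun subr0 expr1n. Qed.

Lemma pdf_gt0 (x : R) : 0 < pdf x.
Proof. by rewrite normal_pdfE0 mulr_gt0 ?expR_gt0// normal_peak_gt0 ?oner_eq0. Qed.

Lemma is_derive_pdf (x : R) : is_derive x (1 : R) pdf (- x * pdf x).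
Proof.
rewrite (_ : pdf = normal_peak 1 \*: (expR \o (fun x : R => (- 2^-1) * (x * x)))); last first.
  by apply/funext => y; rewrite normal_pdfE0 /=; congr (_ * expR _); field.
have h1 : is_derive x (1 : R) ((- 2^-1) \*: (id * id) : R -> R) (- x).
  have H := is_deriveZ (- 2^-1) (is_deriveM (is_derive_id x (1 : R)) (is_derive_id x (1 : R))).
  apply: (is_derive_eq H).
  by rewrite -[_ *: (_ + _)]/(_ * (x * 1 + x * 1)); field.
have h2 := @is_derive1_comp _ expR _ x _ _ (is_derive_expR _) h1.
have h3 := is_deriveZ (normal_peak 1) h2.
apply: (is_derive_eq h3) => /=.
set p := normal_peak 1; rewrite /GRing.scale/= /GRing.scale/=; ring.
Qed.

(** Divided by the density, it solves the differential equation
    [f' x = x * f x + k x]. *)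
Definition cum (k : R -> R) (x : R) : R := Ex Nm (fun t => \1_`]-oo, x] t * k t).

Lemma cum_derive (k : R -> R) (C x : R) : continuous k -> (forall t, `|k t| <= C) ->
  is_derive x (1 : R) (cum k) (k x * pdf x).
Proof.
move=> ck kC.
have mk : measurable_fun setT (k : MR -> MR) by exact: continuous_measurable_fun.
have mkp : measurable_fun setT (fun t => k t * pdf t : MR).
  by apply: measurable_funM => //; exact: measurable_normal_pdf.
have ip : mu.-integrable setT (EFin \o (fun t => k t * pdf t)).
  apply: (@le_integrable _ _ _ mu setT measurableT _ (fun t => (C * pdf t)%:E)).
  - exact/measurable_EFinP.
  - move=> t _ /=; rewrite lee_fin normrM (ger0_norm (normal_pdf_ge0 _ _ _)).
    apply: le_trans (ler_norm _); apply: ler_wpM2r => //; exact: normal_pdf_ge0.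
  - by have := integrableZl measurableT C (@integrable_normal_pdf R 0 1).
have cumE y : cum k y = (\int[mu]_(t in [set` `]-oo, y]]) (k t * pdf t))%R.
  rewrite /cum /Ex /Rintegral integral_normal; last first.
    by apply: measurable_funM => //; exact: measurable_indic.
  congr fine; rewrite [RHS]integral_mkcond; apply: eq_integral => t _.
  rewrite patchE indicE; case: (t \in _); first by rewrite mul1r.
  by rewrite !mul0r.
rewrite (_ : cum k = fun y => (\int[mu]_(t in [set` `]-oo, y]]) (k t * pdf t))%R); last first.
  by apply/funext => y; exact: cumE.
have xu : x < x + 1 by rewrite ltrDl.
have cx : {for x, continuous (fun t => k t * pdf t)}.
  apply: continuousM; first exact: ck.
  by apply: continuous_normal_pdf; rewrite oner_eq0.
have ip2 : mu.-integrable [set` `]-oo, (x + 1)%R]] (EFin \o (fun t => k t * pdf t)).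
  by apply: integrableS ip => //; exact: measurable_itv.
have [d e] := @continuous_FTC1 R (fun t => k t * pdf t) -oo%O x (x + 1) xu ip2 (ltNyr _) cx.
exact: (DeriveDef d (etrans (esym (derive1E _ _)) e)).
Qed.

Let ind_le1 (x t : R) : 0 <= (\1_`]-oo, x] t : R) <= 1.
Proof. by rewrite indicE; case: (_ \in _); rewrite /= ?lexx ?ler01. Qed.

Let indE (x t : R) : \1_`]-oo, x] t = (t <= x)%R%:R :> R.
Proof. by rewrite indicE; congr (nat_of_bool _)%:R; apply/idP/idP; rewrite inE/= in_itv. Qed.

Let icum (k : R -> R) (C x : R) : continuous k -> (forall t, `|k t| <= C) ->
  intg Nm (fun t => \1_`]-oo, x] t * k t).
Proof.
move=> ck kC; apply: (intg_le _ _ (intg_cst Nm C)).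
  by apply: measurable_funM => //; exact: continuous_measurable_fun.
move=> t; rewrite normrM indE normr_nat; apply: le_trans (kC t).
by case: (t <= x)%R; rewrite ?mul1r ?mul0r.
Qed.

Definition gcdf := cum (fun=> 1).

Let i1 x : intg Nm (fun t => \1_`]-oo, x] t * (1 : R)).
Proof. by apply: (@icum (fun=> 1) 1) => [|t]; [exact: cst_continuous|rewrite normr1]. Qed.

Let gcdf01 x : 0 <= gcdf x <= 1.
Proof.
apply/andP; split; first by apply: Ex_ge0 => t; rewrite mulr1; have /andP[] := ind_le1 x t.
rewrite -[leRHS](Ex_cst Nm); apply: Ex_le => //; first exact: intg_cst.
by move=> t; rewrite mulr1; have /andP[] := ind_le1 x t.
Qed.

Let gcdfC x : 1 - gcdf x = Ex Nm (fun t => 1 - \1_`]-oo, x] t * 1).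
Proof. by rewrite /gcdf /cum -{1}(Ex_cst Nm 1) -ExB//; exact: intg_cst. Qed.

(** Chebyshev's inequality for the two tails. *)
Let gcdf_left x : x < 0 -> gcdf x * x ^+ 2 <= 1.
Proof.
move=> x0; rewrite mulrC -ExZ// -[leRHS](@Ex_normal_sqr R); apply: Ex_le; first exact: intgZ.
  exact: intg_normal_sqr.
move=> t; rewrite (mulr1 (\1_`]-oo, x] t)) indE.
case: (leP t x) => tx; last by rewrite mulr0 sqr_ge0.
rewrite mulr1.
by rewrite -[leRHS]sqrrN -[leLHS]sqrrN lerXn2r ?nnegrE ?lerN2 ?oppr_ge0// ltW// (le_lt_trans tx).
Qed.

Let gcdf_right x : 0 < x -> (1 - gcdf x) * x ^+ 2 <= 1.
Proof.
move=> x0; have i2 : intg Nm (fun t => 1 - \1_`]-oo, x] t * 1) by apply: intgB => //; exact: intg_cst.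
rewrite gcdfC mulrC -ExZ// -[leRHS](@Ex_normal_sqr R); apply: Ex_le; first exact: intgZ.
  exact: intg_normal_sqr.
move=> t; rewrite (mulr1 (\1_`]-oo, x] t)) indE.
case: (leP t x) => tx; first by rewrite subrr mulr0 sqr_ge0.
by rewrite subr0 mulr1 lerXn2r ?nnegrE ?(ltW x0) ?(ltW tx)//= (ltW (lt_trans x0 tx)).
Qed.

Let dgcdf x : is_derive x (1 : R) gcdf (pdf x).
Proof.
have := @cum_derive (fun=> 1) 1 x (@cst_continuous _ _ _) (fun t => eq_ind_r (fun z => z <= 1) (lexx 1) (normr1 R)).
by rewrite mul1r.
Qed.

(** Mills' bounds for the Gaussian tails. The difference [q] of the two sides
    is nondecreasing; were it negative at [x], it would be at most [q x] at all
    points further left, which contradicts Chebyshev's inequality far away. The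
    right tail is symmetric. *)
Let mills_left x : - x * gcdf x <= pdf x.
Proof.
pose q := pdf + (id * gcdf).
have D y : is_derive y (1 : R) q (gcdf y).
  have H := is_deriveD (is_derive_pdf y) (is_deriveM (is_derive_id y (1 : R)) (dgcdf y)).
  apply: (is_derive_eq H).
  by rewrite -[y *: _]/(y * pdf y) -[_ *: 1]/(gcdf y * 1) mulr1 mulNr addrA addNr add0r.
suff : 0 <= q x by rewrite /q/= !fctE; lra.
rewrite leNgt; apply/negP => qx.
pose y := Num.min (- 1) (Num.min x (2 / q x)).
have yx : y <= x by rewrite /y !ge_min lexx orbT.
have y1 : y <= -1 by rewrite /y ge_min lexx.
have yq : y <= 2 / q x by rewrite /y !ge_min lexx !orbT.
have y0 : y < 0 by lra.
have [c _ E] := derive_mvt D yx; have /andP[c0 _] := gcdf01 c.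
have qy : q y <= q x by rewrite -subr_ge0 E mulr_ge0// subr_ge0.
have h1 := gcdf_left y0; have h2 := pdf_gt0 y.
have h3 : y * gcdf y <= q x by move: qy; rewrite {1}/q/= !fctE; lra.
have h4 : y * q x >= 2 by rewrite -ler_ndivlMr.
have h5 : y * q x <= y * (y * gcdf y) by apply: ler_wnM2l => //; exact: ltW.
by move: h5; rewrite mulrA -expr2 mulrC; lra.
Qed.

Let mills_right x : x * (1 - gcdf x) <= pdf x.
Proof.
pose q := pdf - (id * (cst 1 - gcdf)).
have D y : is_derive y (1 : R) q (- (1 - gcdf y)).
  have H := is_deriveB (is_derive_pdf y) (is_deriveM (is_derive_id y (1 : R)) (is_deriveB (is_derive_cst (1 : R) y 1) (dgcdf y))).
  apply: (is_derive_eq H).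
  rewrite /GRing.scale/= !fctE/=; ring.
suff : 0 <= q x by rewrite /q/= !fctE; lra.
rewrite leNgt; apply/negP => qx.
pose y := Num.max 1 (Num.max x (- 2 / q x)).
have yx : x <= y by rewrite /y !le_max lexx orbT.
have y1 : 1 <= y by rewrite /y le_max lexx.
have yq : - 2 / q x <= y by rewrite /y !le_max lexx !orbT.
have y0 : 0 < y by lra.
have [c _ E] := derive_mvt D yx; have /andP[_ c0] := gcdf01 c.
have qy : q y <= q x by rewrite -subr_le0 E mulr_le0_ge0// ?subr_ge0// oppr_le0 subr_ge0.
have h1 := gcdf_right y0; have h2 := pdf_gt0 y.
have h3 : - (y * (1 - gcdf y)) <= q x by move: qy; rewrite {1}/q/= !fctE; lra.
have h4 : y * q x <= - 2 by rewrite -ler_ndivrMr.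
have h5 : y * - (y * (1 - gcdf y)) <= y * q x by apply: ler_wpM2l => //; exact: ltW.
by move: h5; rewrite mulrN mulrA -expr2 mulrC; lra.
Qed.

(** The solution is the partial integral of the centred test function divided
    by the density. The partial integral is at most each of the two tails, so
    Mills' bounds control [x * f x], and the equation then controls [f']. *)
Lemma stein_solution (h : R -> R) : continuous h -> (forall x, 0 <= h x <= 1) ->
  exists f f' : R -> R,
  [/\ forall x, is_derive x (1 : R) f (f' x),
      forall x, f' x = x * f x + (h x - Ex Nm h) & forall x, `|f' x| <= 2].
Proof.
move=> ch h01; pose c := Ex Nm h; pose k x := h x - c.
have mh : measurable_fun setT (h : MR -> MR) by exact: continuous_measurable_fun.
have ih : intg Nm h.
  by apply: (intg_le mh _ (intg_cst Nm 1)) => x; have /andP[a b] := h01 x; rewrite ger0_norm.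
have c01 : 0 <= c <= 1.
  rewrite Ex_ge0/=; last by move=> x; have /andP[] := h01 x.
  rewrite -[leRHS](Ex_cst Nm); apply: Ex_le => //; first exact: intg_cst.
  by move=> x; have /andP[] := h01 x.
have k1 t : `|k t| <= 1.
  by have /andP[a b] := h01 t; have /andP[a' b'] := c01; rewrite ler_norml /k; lra.
have ck : continuous k by move=> x; apply: (@continuousB _ _ _ h (cst c)); [exact: ch|exact: cst_continuous].
have ik x := icum x ck k1.
have k0 : Ex Nm k = 0 by rewrite /k ExB//; [rewrite Ex_cst subrr|exact: intg_cst].
have ikk : intg Nm k by apply: intgB => //; exact: intg_cst.
have bl x : `|cum k x| <= gcdf x.
  apply: le_trans (Ex_norm (ik x)) _; apply: Ex_le => //; first exact: intg_abs.
  move=> t; have /andP[a _] := ind_le1 x t.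
  by rewrite normrM (ger0_norm a); apply: ler_wpM2l.
have br x : `|cum k x| <= 1 - gcdf x.
  have i3 : intg Nm (fun t => (1 - \1_`]-oo, x] t * 1) * k t).
    rewrite (_ : (fun t => _) = fun t => k t - \1_`]-oo, x] t * k t); first exact: intgB.
    by apply/funext => t; ring.
  have -> : cum k x = - Ex Nm (fun t => (1 - \1_`]-oo, x] t * 1) * k t).
    have e : Ex Nm (fun t : MR => (1 - \1_`]-oo, x] t * 1) * k t) = Ex Nm (fun t : MR => k t - \1_`]-oo, x] t * k t).
      by apply: eq_Ex => t; ring.
    by rewrite e (ExB ikk (ik x)) k0 sub0r opprK.
  rewrite normrN gcdfC; apply: le_trans (Ex_norm i3) _.
  apply: Ex_le; [exact: intg_abs|by apply: intgB => //; exact: intg_cst|].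
  move=> t; have /andP[_ a] := ind_le1 x t.
  have b : 0 <= 1 - \1_`]-oo, x] t * 1 :> R by rewrite mulr1 subr_ge0.
  by rewrite normrM (ger0_norm b) -[leRHS]mulr1; apply: ler_wpM2l.
pose f x := cum k x / pdf x; pose f' x := x * f x + k x.
exists f, f'; split=> //.
- move=> x; have p0 := pdf_gt0 x; have pn : pdf x != 0 by rewrite gt_eqF.
  have DV : is_derive x (1 : R) (fun y => (pdf y)^-1) (- (pdf x) ^- 2 *: (- x * pdf x)).
    split; first by apply: derivableV => //; exact: (@ex_derive _ _ _ _ _ _ _ (is_derive_pdf x)).
    rewrite deriveV//; last exact: (@ex_derive _ _ _ _ _ _ _ (is_derive_pdf x)).
    by rewrite (@derive_val _ _ _ _ _ _ _ (is_derive_pdf x)).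
  have H := is_deriveM (cum_derive x ck k1) DV.
  apply: (is_derive_eq H).
  rewrite /f' /f /GRing.scale/=; move: pn; move: (pdf x) => p pn; field; exact: pn.
- move=> x; rewrite /f'; apply: le_trans (ler_normD _ _) _.
  suff : `|x * f x| <= 1 by have := k1 x; lra.
  have p0 := pdf_gt0 x.
  rewrite /f mulrA normrM normfV (gtr0_norm p0) ler_pdivrMr// mul1r normrM.
  have [x0|x0] := leP 0 x.
    rewrite ger0_norm//; apply: le_trans (mills_right x); exact: ler_wpM2l.
  rewrite ltr0_norm//; apply: le_trans (mills_left x); apply: ler_wpM2l => //.
  by rewrite oppr_ge0 ltW.
Qed.

End stein_equation.

(** * From continuous test functions to the total variation distance *)

Section baire.
Context {R : realType}.
Local Notation MR := (measurableTypeR R).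

(** The Baire functions with values in [[0, 1]].  They contain the indicators of
    all Borel sets, and bounds on expectations pass from continuous functions to
    them by dominated convergence. *)
Inductive baire01 : (R -> R) -> Prop :=
| baire01_cts (f : R -> R) : continuous f -> (forall x, 0 <= f x <= 1) -> baire01 f
| baire01_lim (u : nat -> R -> R) (f : R -> R) : (forall k, baire01 (u k)) ->
    (forall x, u k x @[k --> \oo] --> f x) -> baire01 f.

Lemma baire01_itv f x : baire01 f -> 0 <= f x <= 1.
Proof.
elim=> {f} [f _|u f _ u01 uf]; first exact.
have cu : cvgn (u ^~ x) by apply/cvg_ex; exists (f x).
rewrite -(cvg_lim _ (uf x))//; apply/andP; split.
  by apply: limr_ge => //; apply: nearW => k; have /andP[] := u01 k.
by apply: limr_le => //; apply: nearW => k; have /andP[] := u01 k.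
Qed.

Lemma baire01_meas f : baire01 f -> measurable_fun setT (f : MR -> R).
Proof.
elim=> {f} [f cf _|u f _ mu uf]; first exact: continuous_measurable_fun.
by apply: (@measurable_fun_cvg _ MR _ _ u f mu) => x _; exact: uf.
Qed.

Lemma baire01C f : baire01 f -> baire01 (fun x => 1 - f x).
Proof.
elim=> {f} [f cf f01|u f _ IH uf].
  apply: baire01_cts => [x|x]; last by have := f01 x; lra.
  by apply: (@continuousB _ R R (cst (1 : R)) f); [exact: cst_continuous|exact: cf].
by apply: (baire01_lim IH) => x; apply: cvgB; [exact: cvg_cst|exact: uf].
Qed.

Lemma cvg_maxr (u v : nat -> R) a b : u k @[k --> \oo] --> a -> v k @[k --> \oo] --> b ->
  Num.max (u k) (v k) @[k --> \oo] --> Num.max a b.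
Proof.
move=> ua vb; rewrite (_ : (fun k => _) = fun k => (u k + v k + `|u k - v k|) / 2); last first.
  by apply/funext => k; rewrite maxr_absE.
rewrite maxr_absE; apply: cvgM; last exact: cvg_cst.
by apply: cvgD; [exact: cvgD|apply: cvg_norm; exact: cvgB].
Qed.

(** One argument is fixed at a time, first among all Baire functions and then
    among the continuous ones. *)
Lemma baire01_max f h : baire01 f -> baire01 h -> baire01 (fun x => Num.max (f x) (h x)).
Proof.
move=> bf; elim: bf h => {f} [f cf f01|u f _ IH uf] h bh; last first.
  apply: (baire01_lim (fun k => IH k h bh)) => x.
  by apply: cvg_maxr; [exact: uf|exact: cvg_cst].
elim: bh => {h} [h ch h01|u h _ IH uh].
  apply: baire01_cts => x.
    by apply: continuous_max; [exact: cf|exact: ch].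
  by have := f01 x; have := h01 x; rewrite /Num.max; case: ifP; lra.
apply: (baire01_lim IH) => x.
by apply: cvg_maxr; [exact: cvg_cst|exact: uh].
Qed.

Lemma baire01_ray (a : R) : baire01 (\1_[set` `]a, +oo[]).
Proof.
pose u k (x : R) := Num.min 1 (Num.max 0 (k%:R * (x - a))).
apply: (@baire01_lim u) => [k|x].
  apply: baire01_cts => x; last by rewrite /u le_min ler01 le_max lexx ge_min lexx.
  apply: (@continuous_min _ _ (cst 1) (fun y => Num.max 0 (k%:R * (y - a)))).
    exact: cst_continuous.
  apply: (@continuous_max _ _ (cst 0) (fun y => k%:R * (y - a))); first exact: cst_continuous.
  apply: (@continuousM _ _ (cst k%:R) (fun y => y - a)); first exact: cst_continuous.
  by apply: (@continuousB _ R R id (cst a)); [exact: id|exact: cst_continuous].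
rewrite indicE; apply: cvg_near_cst.
have [xa|xa] := leP x a.
  rewrite memNset/=; last by rewrite in_itv/= andbT; apply/negP; rewrite -leNgt.
  apply: nearW => k; rewrite /u max_l; first by rewrite min_r.
  by rewrite mulr_ge0_le0// subr_le0.
rewrite mem_set/=; last by rewrite in_itv/= xa.
near=> k; rewrite /u min_l// le_max; apply/orP; right.
rewrite -ler_pdivrMr ?subr_gt0// mul1r.
by near: k; exact: nbhs_infty_ger.
Unshelve. all: by end_near. Qed.

(** By the closure properties above, the sets with a Baire indicator form a
    sigma-algebra, which contains the rays. *)
Lemma baire01_indic (B : set MR) : measurable B -> baire01 (\1_B).
Proof.
have iC (A : set R) : \1_(setT `\` A) = (fun x => 1 - \1_A x) :> (R -> R).
  apply/funext => x; rewrite setTD !indicE in_setC.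
  by case: (x \in A); rewrite /= ?subrr ?subr0.
have iU (A C : set R) : \1_(A `|` C) = (fun x => Num.max (\1_A x) (\1_C x)) :> (R -> R).
  apply/funext => x; rewrite !indicE in_setU.
  by case: (x \in A); case: (x \in C); rewrite /= ?maxxx// /Num.max ?ltr01// ltr10.
have b0 : baire01 (\1_(set0 : set R)).
  by rewrite indic0; apply: baire01_cts => [|x]; [exact: cst_continuous|rewrite lexx ler01].
have -> : measurable B = <<s (@RGenOInfty.G R) >> B.
  by congr (_ B); exact: RGenOInfty.measurableE.
suff : <<s (@RGenOInfty.G R) >> `<=` [set A | baire01 (\1_A)] by exact.
apply: smallest_sub; last by move=> _ [a ->]; exact: baire01_ray.
split=> //= [A bA|A bA]; first by rewrite iC; exact: baire01C.
apply: (@baire01_lim (fun k => \1_(\big[setU/set0]_(i < k) A i))) => [k|x].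
  by elim/big_rec : _ => // i U _ bU; rewrite iU; exact: baire01_max.
rewrite indicE; apply: cvg_near_cst.
have [[i _ Aix]|nA] := pselect ((\bigcup_k A k) x).
  rewrite (mem_set (ex_intro2 _ _ i I Aix)).
  near=> k; rewrite indicE mem_set// -bigcup_mkord; exists i => //=.
  by near: k; exact: nbhs_infty_gt.
rewrite (memNset nA); apply: nearW => k; rewrite indicE memNset// -bigcup_mkord.
by move=> [i _ Aix]; apply: nA; exists i.
Unshelve. all: by end_near. Qed.

(** By induction on the Baire function [\1_B], with dominated convergence. *)
Lemma Ex_indic_le d1 d2 (T1 : measurableType d1) (T2 : measurableType d2)
    (P : probability T1 R) (Q : probability T2 R) (X : T1 -> R) (Z : T2 -> R) (c : R) :
  measurable_fun setT (X : T1 -> MR) -> measurable_fun setT (Z : T2 -> MR) ->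
  (forall h : R -> R, continuous h -> (forall x, 0 <= h x <= 1) ->
    `|Ex P (h \o X) - Ex Q (h \o Z)| <= c) ->
  forall B : set MR, measurable B ->
    (`|P (X @^-1` B) - Q (Z @^-1` B)| <= c%:E)%E.
Proof.
move=> mX mZ hc B mB.
have H f : baire01 f -> `|Ex P (f \o X) - Ex Q (f \o Z)| <= c.
  elim=> {f} [|u f bu IH uf]; first exact: hc.
  have bf := baire01_lim bu uf.
  have C d (T : measurableType d) (S : probability T R) (Y : T -> R) : measurable_fun setT (Y : T -> MR) ->
      Ex S (u k \o Y) @[k --> \oo] --> Ex S (f \o Y).
    move=> mY; have [|||||_] := @Ex_cvg _ _ _ S (fun k => u k \o Y) (f \o Y) (cst 1).
    - by move=> k; apply: (measurableT_comp (baire01_meas (bu k)) mY).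
    - exact: (measurableT_comp (baire01_meas bf) mY).
    - by apply: aeW => x; exact: uf.
    - by apply: aeW => x k; have /andP[a b] := baire01_itv (Y x) (bu k); rewrite ger0_norm.
    - exact: intg_cst.
    - exact.
  have cc : Ex P (u k \o X) - Ex Q (u k \o Z) @[k --> \oo] --> Ex P (f \o X) - Ex Q (f \o Z).
    by apply: cvgB; exact: C.
  exact: (norm_lim_le cc IH).
have E d (T : measurableType d) (S : probability T R) (Y : T -> R) : measurable_fun setT (Y : T -> MR) ->
    S (Y @^-1` B) = (Ex S (\1_B \o Y))%:E.
  move=> mY; have mYB : measurable (Y @^-1` B) by rewrite -[_ @^-1` _]setTI; exact: mY.
  have -> : Ex S (\1_B \o Y) = Ex S (\1_(Y @^-1` B)).
    by apply: eq_Ex => t; rewrite /= !indicE; congr (nat_of_bool _)%:R; apply/idP/idP; rewrite !inE.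
  rewrite -ExE; last first.
    apply: (intg_le _ _ (intg_cst S 1)); first exact: measurable_indic.
    by move=> x; rewrite indicE normr_nat lern1 leq_b1.
  by rewrite integral_indic// setIT.
by rewrite E// (E _ _ Q Z mZ) -EFinB abse_EFin lee_fin; apply: H; exact: baire01_indic.
Qed.

End baire.

(** * The discrepancy of the normalized statistic *)

Section discrepancy.
Context {R : realType} {n : nat}.
Local Notation V := (@rvm R).
Local Notation MR := (measurableTypeR R).
Notation Nm := (normal_prob 0 1 : probability MR R).
Variable g : probability (V n) R.
Hypothesis gg : std_gaussian g.
Variables (F : 'rV[R]_n -> R) (G : 'rV[R]_n -> 'rV[R]_n).
Hypothesis FG : envelope F G.

Let m := Ex g F.
Let v := Ex g (fun x => F x ^+ 2) - m ^+ 2.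
Let s := Num.sqrt v.
Hypothesis v0 : 0 < v.
Let W x := (F x - m) / s.
Let tF : tame F := tame_F FG.
Let tT : tame (covT g G) := tame_covT gg FG.
Let iT : intg g (covT g G) := tame_intg gg tT.
Let s0 : 0 < s. Proof. by rewrite sqrtr_gt0. Qed.

Let Ex_covT : Ex g (covT g G) = v.
Proof.
rewrite /v -(mehler gg FG tF (has_grad_F g FG)).
by congr (_ - _); apply: eq_Ex => x; rewrite expr2.
Qed.

Let tW : tame W.
Proof.
rewrite (_ : W = fun x => s^-1 * (F x + - m)); last by apply/funext => x; rewrite /W mulrC.
by apply: tameZ; apply: tameD => //; exact: tame_cst.
Qed.

Let has_grad_W : has_grad g W (fun x => s^-1 *: (2 *: G x)).
Proof.
rewrite (_ : W = fun x => s^-1 * (F x + - m)); last by apply/funext => x; rewrite /W mulrC.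
rewrite (_ : (fun x => _) = fun x => s^-1 *: (2 *: G x + 0)); last by apply/funext => x; rewrite addr0.
apply: has_gradZ => //; first by apply: tameD => //; exact: tame_cst.
by apply: has_gradD; [exact: has_grad_F|exact: has_grad_cst].
Qed.

Let Ex_sqr_dev : Ex g (fun x => (1 - covT g G x / v) ^+ 2) <= 64 * Ex g (fun x => dotp (G x) (G x)) / v ^+ 2.
Proof.
have vn : v != 0 by rewrite gt_eqF.
have iT2 : intg g (fun x => covT g G x * covT g G x) by exact: (tame_intg gg (tameM tT tT)).
have e : Ex g (fun x => (1 - covT g G x / v) ^+ 2) =
    1 - 2 / v * v + v ^- 2 * Ex g (fun x => covT g G x ^+ 2).
  transitivity (Ex g (fun x : V n => 1 - 2 / v * covT g G x + v ^- 2 * (covT g G x * covT g G x))).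
    by apply: eq_Ex => x; field.
  rewrite ExD; [|by apply: intgB; [exact: intg_cst|exact: intgZ]|exact: intgZ].
  rewrite ExB; [|exact: intg_cst|exact: intgZ].
  by rewrite Ex_cst (ExZ _ iT) Ex_covT (ExZ _ iT2).
rewrite e divfK// ler_pdivlMr ?exprn_gt0//.
have := variance_covT gg FG; rewrite Ex_covT.
have -> : (1 - 2 + v ^- 2 * Ex g (fun x => covT g G x ^+ 2)) * v ^+ 2 =
  Ex g (fun x => covT g G x ^+ 2) - v ^+ 2 by field.
exact.
Qed.

(** Let [f] solve Stein's equation for [h], and [T] be [covT g G]. Then the
    difference is the mean of [f' W - W * f W]. By Mehler's formula for [F]
    and [f W], it equals the mean of [f' W * (1 - T / v)], which is at most
    [2] times the standard deviation of [T / v], a variable of mean [1]. *)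
Lemma discrepancy_cts (h : R -> R) : continuous h -> (forall x, 0 <= h x <= 1) ->
  `|Ex g (h \o W) - Ex Nm h| <= 16 * Num.sqrt (Ex g (fun x => dotp (G x) (G x))) / v.
Proof.
move=> ch h01; have [f [f' [Df Ef f2]]] := stein_solution ch h01.
have cf : continuous f := derive_continuous Df.
have mh : measurable_fun setT (h : MR -> MR) by exact: continuous_measurable_fun.
have mf : measurable_fun setT (f : MR -> MR) by exact: continuous_measurable_fun.
have mf' : measurable_fun setT (f' : MR -> MR).
  rewrite (_ : f' = fun x => x * f x + (h x - Ex Nm h)); last by apply/funext.
  apply: measurable_funD; first exact: measurable_funM.
  by apply: measurable_funB => //; exact: measurable_cst.
have lf := derive_lipschitz Df f2.
pose H x := f (W x).
have tH : tame H := tame_comp lf tW.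
have gH : has_grad g H (fun x => f' (W x) *: (s^-1 *: (2 *: G x))) := has_grad_comp tW Df mf' has_grad_W.
have E := mehler gg FG tH gH.
have mW : measurable_fun setT (W : V n -> MR) := tame_meas tW.
have ifT : intg g (fun x => f' (W x) * covT g G x).
  apply: (intg_le _ _ (intgZ 2 (intg_abs iT))).
    by apply: measurable_funM; [exact: (measurableT_comp mf' mW)|exact: tame_meas tT].
  by move=> x; rewrite normrM ler_wpM2r.
have if' : intg g (fun x => f' (W x)).
  by apply: (intg_le (measurableT_comp mf' mW) _ (intg_cst g 2)) => x; exact: f2.
have ih : intg g (h \o W).
  apply: (intg_le (measurableT_comp mh mW) _ (intg_cst g 1)) => x.
  by have /andP[a b] := h01 (W x); rewrite ger0_norm.
have ER : Ex g (fun x => dotp (f' (W x) *: (s^-1 *: (2 *: G x))) (mehler_grad g G x)) =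
    s^-1 * Ex g (fun x => f' (W x) * covT g G x).
  by rewrite -(ExZ _ ifT); apply: eq_Ex => x; rewrite !dotpZl /covT !dotpZl; ring.
have iFH : intg g (fun x => F x * H x) := tame_intg gg (tameM tF tH).
have iH : intg g H := tame_intg gg tH.
have iWH : intg g (fun x => W x * f (W x)) := tame_intg gg (tameM tW tH).
have EW : Ex g (fun x => W x * f (W x)) = v^-1 * Ex g (fun x => f' (W x) * covT g G x).
  transitivity (Ex g (fun x : V n => s^-1 * (F x * H x - m * H x))).
    by apply: eq_Ex => x; rewrite /W /H; ring.
  rewrite (ExZ _ (intgB iFH (intgZ m iH))) (ExB iFH (intgZ m iH)) (ExZ _ iH) E ER mulrA.
  by rewrite -invfM -expr2 sqr_sqrtr// ltW.
pose dev x := 1 - covT g G x / v.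
have tdev : tame dev.
  rewrite (_ : dev = fun x => 1 + (- v^-1) * covT g G x); last by apply/funext => x; rewrite /dev; ring.
  by apply: tameD; [exact: tame_cst|exact: tameZ].
have idev : intg g dev := tame_intg gg tdev.
have -> : Ex g (h \o W) - Ex Nm h = Ex g (fun x => f' (W x) * dev x).
  transitivity (Ex g (fun x : V n => f' (W x) - v^-1 * (f' (W x) * covT g G x))); last first.
    by apply: eq_Ex => x; rewrite /dev; ring.
  rewrite (ExB if' (intgZ _ ifT)) (ExZ _ ifT) -EW -(ExB if' iWH).
  rewrite -[X in _ - X](Ex_cst g) -(ExB ih (intg_cst g _)).
  by apply: eq_Ex => x; rewrite Ef /=; ring.
have ifd : intg g (fun x => f' (W x) * dev x).
  apply: (intg_le _ _ (intgZ 2 (intg_abs idev))).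
    by apply: measurable_funM; [exact: (measurableT_comp mf' mW)|exact: tame_meas tdev].
  by move=> x; rewrite normrM ler_wpM2r.
apply: le_trans (Ex_norm ifd) _.
apply: (@le_trans _ _ (2 * Ex g (fun x => `|dev x|))).
  rewrite -(ExZ _ (intg_abs idev)); apply: Ex_le; [exact: intg_abs|exact: intgZ (intg_abs idev)|].
  by move=> x; rewrite normrM ler_wpM2r.
have e8 : 8 ^+ 2 = 64 :> R by ring.
have G0 : 0 <= Ex g (fun x => dotp (G x) (G x)) by apply: Ex_ge0 => x; exact: dotp_ge0.
have -> : 16 * Num.sqrt (Ex g (fun x => dotp (G x) (G x))) / v =
    2 * Num.sqrt (64 * Ex g (fun x => dotp (G x) (G x)) / v ^+ 2).
  rewrite -e8 sqrtrM; last by rewrite mulr_ge0// sqr_ge0.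
  rewrite sqrtrM ?sqr_ge0// sqrtr_sqr -exprVn sqrtr_sqr.
  by rewrite normfV (gtr0_norm v0) ger0_norm//; ring.
rewrite ler_pM2l//; apply: le_trans (ler_norm _) _.
rewrite -sqrtr_sqr ler_sqrt; last by rewrite divr_ge0 ?sqr_ge0// mulr_ge0.
apply: le_trans Ex_sqr_dev.
have -> : Ex g (fun x => dev x ^+ 2) = Ex g (fun x => `|dev x| ^+ 2).
  by apply: eq_Ex => x; rewrite -normrX ger0_norm// sqr_ge0.
apply: Ex_sqr_le; first by apply: measurableT_comp => //; exact: tame_meas tdev.
rewrite (_ : (fun x => _) = fun x => dev x * dev x); last first.
  by apply/funext => x; rewrite -normrX ger0_norm ?sqr_ge0// expr2.
exact: (tame_intg gg (tameM tdev tdev)).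
Qed.

Lemma discrepancy (B : set MR) : measurable B ->
  (`|g (W @^-1` B) - Nm B| <= (16 * Num.sqrt (Ex g (fun x => dotp (G x) (G x))) / v)%:E)%E.
Proof.
move=> mB; apply: (Ex_indic_le (tame_meas tW) (@measurable_id _ MR setT)) => // h ch h01.
exact: discrepancy_cts.
Qed.

End discrepancy.

(** * The law of a standard Gaussian vector *)

Import HBNNSimple.

(** Integrals only see functions up to null sets, even when the functions are
    not measurable: simple functions below them can be cut off on a null set. *)
Lemma integral_ae (R : realType) d (T : measurableType d) (P : probability T R) (f f' : T -> \bar R) :
  {ae P, forall x, f x = f' x} -> (\int[P]_x f x = \int[P]_x f' x)%E.
Proof.
have H (h h' : T -> \bar R) : (forall x, 0 <= h x)%E -> (forall x, 0 <= h' x)%E ->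
    {ae P, forall x, h x = h' x} -> (\int[P]_x h x <= \int[P]_x h' x)%E.
  move=> h0 h'0 [N [mN N0 Nh]].
  rewrite !ge0_integralTE//; apply: ub_ereal_sup => _ [s /= sh <-].
  pose s' := mul_nnsfun s (indic_nnsfun R (measurableC mN)).
  have s'E x : s' x = s x * (x \in ~` N)%:R by rewrite /s'/= mindicE.
  have -> : sintegral P s = sintegral P s'.
    have ms (k : {nnsfun T >-> R}) : measurable_fun setT (fun x => (k x)%:E).
      by apply/measurable_EFinP.
    have s0 (k : {nnsfun T >-> R}) x : setT x -> (0 <= (k x)%:E)%E by rewrite lee_fin.
    rewrite -!integralT_nnsfun.
    apply: (ge0_ae_eq_integral measurableT (ms s) (ms s') (s0 s) (s0 s')).
    exists N; split=> // x /= /not_implyP[_ e]; apply: contrapT => Nx; apply: e.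
    by rewrite /= mindicE mem_set ?mulr1.
  apply: ereal_sup_ubound; exists s' => // x; rewrite s'E.
  have [Nx|Nx] := pselect (N x); first by rewrite memNset ?mulr0//; move=> h1; exact: h1.
  rewrite mem_set// mulr1; apply: le_trans (sh x) _.
  by have -> : h x = h' x by apply: contrapT => e; apply: Nx; exact: Nh.
have E h h' : (forall x, 0 <= h x)%E -> (forall x, 0 <= h' x)%E ->
    {ae P, forall x, h x = h' x} -> (\int[P]_x h x = \int[P]_x h' x)%E.
  move=> h0 h'0 hh; apply/le_anti/andP; split; apply: H => //.
  by apply: aeS hh => x ->.
move=> ff; rewrite integralE [RHS]integralE; congr (_ - _)%E; apply: E => //.
  by apply: aeS ff => x e; rewrite !funeposE e.
by apply: aeS ff => x e; rewrite !funenegE e.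
Qed.

Lemma gaussian_law (R : realType) n d (T : measurableType d) (P : probability T R)
    (xi : T -> 'rV[R]_n) : standard_gaussian_vector P xi ->
  exists2 g : probability (rvm n) R, std_gaussian g & forall A, P (xi @^-1` A) = g A.
Proof.
move=> [mxi ind law]; have mX := measurable_rvm mxi.
pose X : {mfun T >-> rvm n} := HB.pack (xi : T -> rvm n) (isMeasurableFun.Build _ _ _ _ (xi : T -> rvm n) mX).
exists (distribution P X) => // B mB.
transitivity (P (\bigcap_i ((fun w => xi w ord0 i) @^-1` B i))).
  congr (P _); apply/seteqP; split=> [w h i _|w h i]; [exact: h|exact: (h i I)].
by rewrite ind//; apply: eq_bigr => i _; exact: law.
Qed.

(** * The bound *)

Section bound.
Context {R : realType} {n : nat}.
Local Notation V := (@rvm R).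
Local Notation MR := (measurableTypeR R).
Variable g : probability (V n) R.
Hypothesis gg : std_gaussian g.
Variables (F : 'rV[R]_n -> R) (G : 'rV[R]_n -> 'rV[R]_n).
Hypothesis FG : envelope F G.

Lemma Ex_sqr_G_gt0 : (exists x, G x != 0) -> 0 < Ex g (fun x => dotp (G x) (G x)).
Proof.
move=> [x Gx].
have G0 : 0 <= Ex g (fun x => dotp (G x) (G x)) by apply: Ex_ge0 => y; exact: dotp_ge0.
rewrite lt_neqAle G0 andbT eq_sym; apply/eqP => e.
have := Ex_abs_eq0 (tame_intg gg (tame_sqr_G FG)).
rewrite (@eq_Ex _ _ _ g _ (fun x : V n => dotp (G x) (G x))); last first.
  by move=> y; rewrite ger0_norm// dotp_ge0.
move=> /(_ e) ae0.
have cG : continuous (fun x => dotp (G x) (G x)) := tame_continuous (tame_sqr_G FG).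
have d0 : 0 < dotp (G x) (G x).
  by rewrite lt_neqAle dotp_ge0 andbT eq_sym; apply: contra Gx => /eqP/dotp_eq0 ->.
have : \forall y \near x, 0 < dotp (G y) (G y).
  exact: (@cvgr_gt _ _ _ _ (fun x => dotp (G x) (G x)) _ (cG x) 0 d0).
move=> /nbhs_normP[r /= r0 hr].
have [w [w0 wr]] := ae_dense gg x ae0 r0.
by have := hr w wr; rewrite /= w0 ltxx.
Qed.

(** When the denominator vanishes the right-hand side is infinite, as the
    numerator is positive. *)
Lemma tv_bound (B : set MR) : (exists x, G x != 0) -> measurable B ->
  (`|g ((fun x => (F x - Ex g F) / Num.sqrt (Ex g (fun x => F x ^+ 2) - Ex g F ^+ 2))%R @^-1` B)
     - normal_prob 0 1 B| <=
   8%:E * sqrte (Ex g (fun x : V n => dotp (G x) (G x)))%:E /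
   (2 * (\sum_i Ex g (fun x : V n => G x ord0 i) ^+ 2) +
    \sum_i \sum_j Ex g (fun x : V n => JG g G i x ord0 j) ^+ 2)%:E)%E.
Proof.
move=> G0 mB; have e0 := Ex_sqr_G_gt0 G0.
have := variance_lower_bound gg FG => vD.
set v := (Ex g (fun x => F x ^+ 2) - Ex g F ^+ 2)%R in vD *.
set D := (_ + _)%R in vD *.
have D0 : 0 <= D.
  rewrite /D addr_ge0 ?mulr_ge0//; first by apply: sumr_ge0 => i _; exact: sqr_ge0.
  by apply: sumr_ge0 => i _; apply: sumr_ge0 => j _; exact: sqr_ge0.
rewrite inver; have [_|Dn] := eqVneq D 0.
  by rewrite /= -EFinM gt0_muley ?leey// lte_fin mulr_gt0// sqrtr_gt0.
have {}D0 : 0 < D by rewrite lt_neqAle eq_sym Dn.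
have v0 : 0 < v by apply: lt_le_trans vD; rewrite mulr_gt0.
apply: le_trans (discrepancy gg FG v0 mB) _.
rewrite /= -!EFinM lee_fin ler_pdivrMr//.
apply: (@le_trans _ _ (8 * Num.sqrt (Ex g (fun x : V n => dotp (G x) (G x))) / D * (2 * D))).
  by rewrite le_eqVlt; apply/orP; left; apply/eqP; field.
apply: ler_wpM2l => //; apply: divr_ge0; last exact: ltW.
by apply: mulr_ge0 => //; exact: sqrtr_ge0.
Qed.

End bound.

Lemma envelope_proj (R : realType) n (K : set 'rV[R]_n) (mu0 : 'rV[R]_n) :
  closed K -> @convex_set R 'rV[R]_n K -> K mu0 -> envelope (Fp K mu0) (Gp K mu0).
Proof.
move=> Kcl Kcv mu0K; split; [exact: Fp0|exact: Gp0|exact: Fp_bounds|exact: Gp_nonexpansive].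
Qed.

Theorem theorem3p1 (R : realType) (n : nat) (K : set 'rV[R]_n)
    (mu0 : 'rV[R]_n)
    (K_closed : closed K)
    (K_convex : @convex_set R 'rV[R]_n K)
    (mu0K : K mu0)
    (K_neq1 : K <> [set mu0])
    (d : measure_display) (Omega : measurableType d) (P : probability Omega R)
    (xi : Omega -> 'rV[R]_n)
    (xi_gauss : standard_gaussian_vector P xi) :
  let Y := fun w => mu0 + xi w in
  let muhat := fun w => metric_proj K (Y w) in
  let J := fun w => jacobian (metric_proj K) (Y w) in
  let TY := fun w => lrt_stat K mu0 (Y w) in
  let m := fine 'E_P[TY] in
  let sigma := Num.sqrt (fine 'V_P[TY]) in
  (tv_dist (pushforward P (fun w => ((TY w - m) / sigma)%R)) (normal_prob 0 1)
   <= 8%:E * sqrte 'E_P[fun w => (enorm (muhat w - mu0) ^+ 2)%R]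
      / (2 * enorm (expectation_mx P muhat - mu0) ^+ 2
         + fnorm (expectation_mx P J) ^+ 2)%:E)%E.
Proof.
cbv beta zeta.
set TY := fun w => lrt_stat K mu0 (mu0 + xi w).
set m := fine 'E_P[TY]; set sigma := Num.sqrt (fine 'V_P[TY]).
set muhat := fun w => metric_proj K (mu0 + xi w).
set J := fun w => jacobian (metric_proj K) (mu0 + xi w).
have [g gg PX] := gaussian_law xi_gauss.
have [mxi _ _] := xi_gauss; have mX := measurable_rvm mxi.
have FG := envelope_proj K_closed K_convex mu0K.
set F := Fp K mu0 in FG; set G := Gp K mu0 in FG.
have tF := tame_F FG; have tG i := tame_G FG i.
have tr f : intg g f -> intg P (f \o xi) /\ Ex P (f \o xi) = Ex g f.
  by move=> i; apply: Ex_image => //.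
have EF : m = Ex g F by rewrite /m unlock; exact: (tr F (tame_intg gg tF)).2.
have EV : fine 'V_P[TY] = Ex g (fun x => F x ^+ 2) - Ex g F ^+ 2.
  have iF := tame_intg gg tF; have iFF := tame_intg gg (tameM tF tF).
  have iD : intg g (fun x => (F x - Ex g F) * (F x - Ex g F)).
    rewrite (_ : (fun x => _) = fun x => (F x + - Ex g F) * (F x + - Ex g F))//.
    by apply: (tame_intg gg); apply: tameM; apply: tameD => //; exact: tame_cst.
  transitivity (Ex g (fun x => (F x - Ex g F) * (F x - Ex g F))).
    by rewrite -(tr _ iD).2 /variance unlock -/m EF unlock.
  transitivity (Ex g (fun x : rvm n => F x * F x - 2 * Ex g F * F x + Ex g F ^+ 2)).
    by apply: eq_Ex => x; ring.
  rewrite ExD; [|by apply: intgB => //; exact: intgZ|exact: intg_cst].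
  rewrite (ExB iFF (intgZ _ iF)) (ExZ _ iF) Ex_cst.
  rewrite (_ : Ex g (fun x => F x * F x) = Ex g (fun x => F x ^+ 2)); first ring.
  by apply: eq_Ex => x; rewrite expr2.
have EG : ('E_P[fun w => (enorm (muhat w - mu0) ^+ 2)%R] = (Ex g (fun x => dotp (G x) (G x)))%:E)%E.
  have [i <-] := tr _ (tame_intg gg (tame_sqr_G FG)).
  by rewrite -ExE// unlock; apply: eq_integral => w _; rewrite enorm_sqr.
have EM : enorm (expectation_mx P muhat - mu0) ^+ 2 = \sum_i Ex g (fun x => G x ord0 i) ^+ 2.
  rewrite enorm_sqr; apply: eq_bigr => i _; rewrite -expr2; congr (_ ^+ 2).
  rewrite !mxE unlock.
  have [iG eG] := tr _ (tame_intg gg (tG i)).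
  have e w : muhat w ord0 i = G (xi w) ord0 i + mu0 ord0 i.
    by rewrite /G /Gp !mxE subrK.
  have -> : fine (\int[P]_w (muhat w ord0 i)%:E) = Ex P (fun w => G (xi w) ord0 i + mu0 ord0 i).
    by congr fine; apply: eq_integral => w _; rewrite e.
  rewrite (ExD iG (intg_cst P _)) Ex_cst addrK; exact: eG.
have EJ : fnorm (expectation_mx P J) ^+ 2 = \sum_i \sum_j Ex g (fun x => JG g G i x ord0 j) ^+ 2.
  rewrite /fnorm sqr_sqrtr; last first.
    by apply: sumr_ge0 => i _; apply: sumr_ge0 => j _; exact: sqr_ge0.
  rewrite exchange_big; apply: eq_bigr => j _; apply: eq_bigr => i _; congr (_ ^+ 2).
  rewrite mxE unlock.
  have [_ <-] := tr _ (tame_grad_intg gg i (tG j) (has_grad_G gg FG j)).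
  congr fine; apply: integral_ae.
  have fr : {ae g, forall x, forall j, frechet (fun x => G x ord0 j) x (JG g G j x)}.
    apply: ae_forall_fin => k.
    by apply: (rademacher gg (ltr0Sn R n)) => x y; exact: (envelope_lip FG).
  have [N [mN N0 NP]] := fr; exists (xi @^-1` N); split.
  - by rewrite -[_ @^-1` _]setTI; exact: mX.
  - by rewrite PX.
  move=> w /= ne; apply: NP => H; apply: ne; congr EFin.
  apply: (@frechet_jacobian _ _ _ _ (fun j => JG g G j (xi w))) => k e e0.
  have [dl dl0 hd] := H k e e0; exists dl => // h hh.
  have := hd h hh; rewrite /G /Gp !mxE addrA.
  by rewrite (_ : _ - mu0 ord0 k - (_ - mu0 ord0 k) = metric_proj K (mu0 + xi w + h) ord0 k -
    metric_proj K (mu0 + xi w) ord0 k)//; ring.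
rewrite EG EM EJ.
apply: ub_ereal_sup => _ [B mB <-].
have := tv_bound gg FG (Gp_neq0 K_closed mu0K K_neq1) mB.
by rewrite -EV -EF -PX.
Qed.
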